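(* Let $K$ be a finite field and let $R=KQ/I$ be a string algebra over $K$. Then $R$ is of hyperfinite type, i.e. the family of all finitely generated left $R$-modules is hyperfinite.
   Context: String algebra: $Q$ is a finite quiver with vertex set $Q_0$ and arrow set $Q_1$ ($s(\alpha)$, $t(\alpha)$ are the source and target of an arrow; in the path algebra $KQ$ the product $\beta\alpha$ means first $\alpha$, then $\beta$, so it requires $s(\beta)=t(\alpha)$). $I$ is an ideal of $KQ$ generated by monomials (paths) such that: (1) for each vertex there are at most two arrows with that source and at most two arrows with that target; (2) for any arrow $\alpha$ there is at most one arrow $\beta$ with $s(\beta)=t(\alpha)$ and $\beta\alpha\notin I$; (3) for any arrow $\alpha$ there is at most one arrow $\beta$ with $t(\beta)=s(\alpha)$ and $\alpha\beta\notin I$; (4) there is $q\ge1$ such that every path of length at least $q$ lies in $I$. Then $R=KQ/I$ is called a string algebra. A family $\mathcal F$ of finitely generated left $R$-modules is hyperfinite if for any $\epsilon>0$ there is a finite family $N_1,\dots,N_t$ of finitely generated $R$-modules such that for every $M\in\mathcal F$ there exist a submodule $P\subset M$ with $\dim_K(P)\ge(1-\epsilon)\dim_K(M)$ and non-negative integers $\alpha_1,\dots,\alpha_t$ with $P\cong\bigoplus_{i=1}^tN_i^{\alpha_i}$. *)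

(* Defs.v *)
From HB Require Import structures.
From mathcomp Require Import all_boot all_order all_algebra.
From mathcomp Require Import finmap.
From mathcomp.multinomials Require Import monalg.
From mathcomp Require Import reals.

Set Implicit Arguments.
Unset Strict Implicit.
Unset Printing Implicit Defensive.

Import GRing.Theory Num.Theory.
Local Open Scope ring_scope.

Record quiver := Quiver {
  vertex : finType;
  arrow : finType;
  source : arrow -> vertex;
  target : arrow -> vertex }.

Arguments source {q} a.
Arguments target {q} a.

Section Paths.
Variable Q : quiver.
Implicit Types (v : vertex Q) (l : seq (arrow Q)).

(* Arrows are listed in the order in which they are traversed, so the path
   written beta * alpha in the path algebra is [:: alpha; beta].  The starting
   vertex is recorded in order to have a trivial path at each vertex. *)
Fixpoint walk v l : bool :=
  if l is a :: l' then (source a == v) && walk (target a) l' else true.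

Definition walk_end v l : vertex Q := last v (map target l).

Record qpath := QPath {
  path_data :> vertex Q * seq (arrow Q);
  path_walk : walk path_data.1 path_data.2 }.

HB.instance Definition _ := [isSub for path_data].
HB.instance Definition _ := [Choice of qpath by <:].

Definition path_start (p : qpath) : vertex Q := p.1.
Definition path_arrows (p : qpath) : seq (arrow Q) := p.2.
Definition path_end (p : qpath) : vertex Q := walk_end p.1 p.2.
Definition path_length (p : qpath) : nat := size p.2.

Definition trivial_path v : qpath := @QPath (v, [::]) isT.

Lemma arrow_walk (a : arrow Q) : walk (source a) [:: a].
Proof. by rewrite /= eqxx. Qed.

Definition arrow_path (a : arrow Q) : qpath := @QPath (_, _) (arrow_walk a).

Lemma walk_cat v l1 l2 :
  walk v (l1 ++ l2) = walk v l1 && walk (walk_end v l1) l2.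
Proof. by elim: l1 v => //= a l IH v; rewrite IH andbA. Qed.

Lemma walk_end_cat v l1 l2 :
  walk_end v (l1 ++ l2) = walk_end (walk_end v l1) l2.
Proof. by rewrite /walk_end map_cat last_cat. Qed.

(* [path_comp p q] is "first q, then p", undefined unless q ends where p
   starts. *)
Definition path_comp (p q : qpath) : option qpath :=
  if path_end q == path_start p
  then insub (path_start q, path_arrows q ++ path_arrows p) else None.

Lemma path_compE (p q : qpath) : path_end q = path_start p ->
  exists2 r, path_comp p q = Some r &
    path_data r = (path_start q, path_arrows q ++ path_arrows p).
Proof.
move=> e; rewrite /path_comp e eqxx; case: insubP => [r _ <-|]; first by exists r.
rewrite /= walk_cat; case: p q e => [[v l] /= Hp] [[w k] /= Hq].
by rewrite /path_end /path_start /= => ->; rewrite Hq Hp.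
Qed.

Lemma path_compN (p q : qpath) : path_end q != path_start p ->
  path_comp p q = None.
Proof. by rewrite /path_comp => /negPf->. Qed.

Lemma path_compA (p q r : qpath) :
  obind (fun x => path_comp x r) (path_comp p q) =
  obind (path_comp p) (path_comp q r).
Proof.
case: (eqVneq (path_end q) (path_start p)) => [e1|n1];
  case: (eqVneq (path_end r) (path_start q)) => [e2|n2].
- have [x -> Ex] := path_compE e1; have [y -> Ey] := path_compE e2 => /=.
  have e3 : path_end r = path_start x by rewrite /path_start Ex.
  have e4 : path_end y = path_start p.
    by rewrite /path_end Ey /= walk_end_cat -[walk_end (path_start r) _]/(path_end r) e2.
  have [z -> Ez] := path_compE e3; have [w -> Ew] := path_compE e4.
  congr Some; apply: val_inj; rewrite /= Ez Ew.
  by rewrite /path_start /path_arrows Ex Ey /= catA.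
- rewrite (path_compN n2) /=; have [x -> Ex] := path_compE e1 => /=.
  by rewrite path_compN // /path_start Ex.
- rewrite (path_compN n1) /=; have [x -> Ex] := path_compE e2 => /=.
  by rewrite path_compN // /path_end Ex /= walk_end_cat -[walk_end (path_start r) _]/(path_end r) e2.
- by rewrite (path_compN n1) (path_compN n2).
Qed.

Lemma path_comp_trivl v (p : qpath) :
  path_comp (trivial_path v) p = if path_end p == v then Some p else None.
Proof.
case: eqVneq => [e|n]; last by rewrite path_compN.
have [x -> Ex] := @path_compE (trivial_path v) p e.
by congr Some; apply: val_inj; rewrite /= Ex cats0 -surjective_pairing.
Qed.

Lemma path_comp_trivr v (p : qpath) :
  path_comp p (trivial_path v) = if v == path_start p then Some p else None.
Proof.
case: eqVneq => [e|n]; last by rewrite path_compN.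
have [x -> Ex] := @path_compE p (trivial_path v) e.
by congr Some; apply: val_inj; rewrite /= Ex /path_start /= e -surjective_pairing.
Qed.

End Paths.

Section PathAlgebra.
Variables (K : fieldType) (Q : quiver).

Definition path_algebra : Type := {malg K[qpath Q]}.

HB.instance Definition _ := GRing.Lmodule.on path_algebra.

Implicit Types (f g h : path_algebra) (p q r : qpath Q).

Definition pbasis p : path_algebra := << p >>.

Definition opbasis (o : option (qpath Q)) : path_algebra :=
  if o is Some p then pbasis p else 0.

Definition pa_mul f g : path_algebra :=
  \sum_(p <- msupp f) \sum_(q <- msupp g)
     (f@_p * g@_q) *: opbasis (path_comp p q).

Definition pa_one : path_algebra := \sum_(v : vertex Q) pbasis (trivial_path v).

Local Notation B p q := (opbasis (path_comp p q)).

Lemma pa_basisE f : f = \sum_(p <- msupp f) f@_p *: pbasis p.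
Proof.
rewrite {1}[f]monalgE; apply: eq_bigr => p _.
by apply/malgP => k; rewrite mcoeffZ !mcoeffU mulr_natr.
Qed.

Lemma big_msupp (V : lmodType K) (F : qpath Q -> V) f (d : {fset qpath Q}) :
  (msupp f `<=` d)%fset ->
  \sum_(p <- msupp f) f@_p *: F p = \sum_(p <- d) f@_p *: F p.
Proof.
move=> le; apply: big_fset_incl => // p _ /mcoeff_outdom ->.
by rewrite scale0r.
Qed.

Lemma big_msuppP (V : lmodType K) (F : qpath Q -> V) a f g :
  \sum_(p <- msupp (a *: f + g)) (a *: f + g)@_p *: F p =
  a *: (\sum_(p <- msupp f) f@_p *: F p) + \sum_(p <- msupp g) g@_p *: F p.
Proof.
pose d := (msupp (a *: f + g) `|` (msupp f `|` msupp g))%fset.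
rewrite !(@big_msupp _ _ _ d) ?fsubsetUl //.
- rewrite scaler_sumr -big_split /=; apply: eq_bigr => p _.
  by rewrite mcoeffD mcoeffZ scalerDl scalerA.
- by apply/fsubsetP => x; rewrite !inE => ->; rewrite !orbT.
- by apply/fsubsetP => x; rewrite !inE => ->; rewrite !orbT.
Qed.

Lemma big_msuppU (V : lmodType K) (F : qpath Q -> V) p :
  \sum_(q <- msupp (pbasis p)) (pbasis p)@_q *: F q = F p.
Proof.
by rewrite msuppU oner_eq0 big_seq_fset1 mcoeffUU scale1r.
Qed.

Lemma pa_mulE f g : pa_mul f g =
  \sum_(p <- msupp f) f@_p *: \sum_(q <- msupp g) g@_q *: B p q.
Proof.
apply: eq_bigr => p _; rewrite scaler_sumr; apply: eq_bigr => q _.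
by rewrite scalerA.
Qed.

Lemma pa_mulEr f g : pa_mul f g =
  \sum_(q <- msupp g) g@_q *: \sum_(p <- msupp f) f@_p *: B p q.
Proof.
rewrite /pa_mul exchange_big /=; apply: eq_bigr => q _; rewrite scaler_sumr.
by apply: eq_bigr => p _; rewrite scalerA mulrC.
Qed.

Lemma pa_mul_linl g : linear (fun f => pa_mul f g).
Proof. by move=> a f1 f2 /=; rewrite !pa_mulE big_msuppP. Qed.

Lemma pa_mul_linr f : linear (pa_mul f).
Proof. by move=> a g1 g2 /=; rewrite !pa_mulEr big_msuppP. Qed.

Lemma pa_mulU p q : pa_mul (pbasis p) (pbasis q) = B p q.
Proof. by rewrite pa_mulE !big_msuppU. Qed.

Lemma pa_linear_ext (V : lmodType K) (F G : path_algebra -> V) :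
  linear F -> linear G -> (forall p, F (pbasis p) = G (pbasis p)) -> F =1 G.
Proof.
move=> lF lG e f.
pose F' : {linear path_algebra -> V} :=
  HB.pack F (GRing.isLinear.Build K path_algebra V _ F lF).
pose G' : {linear path_algebra -> V} :=
  HB.pack G (GRing.isLinear.Build K path_algebra V _ G lG).
rewrite [f]pa_basisE -[LHS]/(F' _) -[RHS]/(G' _) !linear_sum.
by apply: eq_bigr => p _; rewrite !linearZ /= e.
Qed.

Lemma pa_mulDl : left_distributive pa_mul +%R.
Proof.
by move=> f g h; have := pa_mul_linl h 1 f g; rewrite !scale1r.
Qed.

Lemma pa_mulDr : right_distributive pa_mul +%R.
Proof.
by move=> f g h; have := pa_mul_linr f 1 g h; rewrite !scale1r.
Qed.

Lemma pa_mul0l f : pa_mul 0 f = 0.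
Proof. by rewrite pa_mulE msupp0 big_seq_fset0. Qed.

Lemma pa_mul0r f : pa_mul f 0 = 0.
Proof. by rewrite pa_mulEr msupp0 big_seq_fset0. Qed.

Lemma pa_mulo_l p o :
  pa_mul (pbasis p) (opbasis o) = opbasis (obind (path_comp p) o).
Proof. by case: o => [q|] /=; rewrite ?pa_mulU ?pa_mul0r. Qed.

Lemma pa_mulo_r p o :
  pa_mul (opbasis o) (pbasis p) = opbasis (obind (fun q => path_comp q p) o).
Proof. by case: o => [q|] /=; rewrite ?pa_mulU ?pa_mul0l. Qed.

Lemma pa_mulA : associative pa_mul.
Proof.
move=> f g h.
apply: (@pa_linear_ext _ (fun x => pa_mul x (pa_mul g h))
                        (fun x => pa_mul (pa_mul x g) h)) => [||p].
- exact: pa_mul_linl.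
- by move=> a x y /=; rewrite pa_mul_linl pa_mul_linl.
apply: (@pa_linear_ext _ (fun y => pa_mul (pbasis p) (pa_mul y h))
                        (fun y => pa_mul (pa_mul (pbasis p) y) h)) => [||q].
- by move=> a x y /=; rewrite pa_mul_linl pa_mul_linr.
- by move=> a x y /=; rewrite pa_mul_linr pa_mul_linl.
apply: (@pa_linear_ext _ (fun z => pa_mul (pbasis p) (pa_mul (pbasis q) z))
          (fun z => pa_mul (pa_mul (pbasis p) (pbasis q)) z)) => [||r].
- by move=> a x y /=; rewrite !pa_mul_linr.
- by move=> a x y /=; rewrite !pa_mul_linr.
by rewrite !pa_mulU pa_mulo_l pa_mulo_r path_compA.
Qed.

Lemma pa_mul1l : left_id pa_one pa_mul.
Proof.
apply: pa_linear_ext => [|//|p]; first exact: pa_mul_linr.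
pose F : {linear path_algebra -> path_algebra} :=
  HB.pack (fun f => pa_mul f (pbasis p))
    (GRing.isLinear.Build K path_algebra path_algebra _ _ (pa_mul_linl (pbasis p))).
rewrite -[LHS]/(F _) linear_sum /= (bigD1 (path_end p)) //= big1 => [|v n].
  by rewrite pa_mulU path_comp_trivl eqxx addr0.
by rewrite pa_mulU path_comp_trivl eq_sym (negPf n).
Qed.

Lemma pa_mul1r : right_id pa_one pa_mul.
Proof.
apply: pa_linear_ext => [|//|p]; first exact: pa_mul_linl.
pose F : {linear path_algebra -> path_algebra} :=
  HB.pack (pa_mul (pbasis p))
    (GRing.isLinear.Build K path_algebra path_algebra _ _ (pa_mul_linr (pbasis p))).
rewrite -[LHS]/(F _) linear_sum /= (bigD1 (path_start p)) //= big1 => [|v n].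
  by rewrite pa_mulU path_comp_trivr eqxx addr0.
by rewrite pa_mulU path_comp_trivr (negPf n).
Qed.

HB.instance Definition _ := GRing.Zmodule_isPzRing.Build path_algebra
  pa_mulA pa_mul1l pa_mul1r pa_mulDl pa_mulDr.

Lemma pa_scaleAl (k : K) f g : k *: (f * g) = (k *: f) * g.
Proof.
have := pa_mul_linl g k f 0; rewrite pa_mul0l !addr0 => e.
exact: esym e.
Qed.

Lemma pa_scaleAr (k : K) f g : k *: (f * g) = f * (k *: g).
Proof.
have := pa_mul_linr f k g 0; rewrite pa_mul0r !addr0 => e.
exact: esym e.
Qed.

(* If Q has no vertices then KQ is the zero ring, so it is only a [pzRingType], for which
   [algType K] is not available; the K-algebra structure is carried by this
   (central) morphism instead. *)
Definition pa_scalar (k : K) : path_algebra := k *: (1 : path_algebra).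

Lemma pa_scalar_zmod : zmod_morphism pa_scalar.
Proof. by move=> a b; rewrite /pa_scalar scalerBl. Qed.

Lemma pa_scalar_monoid : monoid_morphism pa_scalar.
Proof.
split=> [|a b]; rewrite /pa_scalar ?scale1r //.
by rewrite -pa_scaleAl mul1r scalerA.
Qed.

HB.instance Definition _ :=
  GRing.isZmodMorphism.Build K path_algebra pa_scalar pa_scalar_zmod.
HB.instance Definition _ :=
  GRing.isMonoidMorphism.Build K path_algebra pa_scalar pa_scalar_monoid.

Lemma pa_scalar_mull k f : pa_scalar k * f = k *: f.
Proof. by rewrite /pa_scalar -pa_scaleAl mul1r. Qed.

Lemma pa_scalar_mulr k f : f * pa_scalar k = k *: f.
Proof. by rewrite /pa_scalar -pa_scaleAr mulr1. Qed.

Definition arr (a : arrow Q) : path_algebra := pbasis (arrow_path a).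

End PathAlgebra.

Arguments pbasis K {Q} p.
Arguments arr K {Q} a.

(* [ring_quotient] only covers proper ideals of commutative rings. *)

Definition two_sided (A : pzRingType) (S : {pred A}) : Prop :=
  forall a x, x \in S -> (a * x \in S) /\ (x * a \in S).

HB.mixin Record isTwoSided (A : pzRingType) (S : A -> bool) := {
  two_sided_subproof : two_sided S }.

#[short(type="ideal2")]
HB.structure Definition Ideal2 (A : pzRingType) :=
  {S of GRing.ZmodClosed A S & isTwoSided A S}.

Section QuotientRing.
Variables (A : pzRingType) (I : ideal2 A).

Definition quotient_ring : Type := Quotient.quot I.

HB.instance Definition _ := GRing.Zmodule.on quotient_ring.
HB.instance Definition _ :=
  EqQuotient.on quotient_ring.

Definition quotient_proj (a : A) : quotient_ring := \pi_(quotient_ring)%qT a.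

Local Notation pr := quotient_proj.

Lemma quotient_projP x y : reflect (pr x = pr y) (x - y \in I).
Proof. by rewrite Quotient.idealrBE; apply: eqP. Qed.

Lemma quotient_reprK (x : quotient_ring) : pr (repr x) = x.
Proof. exact: reprK. Qed.

Lemma quotient_proj_zmod : zmod_morphism pr.
Proof. by move=> x y; rewrite /pr !piE. Qed.

HB.instance Definition _ :=
  GRing.isZmodMorphism.Build A quotient_ring pr quotient_proj_zmod.

Definition quotient_mul (x y : quotient_ring) : quotient_ring :=
  pr (repr x * repr y).

Lemma quotient_mulE x y : quotient_mul (pr x) (pr y) = pr (x * y).
Proof.
apply/quotient_projP; set x' := repr _; set y' := repr _.
have hx : x' - x \in I by apply/quotient_projP; exact: quotient_reprK.
have hy : y' - y \in I by apply/quotient_projP; exact: quotient_reprK.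
have -> : x' * y' - x * y = x' * (y' - y) + (x' - x) * y.
  by rewrite mulrBr mulrBl addrA subrK.
by apply: rpredD; [case: (two_sided_subproof x' _ hy) | case: (two_sided_subproof y _ hx)].
Qed.

Lemma quotient_mulA : associative quotient_mul.
Proof.
move=> x y z; rewrite -[x]quotient_reprK -[y]quotient_reprK -[z]quotient_reprK.
by rewrite !quotient_mulE mulrA.
Qed.

Lemma quotient_mul1l : left_id (pr 1) quotient_mul.
Proof. by move=> x; rewrite -[x]quotient_reprK quotient_mulE mul1r. Qed.

Lemma quotient_mul1r : right_id (pr 1) quotient_mul.
Proof. by move=> x; rewrite -[x]quotient_reprK quotient_mulE mulr1. Qed.

Lemma quotient_mulDl : left_distributive quotient_mul +%R.
Proof.
move=> x y z; rewrite -[x]quotient_reprK -[y]quotient_reprK -[z]quotient_reprK.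
by rewrite -raddfD !quotient_mulE mulrDl raddfD.
Qed.

Lemma quotient_mulDr : right_distributive quotient_mul +%R.
Proof.
move=> x y z; rewrite -[x]quotient_reprK -[y]quotient_reprK -[z]quotient_reprK.
by rewrite -raddfD !quotient_mulE mulrDr raddfD.
Qed.

HB.instance Definition _ := GRing.Zmodule_isPzRing.Build quotient_ring
  quotient_mulA quotient_mul1l quotient_mul1r quotient_mulDl quotient_mulDr.

Lemma quotient_proj_monoid : monoid_morphism pr.
Proof. by split=> // x y; rewrite -quotient_mulE. Qed.

HB.instance Definition _ :=
  GRing.isMonoidMorphism.Build A quotient_ring pr quotient_proj_monoid.

End QuotientRing.

Arguments quotient_proj {A} I a.

Inductive ideal_gen (A : pzRingType) (S : A -> Prop) : A -> Prop :=
| ideal_gen_base x of S x : ideal_gen S x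
| ideal_gen0 : ideal_gen S 0
| ideal_genD x y of ideal_gen S x & ideal_gen S y : ideal_gen S (x + y)
| ideal_genMl a x of ideal_gen S x : ideal_gen S (a * x)
| ideal_genMr a x of ideal_gen S x : ideal_gen S (x * a).

Section StringAlgebra.
Variables (K : fieldType) (Q : quiver) (I : ideal2 (path_algebra K Q)).

Definition monomial_ideal : Prop :=
  exists Z : qpath Q -> Prop, forall x : path_algebra K Q,
    x \in I <-> ideal_gen (fun y => exists2 p, Z p & y = pbasis K p) x.

Definition string_ideal : Prop :=
  [/\ monomial_ideal,
      forall v : vertex Q,
        (#|[set a : arrow Q | source a == v]| <= 2)%N /\
        (#|[set a : arrow Q | target a == v]| <= 2)%N,
      forall a : arrow Q,
        (#|[set b : arrow Q |
             (source b == target a) && (arr K b * arr K a \notin I)%R]| <= 1)%N,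
      forall a : arrow Q,
        (#|[set b : arrow Q |
             (target b == source a) && (arr K a * arr K b \notin I)%R]| <= 1)%N
    & exists2 q : nat, (1 <= q)%N &
        forall p : qpath Q, (q <= path_length p)%N -> pbasis K p \in I].

Definition quotient_scalar : {rmorphism K -> quotient_ring I} :=
  quotient_proj I \o @pa_scalar K Q.

End StringAlgebra.

Section Modules.
Variables (K : fieldType) (R : pzRingType) (iota : {rmorphism K -> R}).

Definition fin_gen (M : lmodType R) : Prop :=
  exists (n : nat) (g : 'I_n -> M), forall m : M,
    exists c : 'I_n -> R, m = \sum_(i < n) c i *: g i.

(* M as a K-vector space, by restriction of scalars along iota. *)
Definition restr (M : lmodType R) : Type := M.

Section Restr.
Variable M : lmodType R.

HB.instance Definition _ := GRing.Zmodule.on (restr M).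

Definition restr_scale (k : K) (m : restr M) : restr M := iota k *: (m : M).

Lemma restr_scaleA a b m : restr_scale a (restr_scale b m) = restr_scale (a * b) m.
Proof. by rewrite /restr_scale scalerA rmorphM. Qed.

Lemma restr_scale1 : left_id 1 restr_scale.
Proof. by move=> m; rewrite /restr_scale rmorph1 scale1r. Qed.

Lemma restr_scaleDr : right_distributive restr_scale +%R.
Proof. by move=> a m n; exact: scalerDr. Qed.

Lemma restr_scaleDl m : {morph restr_scale^~ m : a b / a + b}.
Proof. by move=> a b; rewrite /restr_scale rmorphD; exact: scalerDl. Qed.

Definition restr_lmod : lmodType K :=
  HB.pack (restr M) (GRing.Zmodule_isLmodule.Build K (restr M)
    restr_scaleA restr_scale1 restr_scaleDr restr_scaleDl).

End Restr.

Definition has_dimK (M : lmodType R) (n : nat) : Prop :=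
  inhabited (Vector.axiom n (restr_lmod M)).

End Modules.

Section Submodule.
Variables (R : pzRingType) (M : lmodType R) (P : submodClosed M).

Record submodule : predArgType :=
  Submodule { submodule_val :> M; submodule_mem : submodule_val \in P }.

HB.instance Definition _ := [isSub for submodule_val].
HB.instance Definition _ := [Choice of submodule by <:].
HB.instance Definition _ := [SubChoice_isSubLmodule of submodule by <:].

End Submodule.

Section DirectSum.
Variables (R : pzRingType) (J : finType) (V : J -> lmodType R).

(* Direct sum of a finite family: the product, with pointwise operations. *)
Definition dsum : Type := {dffun forall j, V j}.

HB.instance Definition _ := Choice.on dsum.

Implicit Types x y z : dsum.

Definition dsum_zero : dsum := [ffun j => 0].
Definition dsum_opp x : dsum := [ffun j => - x j].
Definition dsum_add x y : dsum := [ffun j => x j + y j].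
Definition dsum_scale (a : R) x : dsum := [ffun j => a *: x j].

Lemma dsum_addA : associative dsum_add.
Proof. by move=> x y z; apply/ffunP => j; rewrite !ffunE addrA. Qed.
Lemma dsum_addC : commutative dsum_add.
Proof. by move=> x y; apply/ffunP => j; rewrite !ffunE addrC. Qed.
Lemma dsum_add0 : left_id dsum_zero dsum_add.
Proof. by move=> x; apply/ffunP => j; rewrite !ffunE add0r. Qed.
Lemma dsum_addN : left_inverse dsum_zero dsum_opp dsum_add.
Proof. by move=> x; apply/ffunP => j; rewrite !ffunE addNr. Qed.

HB.instance Definition _ := GRing.isZmodule.Build dsum
  dsum_addA dsum_addC dsum_add0 dsum_addN.

Lemma dsum_scaleA a b x : dsum_scale a (dsum_scale b x) = dsum_scale (a * b) x.
Proof. by apply/ffunP => j; rewrite !ffunE scalerA. Qed.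
Lemma dsum_scale1 : left_id 1 dsum_scale.
Proof. by move=> x; apply/ffunP => j; rewrite !ffunE scale1r. Qed.
Lemma dsum_scaleDr : right_distributive dsum_scale +%R.
Proof. by move=> a x y; apply/ffunP => j; rewrite !ffunE scalerDr. Qed.
Lemma dsum_scaleDl x : {morph dsum_scale^~ x : a b / a + b}.
Proof. by move=> a b; apply/ffunP => j; rewrite !ffunE scalerDl. Qed.

HB.instance Definition _ := GRing.Zmodule_isLmodule.Build R dsum
  dsum_scaleA dsum_scale1 dsum_scaleDr dsum_scaleDl.

End DirectSum.

Definition iso_mod (R : pzRingType) (M N : lmodType R) : Prop :=
  exists f : {linear M -> N}, bijective f.

Section Hyperfinite.
Variables (Re : realType) (K : fieldType) (R : pzRingType).
Variable iota : {rmorphism K -> R}.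

(* [F] is meant to consist of finitely generated modules; they are
   finite-dimensional when R is, so the dimensions below exist. *)
Definition hyperfinite (F : lmodType R -> Prop) : Prop :=
  forall eps : Re, 0 < eps ->
  exists (t : nat) (N : 'I_t -> lmodType R),
    (forall i, fin_gen (N i)) /\
    forall M : lmodType R, F M ->
      exists (P : submodClosed M) (alpha : 'I_t -> nat),
        (exists dP dM : nat,
           [/\ has_dimK iota (submodule P) dP,
               has_dimK iota M dM
             & (1 - eps) * dM%:R <= dP%:R :> Re]) /\
        iso_mod (submodule P) (dsum (fun i => {ffun 'I_(alpha i) -> N i})).

Definition hyperfinite_type : Prop := hyperfinite (@fin_gen R).

End Hyperfinite.

(* Main.v *)
(* Modules are cut up without classifying them.  At each vertex the arrows are distributed on two
   sides so that composites through a single side vanish.  For each side, images and preimages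
   along arrows generate a flag of subspaces of M_v, and the two flags split M_v into graded
   pieces.  Arrows identify graded pieces, at most one on each side of a piece, so that the pieces
   form paths and cycles along which vectors can be transported.  On a cycle the transport induces
   an automorphism of the graded piece, which splits into cyclic summands; the lifts of a cyclic
   summand can be closed up exactly, because transport in one of the two directions is nilpotent on
   each of the two subspaces spanning the denominator of the graded piece.  This yields a basis of M
   on which the arrows act along chains.  Cut the chains into blocks of length at most k: only
   O(dim M / k) basis vectors are moved out of the span of their block by some arrow, so the largest
   submodules contained in the spans of the blocks have a direct sum of codimension O(dim M / k).
   Over a finite field there are finitely many modules of dimension at most k. *)
Require Import Defs.
From HB Require Import structures.
From mathcomp Require Import all_boot all_order all_algebra reals.
From mathcomp Require Import finmap boolp zify.
From mathcomp.multinomials Require Import monalg.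

Set Implicit Arguments.
Unset Strict Implicit.
Unset Printing Implicit Defensive.

Import Order.TTheory GRing.Theory Num.Theory.

(** * Chains in graphs of degree two *)

(** The bound on moved vectors has to survive modules made of very many short chains. A chain of
    length [L > k] is cut into at most [L / k + 1] blocks with two ends each, so it has at most
    [4 L / k] moved vectors. A chain of length at most [k] is kept whole and must have none at all:
    otherwise a sum of many short chains would have a number of moved vectors proportional to its
    dimension. This is why the ends of a path must be killed by the outer arrows, and why the lifts
    of a cyclic summand must satisfy their relation exactly and not only modulo the denominator of
    the graded piece. Nilpotency enters in the passage from arrows to submodules: the paths that are
    nonzero in the algebra are finitely many and shorter than [q], and one of length [r] enlarges
    the span of a block by at most [r] times its number of moved vectors. The loss is therefore
    bounded by this number times a constant of the algebra, from which [k] is chosen. *)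

Section Chains.
Variables (N : finType) (R : rel (N * bool)).
Hypothesis Rsym : symmetric R.
Hypothesis Rirr : irreflexive R.
Hypothesis Rfun : forall h h1 h2, R h h1 -> R h h2 -> h1 = h2.
Implicit Types (h x y z : N * bool) (c : seq (N * bool)).

(* In a chain, [(n, d)] is the node [n] left through its side [d]. *)
Definition flip h : N * bool := (h.1, ~~ h.2).
(** [R] joins two sides; a chain coming from [h] enters the next node on the side opposite to the
    one through which it leaves, whence the flip. *)
Definition follow : rel (N * bool) := fun h h' => R h (flip h').
Notation nodes c := [seq x.1 | x <- c].

Lemma flipK : involutive flip.
Proof. by case=> n d; rewrite /flip /= negbK. Qed.

Lemma flip_neq h : flip h != h.
Proof. by case: h => n []; rewrite /flip xpair_eqE eqxx. Qed.

Lemma same_node x y : x.1 = y.1 -> x = y \/ x = flip y.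
Proof. by case: x y => [n []] [m []] /= ->; [left|right|right|left]. Qed.

(** Either a cycle, or a path both of whose outer sides are joined to nothing. A node whose two
    sides are joined to each other is a cycle of length one. *)
Definition component c :=
  if c is h :: c' then path follow h c' &&
    (follow (last h c') h ||
      [forall x, ~~ R (last h c') x] && [forall x, ~~ R (flip h) x])
  else false.

Lemma path_succ h c z : path follow h c -> z \in h :: c -> z != last h c ->
  exists2 w, w \in c & follow z w.
Proof.
elim: c h => [|a c IH] h /=; first by rewrite inE => _ /eqP->; rewrite eqxx.
case/andP=> ha pa; rewrite inE => /orP[/eqP->|zc] nz; first by exists a; rewrite ?mem_head.
by have [w wc zw] := IH a pa zc nz; exists w; rewrite // inE wc orbT.
Qed.

Lemma path_pred h c z : path follow h c -> z \in h :: c -> z != h ->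
  exists2 w, w \in belast h c & follow w z.
Proof.
elim: c h => [|a c IH] h /=; first by rewrite inE => _ /eqP->; rewrite eqxx.
case/andP=> ha pa; rewrite inE => /orP[/eqP->|zc] nz; first by rewrite eqxx in nz.
have [->|za] := eqVneq z a; first by exists h; rewrite ?mem_head.
by have [w wc zw] := IH a pa zc za; exists w; rewrite // inE wc orbT.
Qed.

Lemma uniq_nodes_inj c x y : uniq (nodes c) -> x \in c -> y \in c -> x.1 = y.1 -> x = y.
Proof.
elim: c => //= a c IH /andP[na uc]; rewrite !inE => /orP[/eqP->|xc] /orP[/eqP->|yc] e //.
- by case/negP: na; rewrite e map_f.
- by case/negP: na; rewrite -e map_f.
- exact: IH.
Qed.

Lemma component_closed c z x : component c -> z \in c ->
  R z x || R (flip z) x -> x.1 \in nodes c.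
Proof.
case: c => //= h c /andP[p cy] zc /orP[Rzx|Rzx].
- have [e|nz] := eqVneq z (last h c); last first.
    have [w wc zw] := path_succ p zc nz.
    by rewrite (Rfun Rzx zw) inE [_.1]/= map_f ?orbT.
  move: Rzx cy; rewrite e => Rzx /orP[lh|/andP[/forallP/(_ x)]]; last by rewrite Rzx.
  by rewrite (Rfun Rzx lh) mem_head.
- have [e|nz] := eqVneq z h; last first.
    have [w wc] := path_pred p zc nz; rewrite /follow Rsym => Rzw.
    by rewrite (Rfun Rzx Rzw) -map_cons map_f // lastI mem_rcons inE wc orbT.
  move: Rzx cy; rewrite e => Rhx /orP[|/andP[_ /forallP/(_ x)]]; last by rewrite Rhx.
  by rewrite /follow Rsym => Rhl; rewrite (Rfun Rhx Rhl) -map_cons map_f // mem_last.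
Qed.

(** A neighbour across an outer side either lengthens the chain or already lies on it. In the second
    case, since a side has at most one partner and is not joined to itself, the neighbour can only
    be the other outer side, and the chain is a cycle. *)
Lemma maximal_chain_component (U : {set N}) h c :
    (forall y x, y.1 \in U -> R y x -> x.1 \in U) ->
    {subset nodes (h :: c) <= U} -> uniq (nodes (h :: c)) -> path follow h c ->
    (forall h' c', {subset nodes (h' :: c') <= U} -> uniq (nodes (h' :: c')) ->
       path follow h' c' -> size c' <= size c) ->
  component (h :: c).
Proof.
move=> clU sub un p mx; rewrite /component p /=; set l := last h c.
have lc : l \in h :: c by exact: mem_last.
have unc : uniq (h :: c) by exact: map_uniq un.
have hc : h \notin c by case/andP: unc.
have lb : l \notin belast h c by move: unc; rewrite lastI rcons_uniq => /andP[].
have inU z : z \in h :: c -> z.1 \in U by move=> zc; apply: sub; rewrite map_f.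
have mb w : w \in belast h c -> w \in h :: c by rewrite lastI mem_rcons inE orbC => ->.
have [//|nlh /=] := boolP (follow l h).
have nR x : ~~ R l x.
  apply/negP => Rlx; set y := flip x.
  have ly : follow l y by rewrite /follow flipK.
  have [/mapP[z zc e]|ny] := boolP (y.1 \in nodes (h :: c)); last first.
    suff: size (rcons c y) <= size c by rewrite size_rcons ltnn.
    apply: (mx h).
    - move=> n; rewrite -rcons_cons map_rcons mem_rcons inE => /orP[/eqP->|/sub //].
      exact: (clU l x (inU _ lc) Rlx).
    - by rewrite -rcons_cons map_rcons rcons_uniq ny.
    - by rewrite rcons_path p.
  case: (same_node e) => ey.
    have [zh|nz] := eqVneq z h; first by move: nlh; rewrite -zh -ey ly.
    have [w wb wz] := path_pred p zc nz; move: wz ly; rewrite ey /follow Rsym => /Rfun H.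
    by rewrite Rsym => /H wl; rewrite -wl wb in lb.
  have xz : x = z by rewrite -(flipK x) -/y ey flipK.
  have [zl|nz] := eqVneq z l; first by move: Rlx; rewrite xz zl Rirr.
  have [w wc zw] := path_succ p zc nz; move: Rlx; rewrite xz Rsym => /(Rfun zw) fwl.
  have wl : w = l by apply: (uniq_nodes_inj un) => //; rewrite ?inE ?wc ?orbT // -fwl.
  by have := flip_neq w; rewrite fwl wl eqxx.
apply/andP; split; apply/forallP => // x; apply/negP => Rhx.
have xh : follow x h by rewrite /follow Rsym.
have [/mapP[z zc e]|nx] := boolP (x.1 \in nodes (h :: c)); last first.
  suff: size (h :: c) <= size c by rewrite ltnn.
  apply: (mx x) => //=; rewrite ?xh ?nx //.
  move=> n; rewrite inE => /orP[/eqP->|/sub //].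
  exact: (clU (flip h) x (inU h (mem_head _ _)) Rhx).
case: (same_node e) => ex.
  have [zl|nz] := eqVneq z l; first by have := nR (flip h); rewrite -zl -ex -[R _ _]/(follow x h) xh.
  have [w wc zw] := path_succ p zc nz.
  have := Rfun zw; rewrite -ex => /(_ _ xh) /(congr1 flip); rewrite !flipK => wh.
  by rewrite -wh wc in hc.
have [zh|nz] := eqVneq z h; first by move: Rhx; rewrite ex zh Rirr.
have [w wb] := path_pred p zc nz; rewrite /follow -ex Rsym => xw.
have wh := Rfun xw xh.
have {}wh' : w = h by apply: (uniq_nodes_inj un (mb _ wb) (mem_head _ _)); rewrite wh.
by have := flip_neq h; rewrite -wh wh' eqxx.
Qed.

(** A longest chain in [U] is a component, and since a component is closed under [R], removing its
    nodes leaves a closed set to which induction applies. *)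
Lemma components_exist (U : {set N}) : (forall y x, y.1 \in U -> R y x -> x.1 \in U) ->
  exists cs : seq (seq (N * bool)), [/\ all component cs, uniq (nodes (flatten cs)) &
    forall n, (n \in nodes (flatten cs)) = (n \in U)].
Proof.
have [m] := ubnP #|U|; elim: m U => // m IH U /ltnSE leU clU.
have [->|[n0 n0U]] := set_0Vmem U; first by exists [::]; split=> // n; rewrite !inE.
pose P k := `[< exists h c, [/\ size c = k, {subset nodes (h :: c) <= U},
   uniq (nodes (h :: c)) & path follow h c] >].
have exP : exists k, P k.
  exists 0; apply/asboolP; exists (n0, true), [::]; split=> // n.
  by rewrite inE => /eqP->.
have bP k : P k -> k <= #|U|.
  move=> /asboolP[h [c [<- sub un _]]]; have := uniq_leq_size un.
  move=> /(_ (enum U)) H; have := H _; rewrite /= size_map -cardE => /(_ _)/ltnW; apply.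
  by move=> n /sub; rewrite mem_enum.
have [k /asboolP[h [c [sc sub un p]]] kmax] := ex_maxnP exP bP.
have comp : component (h :: c).
  apply: (maximal_chain_component clU sub un p) => // h' c' s' u' p'; rewrite sc; apply: kmax.
  by apply/asboolP; exists h', c'.
pose U' := U :\: [set n in nodes (h :: c)].
have lt : #|U'| < m.
  apply: leq_trans leU; apply: proper_card; apply/properP; split; first exact: subsetDl.
  by exists h.1; rewrite ?sub ?mem_head // !inE eqxx.
have [|cs [al uc mc]] := IH U' lt.
  move=> y x; rewrite in_setD inE => /andP[ny yU] Ryx; rewrite in_setD inE (clU y) // andbT.
  apply: contra ny => /mapP[z zc e]; apply: (component_closed comp zc).
  by rewrite !(Rsym _ y); case: (same_node e) => <-; rewrite Ryx ?orbT.
exists ((h :: c) :: cs); split; first by rewrite /= al andbT; exact: comp.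
- rewrite [flatten _]/= -cat_cons map_cat cat_uniq un uc andbT; apply/hasPn => n.
  by rewrite mc in_setD inE => /andP[].
- move=> n; rewrite [flatten _]/= -cat_cons map_cat mem_cat mc in_setD inE.
  by case: (boolP (n \in nodes (h :: c))) => // /sub ->.
Qed.

End Chains.

Local Open Scope ring_scope.

(** * Cyclic decomposition of an endomorphism *)

Section CyclicDecomposition.
Variables (K : fieldType) (V : vectType K) (f : 'End(V)).
Implicit Types (p q : {poly K}) (u v w : V) (U W : {vspace V}).

(** This is [p(f) v], the action of [K[X]] on [V] through [f]. *)
Definition pact p v : V := \sum_(j < size p) p`_j *: iter j f v.

Lemma pactE n p v : (size p <= n)%N -> pact p v = \sum_(j < n) p`_j *: iter j f v.
Proof.
move=> le; rewrite /pact (big_ord_widen n (fun j => p`_j *: iter j f v) le).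
rewrite big_mkcond; apply: eq_bigr => j _.
by case: ltnP => // /(nth_default 0) ->; rewrite scale0r.
Qed.

Lemma iter_lin_is_linear j : linear (iter j f).
Proof. by elim: j => [|j IH] a u v //=; rewrite IH linearP. Qed.

Lemma pact_is_linear p : linear (pact p).
Proof.
move=> a u v; rewrite /pact scaler_sumr -big_split; apply: eq_bigr => j _ /=.
by rewrite iter_lin_is_linear scalerDr !scalerA mulrC.
Qed.

HB.instance Definition _ p :=
  GRing.isLinear.Build K V V _ (pact p) (pact_is_linear p).

Lemma pactP a p q v : pact (a *: p + q) v = a *: pact p v + pact q v.
Proof.
set n := maxn (size p) (size q).
have sn : (size (a *: p + q)%R <= n)%N.
  rewrite (leq_trans (size_polyD _ _)) // geq_max.
  by rewrite (leq_trans (size_scale_leq _ _)) ?leq_maxl ?leq_maxr.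
rewrite (pactE v sn) (@pactE n p) ?leq_maxl // (@pactE n q) ?leq_maxr //.
rewrite scaler_sumr -big_split; apply: eq_bigr => j _ /=.
by rewrite coefD coefZ scalerDl scalerA.
Qed.

Lemma pact0p v : pact 0 v = 0.
Proof. by rewrite /pact size_poly0 big_ord0. Qed.

Lemma pactD p q v : pact (p + q) v = pact p v + pact q v.
Proof. by have := pactP 1 p q v; rewrite !scale1r. Qed.

Lemma pactZ a p v : pact (a *: p) v = a *: pact p v.
Proof. by have := pactP a p 0 v; rewrite pact0p !addr0. Qed.

Lemma pactC c v : pact c%:P v = c *: v.
Proof. by rewrite (@pactE 1) ?size_polyC_leq1 // big_ord1 coefC. Qed.

Lemma pactMX p v : pact (p * 'X) v = f (pact p v).
Proof.
rewrite (@pactE (size p).+1); last first.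
  by rewrite (leq_trans (size_polyMleq _ _)) // size_polyX addn2.
rewrite big_ord_recl coefMX eqxx scale0r add0r /pact linear_sum.
by apply: eq_bigr => j _; rewrite coefMX /= linearZ.
Qed.

Lemma pactM p q v : pact (p * q) v = pact p (pact q v).
Proof.
elim/poly_ind: p v => [|p c IH] v; first by rewrite mul0r !pact0p.
rewrite mulrDl -mulrA ['X * q]mulrC mulrA pactD pactMX IH.
by rewrite pactD pactMX mul_polyC pactZ pactC.
Qed.

Lemma pactCA p q v : pact p (pact q v) = pact q (pact p v).
Proof. by rewrite -!pactM mulrC. Qed.

Lemma pact_iter j v : pact 'X^j v = iter j f v.
Proof.
elim: j => [|j IH]; first by rewrite expr0 pactC scale1r.
by rewrite exprSr pactMX IH.
Qed.

Lemma iter_stable U : (f @: U <= U)%VS -> forall j u, u \in U -> iter j f u \in U.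
Proof.
move=> fU j u uU; elim: j => //= j IH.
by apply: (subvP fU); exact: memv_img.
Qed.

Lemma pact_stable U : (f @: U <= U)%VS -> forall p u, u \in U -> pact p u \in U.
Proof.
move=> fU p u uU; apply: rpred_sum => j _.
by apply: rpredZ; exact: iter_stable.
Qed.

Lemma nth_traj n (j : 'I_n) v : (traject f v n)`_j = iter j f v.
Proof. by rewrite (set_nth_default v) ?size_traject // nth_traject. Qed.

Lemma traject_dep n v : ~~ free (traject f v n) ->
  exists p : {poly K}, [/\ p != 0, (size p <= n)%N & pact p v = 0].
Proof.
move=> nf; have sn : size (traject f v n) == n by rewrite size_traject.
have : ~~ free (Tuple sn) by [].
case: n sn nf => [|n] sn _; first by rewrite /= nil_free.
move/freeP => H.
have [k] : exists k : 'I_n.+1 -> K, ~ (\sum_(i < n.+1) k i *: (Tuple sn)`_i = 0 ->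
    forall i : 'I_n.+1, k i = 0) by apply/existsNP.
move/not_implyP=> [e /existsNP[i /eqP ki]].
pose p := \poly_(j < n.+1) k (inord j).
have cp (j : 'I_n.+1) : p`_j = k j by rewrite coef_poly ltn_ord inord_val.
exists p; split; rewrite ?size_poly //.
  by apply: contraNneq ki => p0; rewrite -cp p0 coef0.
rewrite (@pactE n.+1) ?size_poly // -[RHS]e.
by apply: eq_bigr => j _; rewrite cp nth_traj.
Qed.

Lemma span_trajectP n v w : w \in <<traject f v n>>%VS ->
  exists2 p : {poly K}, (size p <= n)%N & w = pact p v.
Proof.
elim: n w => [|n IH] w; first by rewrite span_nil memv0 => /eqP->;
   exists 0; rewrite ?size_poly0 ?pact0p.
rewrite trajectSr -cats1 span_cat span_seq1 => /memv_addP[x /IH[p sp ->]].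
case=> y /vlineP[k ->] ->; exists (p + k *: 'X^n); last by rewrite pactD pactZ pact_iter.
rewrite (leq_trans (size_polyD _ _)) // geq_max (leqW sp) /=.
by rewrite (leq_trans (size_scale_leq _ _)) // size_polyXn.
Qed.

Lemma mem_span_traject n p v : (size p <= n)%N -> pact p v \in <<traject f v n>>%VS.
Proof.
move=> sp; apply: rpred_sum => j _; apply: rpredZ; apply: memv_span.
by apply/trajectP; exists j => //; exact: leq_trans (ltn_ord j) sp.
Qed.

(** Fitting decomposition for [p(f)]: once the images of [U] under the powers of [p(f)] have reached
    their least dimension, the power is injective on its own image, so kernel and image are
    complementary. *)
Lemma fitting p U : (f @: U <= U)%VS ->
  exists U1 U2 N,
    [/\ (f @: U1 <= U1)%VS /\ (f @: U2 <= U2)%VS, (U1 + U2 = U)%VS,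
      (U1 :&: U2 = 0)%VS, forall u, u \in U1 -> pact (p ^+ N) u = 0 &
      forall u, u \in U -> pact p u = 0 -> u \in U1].
Proof.
move=> fU; pose G n : 'End(V) := linfun (pact (p ^+ n)).
have GE n u : G n u = pact (p ^+ n) u by rewrite lfunE.
have Gadd m n W : (G (m + n)%N @: W = G m @: (G n @: W))%VS.
  rewrite -limg_comp; congr (_ @: _)%VS; apply/lfunP => u.
  by rewrite comp_lfunE !GE exprD pactM.
have GU n : (G n @: U <= U)%VS.
  by apply/subvP => _ /memv_imgP[u uU ->]; rewrite GE pact_stable.
have [N0 minN] : exists N, forall n, (\dim (G N @: U) <= \dim (G n @: U))%N.
  have [//|d /asboolP[N <-] dmin] := ex_minnP (P := fun d => `[< exists n, \dim (G n @: U) = d >]).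
    by exists (\dim (G 0 @: U)); apply/asboolP; exists 0.
  by exists N => n; apply: dmin; apply/asboolP; exists n.
(* The exponent is made positive so that the kernel of [p(f)] itself lies in the first summand. *)
pose N := N0.+1; pose I := (G N @: U)%VS.
have dI n : (\dim I <= \dim (G n @: U))%N.
  apply: leq_trans (minN n); rewrite /I /N -addn1 Gadd dimvS //.
  by apply: limgS; exact: GU.
have I0 : (I :&: lker (G N) = 0)%VS.
  apply/eqP; rewrite -dimv_eq0 -leqn0 -(leq_add2r (\dim (G N @: I))).
  by rewrite limg_ker_dim add0n /I -Gadd dI.
exists (U :&: lker (G N))%VS, I, N; split; first split.
- apply/subvP => _ /memv_imgP[u /memv_capP[uU ku] ->]; rewrite memv_cap memv_ker.
  rewrite (subvP fU) ?memv_img //=; move: ku; rewrite memv_ker !GE => /eqP e.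
  by rewrite -[f u]/(iter 1 f u) -pact_iter pactCA e linear0.
- apply/subvP => _ /memv_imgP[_ /memv_imgP[u uU ->] ->].
  rewrite GE -[f _]/(iter 1 f _) -pact_iter pactCA -GE memv_img // pact_iter.
  by apply: (subvP fU); exact: memv_img.
- have s : ((U :&: lker (G N)) + I <= U)%VS by rewrite subv_add capvSl GU.
  apply/eqP; rewrite eqEdim s /= -(leq_add2r (\dim ((U :&: lker (G N)) :&: I))).
  rewrite dimv_sum_cap limg_ker_dim -capvA [(lker _ :&: I)%VS]capvC I0 capv0.
  by rewrite dimv0 addn0.
- by rewrite -capvA [(lker _ :&: I)%VS]capvC I0 capv0.
- by move=> u /memv_capP[_]; rewrite memv_ker GE => /eqP.
- move=> u uU e; rewrite memv_cap uU memv_ker GE exprSr pactM e linear0.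
  exact/eqP.
Qed.

(** The remainder of [g] modulo [p] kills [p(f)^e w], so it is 0 by the injectivity hypothesis.
    Hence [p] divides [g], and the quotient kills [p(f) w], whose order is one less. *)
Lemma order_lower_bound U p : (f @: U <= U)%VS ->
    (forall (q : {poly K}) u, q != 0 -> (size q < size p)%N -> u \in U -> pact q u = 0 -> u = 0) ->
  p != 0 -> forall e w (g : {poly K}), w \in U -> pact (p ^+ e.+1) w = 0 ->
  pact (p ^+ e) w != 0 -> g != 0 -> pact g w = 0 -> (e.+1 * (size p).-1 < size g)%N.
Proof.
move=> fU inj p0.
have mod0 e w g : w \in U -> pact (p ^+ e.+1) w = 0 -> pact (p ^+ e) w != 0 ->
    pact g w = 0 -> g %% p = 0.
  move=> wU pe pe1 gw; apply: contraNeq pe1 => r0; apply/eqP.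
  apply: (inj _ _ r0); rewrite ?ltn_modp //; first exact: pact_stable.
  rewrite pactCA; have : pact (p ^+ e) (pact g w) = 0 by rewrite gw linear0.
  rewrite {1}(divp_eq g p) pactD linearD /= -[X in X + _]pactM mulrCA -exprSr.
  by rewrite pactM pe linear0 add0r.
elim=> [|e IH] w g wU pe pe1 g0 gw; have r0 := mod0 _ _ _ wU pe pe1 gw.
all: have eg : g = (g %/ p) * p by rewrite {1}(divp_eq g p) r0 addr0.
all: have q0 : g %/ p != 0 by apply: contraNneq g0 => q0; rewrite eg q0 mul0r.
all: have sp : size g = (size (g %/ p)%R + (size p).-1)%N
  by rewrite {1}eg size_mul // -!subn1 addnBA // lt0n size_poly_eq0.
- by rewrite sp mul1n -[X in (X < _)%N]add0n ltn_add2r lt0n size_poly_eq0.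
rewrite sp mulSn addnC ltn_add2r; apply: (IH (pact p w)) => //.
- exact: pact_stable.
- by rewrite -pactM -exprSr.
- by rewrite -pactM -exprSr.
- by rewrite -pactM -eg.
Qed.

(** A polynomial [p] of least size that kills a nonzero vector of [U] serves as an irreducible
    factor. By the Fitting decomposition a power of [p] kills all of [U]. A vector of maximal order
    then generates a cyclic subspace that has a stable complement, so this complement is 0. *)
Lemma cyclic_of_indecomposable U : (f @: U <= U)%VS -> U != 0%VS ->
    (forall U1 U2, (f @: U1 <= U1)%VS -> (f @: U2 <= U2)%VS -> (U1 + U2 = U)%VS ->
       (U1 :&: U2 = 0)%VS -> U1 = 0%VS \/ U2 = 0%VS) ->
  exists v (p : {poly K}), [/\ v \in U, p \is monic, (1 < size p)%N, pact p v = 0 &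
    basis_of U (traject f v (size p).-1)].
Proof.
move=> fU U0 ind.
have [//|d /asboolP[p [p0 sp [u0 [u0U u00 pu0]]]] dmin] :=
  ex_minnP (P := fun d => `[< exists p : {poly K}, [/\ p != 0, size p = d &
      exists u, [/\ u \in U, u != 0 & pact p u = 0]] >]).
  have [p [p0 _ pu]] : exists p : {poly K},
      [/\ p != 0, (size p <= (\dim {:V}).+1)%N & pact p (vpick U) = 0].
    apply: traject_dep; apply/negP => /eqP; rewrite size_traject => e.
    by have := dimvS (subvf <<traject f (vpick U) (\dim {:V}).+1>>); rewrite e ltnn.
  by exists (size p); apply/asboolP; exists p; split => //; exists (vpick U);
    rewrite memv_pick vpick0.
wlog mp : p p0 sp pu0 / p \is monic.
  move=> H; have l0 : lead_coef p != 0 by rewrite lead_coef_eq0.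
  apply: (H ((lead_coef p)^-1 *: p)); rewrite ?scaler_eq0 ?invr_eq0 ?negb_or ?l0 //.
  - by rewrite size_scale ?invr_eq0.
  - by rewrite pactZ pu0 scaler0.
  - by rewrite monicE lead_coefZ mulVf.
have inj q u : q != 0 -> (size q < size p)%N -> u \in U -> pact q u = 0 -> u = 0.
  move=> q0 sq uU qu; apply/eqP/negPn/negP => un0.
  suff: (size p <= size q)%N by rewrite leqNgt sq.
  rewrite sp; apply: dmin; apply/asboolP; exists q; split => //.
  by exists u.
have [N nil] : exists N, forall u, u \in U -> pact (p ^+ N) u = 0.
  have [U1 [U2 [N [[s1 s2] es i0 n1 k1]]]] := fitting p fU.
  have U1n0 : U1 != 0%VS.
    by apply: contraNneq u00 => e; have := k1 _ u0U pu0; rewrite e memv0.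
  case: (ind U1 U2 s1 s2 es i0) => e0; first by rewrite e0 eqxx in U1n0.
  by exists N; move: n1; rewrite -es e0 addv0.
have [//|e /asboolP nile emin] :=
  ex_minnP (P := fun N => `[< forall u, u \in U -> pact (p ^+ N) u = 0 >]).
  by exists N; apply/asboolP.
case: e nile emin => [|e] nile emin.
  by have := nile _ u0U; rewrite expr0 pactC scale1r => /eqP; rewrite (negPf u00).
have [v vU pv] : exists2 v, v \in U & pact (p ^+ e) v != 0.
  apply: contrapT => H; suff: (e.+1 <= e)%N by rewrite ltnn.
  apply: emin; apply/asboolP => u uU; apply/eqP/negPn/negP => ne.
  by apply: H; exists u.
have s1p : (1 < size p)%N.
  rewrite ltnNge; apply/negP => /size1_polyC pc; move: pu0 p0; rewrite pc pactC => /eqP.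
  by rewrite scaler_eq0 (negPf u00) orbF polyC_eq0 => ->.
pose n := (e.+1 * (size p).-1)%N; pose P := p ^+ e.+1.
have mP : P \is monic by exact: monic_exp.
have sP : size P = n.+1.
  by rewrite -[LHS]prednK ?size_poly_gt0 ?monic_neq0 // size_exp mulnC.
have n0 : (0 < n)%N by rewrite muln_gt0 /= -subn1 subn_gt0.
have fr : free (traject f v n).
  apply: contraT => /traject_dep[g [g0 sg gv]].
  have := order_lower_bound fU inj p0 vU (nile v vU) pv g0 gv.
  by rewrite ltnNge sg.
exists v, P; split; rewrite ?sP ?ltnS //=; first exact: nile.
pose C := <<traject f v n>>%VS.
have dC : \dim C = n by move/eqP: fr; rewrite size_traject.
have CU : (C <= U)%VS.
  by apply/span_subvP => _ /trajectP[j _ ->]; exact: iter_stable.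
have fC : (f @: C <= C)%VS.
  apply/subvP => _ /memv_imgP[_ /span_trajectP[g sg ->] ->].
  rewrite -pactMX (divp_eq (g * 'X) P) pactD pactM nile // linear0 add0r.
  by apply: mem_span_traject; rewrite -ltnS -sP ltn_modp monic_neq0.
have st : size (traject f v n) == n by rewrite size_traject.
(* [phi] reads the coordinate at [f^(n-1) v]. The forms [phi (f^i w)] with [i < n] have as common
   kernel a stable complement of the cyclic subspace. *)
pose phi : {scalar V} := coord (Tuple st) (Ordinal (etrans (ltn_predL n) n0) : 'I_n).
have phiE (j : 'I_n) : phi (iter j f v) = ((n.-1 == j)%N)%:R.
  by rewrite -nth_traj -[LHS]/(coord (Tuple st) _ (Tuple st)`_j) coord_free // eq_sym.
pose Phi : V -> 'rV[K]_n := fun w => \row_i phi (iter i f w).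
have Plin : linear Phi.
  by move=> a u w; apply/rowP => i; rewrite !mxE iter_lin_is_linear linearP.
pose Phi' : {linear V -> 'rV[K]_n} :=
  HB.pack Phi (GRing.isLinear.Build K V 'rV[K]_n _ Phi Plin).
pose W := (U :&: lker (linfun Phi'))%VS.
have memW w : w \in W -> w \in U /\ forall i : 'I_n, phi (iter i f w) = 0.
  move=> /memv_capP[wU]; rewrite memv_ker lfunE /= => /eqP e0; split=> // i.
  by have := congr1 (fun r : 'rV_n => r 0 i) e0; rewrite !mxE.
have Wmem w : w \in U -> (forall i : 'I_n, phi (iter i f w) = 0) -> w \in W.
  move=> wU e0; rewrite memv_cap wU memv_ker lfunE /=; apply/eqP/rowP => i.
  by rewrite !mxE e0.
have fW : (f @: W <= W)%VS.
  apply/subvP => _ /memv_imgP[w /memW[wU ew] ->]; apply: Wmem.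
    by apply: (subvP fU); exact: memv_img.
  move=> i; rewrite -iterSr; have [lt|ge] := ltnP i.+1 n.
    exact: (ew (Ordinal lt)).
  have -> : i.+1 = n by apply/eqP; rewrite eqn_leq ge ltn_ord.
  (* Since [P] is monic of size [n.+1], this expresses [f^n w] by the lower iterates of [w], on
     which [phi] vanishes. *)
  have : pact P w = 0 by exact: nile.
  rewrite (@pactE n.+1) ?sP // big_ord_recr /=.
  have -> : P`_n = 1 by move/monicP: mP; rewrite lead_coefE sP.
  rewrite scale1r addrC => /eqP; rewrite addr_eq0 => /eqP ->.
  rewrite linearN linear_sum big1 ?oppr0 // => j _.
  by rewrite linearZ /= (ew j) mulr0.
have CW : (C :&: W = 0)%VS.
  apply/eqP; rewrite -subv0; apply/subvP => w /memv_capP[/span_trajectP[g sg ->] /memW[_ ew]].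
  rewrite memv0; have [->|g0] := eqVneq g 0; first by rewrite pact0p.
  have sg0 : (0 < size g)%N by rewrite size_poly_gt0.
  (* With this many further applications of [f], the leading term of [g] lands on [f^(n-1) v], and
     [phi] returns the leading coefficient of [g]. *)
  have lt : (n - size g < n)%N by rewrite ltn_subrL sg0.
  have := ew (Ordinal lt); rewrite /= -pact_iter -pactM.
  rewrite (@pactE n); last first.
    by rewrite mulrC size_mulXn // subnK.
  rewrite linear_sum (bigD1 (Ordinal (etrans (ltn_predL n) n0))) //=.
  rewrite big1 => [|j nj]; last first.
    rewrite linearZ /= phiE; case: eqP => [ej|]; rewrite ?mulr0 //.
    by case/eqP: nj; apply: val_inj; rewrite /= ej.
  have lt1 : (n.-1 < n)%N by rewrite prednK.
  rewrite linearZ /= (phiE (Ordinal lt1)) eqxx mulr1 addr0 mulrC coefMXn.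
  rewrite ifN; last by rewrite -leqNgt -subn1 leq_sub2l.
  have -> : (n.-1 - (n - size g) = (size g).-1)%N.
    by rewrite -!subn1 subnAC subKn.
  by rewrite -lead_coefE => /eqP; rewrite lead_coef_eq0 (negPf g0).
have dW : (\dim U <= n + \dim W)%N.
  rewrite -(limg_ker_dim (linfun Phi') U) addnC leq_add2r.
  by rewrite (leq_trans (dimvS (subvf _))) // dimvf /dim /= mul1n.
have CWU : (C + W = U)%VS.
  have s : (C + W <= U)%VS by rewrite subv_add CU capvSl.
  by apply/eqP; rewrite eqEdim s /= dimv_disjoint_sum // dC.
case: (ind C W fC fW CWU CW) => [C0|W0].
  by have := n0; rewrite -dC C0 dimv0.
by rewrite basisEdim -/C -{1}CWU W0 addv0 subvv /= size_traject -dC dimvS.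
Qed.

Lemma cyclic_decomposition U : (f @: U <= U)%VS ->
  exists s : seq (V * {poly K}),
    (forall x, x \in s -> [/\ x.1 \in U, x.2 \is monic, (1 < size x.2)%N, pact x.2 x.1 = 0 &
      free (traject f x.1 (size x.2).-1)]) /\
    basis_of U (flatten [seq traject f x.1 (size x.2).-1 | x : V * {poly K} <- s]).
Proof.
have [d] := ubnP (\dim U); elim: d U => // d IH U /ltnSE led fU.
have [->|U0] := eqVneq U 0%VS.
  by exists [::]; split=> //=; rewrite basisEdim span_nil subvv dimv0.
case: (pselect (forall U1 U2, (f @: U1 <= U1)%VS -> (f @: U2 <= U2)%VS ->
    (U1 + U2 = U)%VS -> (U1 :&: U2 = 0)%VS -> U1 = 0%VS \/ U2 = 0%VS)) => [ind|].
  have [v [p [vU mp sp pv bs]]] := cyclic_of_indecomposable fU U0 ind.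
  exists [:: (v, p)]; split => [x|]; last by rewrite /= cats0.
  by rewrite inE => /eqP->; split=> //; case/andP: bs.
move=> /existsNP[U1] /existsNP[U2] /not_implyP[f1] /not_implyP[f2] /not_implyP[eU].
move=> /not_implyP[i0 /not_orP[/eqP n1 /eqP n2]].
have dU : \dim U = (\dim U1 + \dim U2)%N by rewrite -eU dimv_disjoint_sum.
have l1 : (\dim U1 < d)%N.
  by apply: leq_trans led; rewrite dU -[X in (X < _)%N]addn0 ltn_add2l lt0n dimv_eq0.
have l2 : (\dim U2 < d)%N.
  by apply: leq_trans led; rewrite dU -[X in (X < _)%N]add0n ltn_add2r lt0n dimv_eq0.
have [s1 [h1 b1]] := IH U1 l1 f1; have [s2 [h2 b2]] := IH U2 l2 f2.
exists (s1 ++ s2); split => [x|].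
  rewrite mem_cat => /orP[/h1|/h2][h]; split=> //; rewrite -eU.
    by apply: (subvP (addvSl _ _)).
  by apply: (subvP (addvSr _ _)).
rewrite map_cat flatten_cat basisEdim span_cat (span_basis (X := in_tuple _) b1).
rewrite (span_basis (X := in_tuple _) b2) eU subvv size_cat /=.
by rewrite dU (size_basis (X := in_tuple _) b1) (size_basis (X := in_tuple _) b2).
Qed.

(** If the constant term were 0, then [p = q * 'X], and injectivity of [f] would make [q] kill [v],
    against the freeness of the trajectory. *)
Lemma coef0_neq0 U p v : (f @: U <= U)%VS -> (forall u, u \in U -> f u = 0 -> u = 0) ->
    v \in U -> (1 < size p)%N -> pact p v = 0 -> free (traject f v (size p).-1) ->
  p`_0 != 0.
Proof.
move=> fU inj vU sp pv fr; apply/negP => /eqP p0.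
have np : p != 0 by rewrite -size_poly_eq0 -lt0n; exact: ltnW.
pose q := \poly_(j < (size p).-1) p`_j.+1.
have ep : p = q * 'X.
  apply/polyP => -[|j]; rewrite coefMX //= coef_poly; case: ltnP => //.
  by move=> le; rewrite nth_default // -(prednK (ltnW sp)).
have q0 : pact q v = 0.
  by apply: inj; rewrite ?pact_stable // -pactMX -ep.
have st : size (traject f v (size p).-1) == (size p).-1 by rewrite size_traject.
have {}fr : free (Tuple st) by [].
have sp1 : ((size p).-2 < (size p).-1)%N by rewrite ltn_predL -subn1 subn_gt0.
move/freeP: fr => /(_ (fun j => p`_j.+1)) H.
have := H _ (Ordinal sp1); move=> /(_ _)/eqP; rewrite /= prednK ?(ltnW sp) //; last first.
  by rewrite -subn1 subn_gt0.
rewrite -lead_coefE lead_coef_eq0 (negPf np) => E.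
suff : false by []; apply: E.
rewrite -[RHS]q0 (@pactE (size p).-1) ?size_poly //; apply: eq_bigr => j _.
by rewrite nth_traj coef_poly ltn_ord.
Qed.

End CyclicDecomposition.

(** * Flags, graded pieces and transport *)

Section StringRepresentation.
Variables (K : fieldType) (V : vectType K) (Q0 Q1 : finType).
Variables (src tgt : Q1 -> Q0) (X : Q0 -> {vspace V}) (A : Q1 -> 'End(V)).
(* [a] leaves its source on the side [ts a] and enters its target on the side [hs a]. *)
Variables (ts hs : Q1 -> bool).
Hypothesis XA : forall a, (A a @: X (src a) <= X (tgt a))%VS.
Hypothesis ts_inj : forall a b, src a = src b -> ts a = ts b -> a = b.
Hypothesis hs_inj : forall a b, tgt a = tgt b -> hs a = hs b -> a = b.
Hypothesis A_side : forall a b, src b = tgt a -> ts b = hs a ->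
  forall x, x \in X (src a) -> A b (A a x) = 0.
Implicit Types (v : Q0) (d : bool) (W U : {vspace V}) (a b : Q1) (x y z : V).

Definition pre a W : {vspace V} := (A a @^-1: W :&: X (src a))%VS.

Lemma mem_pre a W x : (x \in pre a W) = (A a x \in W) && (x \in X (src a)).
Proof. by rewrite memv_cap -memv_preim. Qed.

Lemma preS a W W' : (W <= W')%VS -> (pre a W <= pre a W')%VS.
Proof. by move=> s; apply: capvS => //; exact: lpreimS. Qed.

(** These are the functorial filtrations of Gelfand and Ponomarev. A member of [flag v d] is given
    by a word that leaves [v] through the side [d] and ends in 0 or in a whole vertex space. The
    word crosses each further vertex from one side to the other, which explains the negated sides in
    the premises. *)
Inductive flag : Q0 -> bool -> {vspace V} -> Prop :=
| flag0 v d : flag v d 0%VS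
| flagX v d : flag v d (X v)
| flag_im a W of flag (src a) (~~ ts a) W : flag (tgt a) (hs a) (A a @: W)%VS
| flag_pre a W of flag (tgt a) (~~ hs a) W : flag (src a) (ts a) (pre a W).

Lemma flagE v d W : flag v d W ->
  [\/ W = 0%VS, W = X v,
      exists a W', [/\ tgt a = v, hs a = d, flag (src a) (~~ ts a) W' & W = (A a @: W')%VS]
    | exists a W', [/\ src a = v, ts a = d, flag (tgt a) (~~ hs a) W' & W = pre a W']].
Proof.
case=> {v d W} [v d|v d|a W fW|a W fW].
- exact: Or41.
- exact: Or42.
- by apply: Or43; exists a, W.
- by apply: Or44; exists a, W.
Qed.

Lemma flag_sub v d W : flag v d W -> (W <= X v)%VS.
Proof.
elim=> {v d W} [v d|v d|a W fW IH|a W fW IH]; rewrite ?sub0v ?subvv ?capvSr //.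
exact: subv_trans (limgS _ IH) (XA a).
Qed.

Lemma im_ker a b x : src b = tgt a -> ts b = hs a -> x \in (A a @: X (src a))%VS -> A b x = 0.
Proof. by move=> e1 e2 /memv_imgP[y yX ->]; exact: A_side. Qed.

Lemma im_sub_pre a b U W : src b = tgt a -> ts b = hs a -> (U <= X (src a))%VS ->
  (A a @: U <= pre b W)%VS.
Proof.
move=> e1 e2 UX; apply/subvP => _ /memv_imgP[x xU ->]; have xX := subvP UX _ xU.
by rewrite mem_pre A_side // mem0v e1 (subvP (XA a)) // memv_img.
Qed.

(** Two images, or two preimages, on the same side of [v] come from the same arrow and are compared
    by induction. An image lies in every preimage on the same side, because the composite of the two
    arrows vanishes. *)
Lemma flag_chain v d W W' : flag v d W -> flag v d W' -> (W <= W')%VS \/ (W' <= W)%VS.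
Proof.
move=> fW; elim: fW W' => {v d W} [v d|v d|a W fW IH|a W fW IH] W' fW'.
- by left; exact: sub0v.
- by right; exact: flag_sub fW'.
- have [->|->|[b [U [e1 e2 fU ->]]]|[b [U [e1 e2 fU ->]]]] := flagE fW'.
  + by right; exact: sub0v.
  + by left; apply: flag_sub; exact: flag_im.
  + have eb := hs_inj e1 e2; subst b.
    by case: (IH U fU) => /(limgS (A a)); [left|right].
  + by left; apply: im_sub_pre => //; exact: flag_sub fW.
- have [->|->|[b [U [e1 e2 fU ->]]]|[b [U [e1 e2 fU ->]]]] := flagE fW'.
  + by right; exact: sub0v.
  + by left; apply: flag_sub; exact: flag_pre.
  + by right; apply: im_sub_pre => //; exact: flag_sub fU.
  + have eb := ts_inj e1 e2; subst b.
    by case: (IH U fU) => /(preS a); [left|right].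
Qed.

Lemma Fl_ex v d n : {W | [/\ flag v d W, (\dim W <= n)%N &
  forall W', flag v d W' -> (\dim W' <= n)%N -> (W' <= W)%VS]}.
Proof.
apply: cid; pose P k := `[< exists W, [/\ flag v d W, (\dim W <= n)%N & \dim W = k] >].
have [||k /asboolP[W [fW dW ek]] mx] := @ex_maxnP P n.
- by exists 0%N; apply/asboolP; exists 0%VS; rewrite dimv0; split=> //; exact: flag0.
- by move=> k /asboolP[W [_ dW <-]].
exists W; split=> // W' fW' dW'; case: (flag_chain fW fW') => // s.
suff /eqP -> : W == W' by exact: subvv.
by rewrite eqEdim s ek; apply: mx; apply/asboolP; exists W'.
Qed.

(** Numbering by dimension gives all vertices and sides the same finite index set. The price is
    repetition: where [Fl] does not grow from [n] to [n.+1], the corresponding graded pieces are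
    0. *)
Definition Fl v d n : {vspace V} := sval (Fl_ex v d n).

Lemma FlP v d n : [/\ flag v d (Fl v d n), (\dim (Fl v d n) <= n)%N &
  forall W, flag v d W -> (\dim W <= n)%N -> (W <= Fl v d n)%VS].
Proof. by rewrite /Fl; case: Fl_ex. Qed.

Lemma Fl_flag v d n : flag v d (Fl v d n). Proof. by have [] := FlP v d n. Qed.

Lemma FlS v d m n : (m <= n)%N -> (Fl v d m <= Fl v d n)%VS.
Proof.
by move=> le; have [fm dm _] := FlP v d m; have [_ _] := FlP v d n; apply=> //; exact: leq_trans le.
Qed.

Lemma Fl0 v d : Fl v d 0 = 0%VS.
Proof. by have [_] := FlP v d 0; rewrite leqn0 dimv_eq0 => /eqP. Qed.

Lemma Fl_dim v d n : (\dim {:V} <= n)%N -> Fl v d n = X v.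
Proof.
move=> le; apply: subv_anti; rewrite (flag_sub (Fl_flag v d n)) /=.
have [_ _] := FlP v d n; apply; first exact: flagX.
by apply: leq_trans le; exact: dimvS (subvf _).
Qed.

Lemma Fl_jump v d n W : flag v d W -> (W <= Fl v d n)%VS \/ (Fl v d n.+1 <= W)%VS.
Proof.
move=> fW; have [_ _ H] := FlP v d n; case: (leqP (\dim W) n) => [|lt]; first by left; exact: H.
right; have [fF dF _] := FlP v d n.+1; case: (flag_chain fW fF) => // s.
suff /eqP -> : W == Fl v d n.+1 by exact: subvv.
by rewrite eqEdim s (leq_trans dF).
Qed.

(** Recovers the number of a jump. Nothing in the flag lies strictly between [F'] and [F], so the
    largest member of dimension below that of [F] is [F']. *)
Lemma Fl_of_jump v d F F' : flag v d F -> flag v d F' -> (F' <= F)%VS -> ~~ (F <= F')%VS ->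
  (forall W, flag v d W -> (W <= F')%VS \/ (F <= W)%VS) ->
  exists2 i : 'I_(\dim {:V}), Fl v d i = F' & Fl v d i.+1 = F.
Proof.
move=> fF fF' s ns J.
have dlt : (\dim F' < \dim F)%N.
  by rewrite ltnNge; apply: contra ns => le; move: (eqEdim F' F); rewrite s le => /eqP ->.
have eF : Fl v d (\dim F) = F.
  have [fl dl H] := FlP v d (\dim F); apply/eqP; rewrite eq_sym eqEdim dl andbT; exact: H.
have dF0 : (0 < \dim F)%N by exact: leq_ltn_trans dlt.
have eF' : Fl v d (\dim F).-1 = F'.
  have [fl dl H] := FlP v d (\dim F).-1; apply: subv_anti.
  rewrite H ?andbT //; last by rewrite -ltnS prednK.
  case: (J _ fl) => // /dimvS le; have := leq_trans le dl.
  by rewrite -ltnS prednK // ltnn.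
have lt : ((\dim F).-1 < \dim {:V})%N by rewrite prednK // dimvS // subvf.
by exists (Ordinal lt) => //=; rewrite prednK.
Qed.

(* [(v, (i, j))] stands for the graded piece [Zn / Nn] of [X v] at the jumps [i] and [j] of its two
   flags; a jump is numbered by the dimension below it. *)
Definition node : predArgType := (Q0 * ('I_(\dim {:V}) * 'I_(\dim {:V})))%type.
HB.instance Definition _ := Finite.on node.
Implicit Types (n m : node).

Definition idx n d : 'I_(\dim {:V}) := if d then n.2.1 else n.2.2.
Definition lo n d := Fl n.1 d (idx n d).
Definition hi n d := Fl n.1 d (idx n d).+1.
(** [Zn / Nn] is the quotient of the Zassenhaus lemma for one jump of each flag. *)
Definition Zn n : {vspace V} := (hi n true :&: hi n false)%VS.
Definition Nn n : {vspace V} := (lo n true :&: hi n false + hi n true :&: lo n false)%VS.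
Definition alive n := ~~ (Zn n <= Nn n)%VS.

Lemma ZnE d n : Zn n = (hi n d :&: hi n (~~ d))%VS.
Proof. by case: d => //; rewrite capvC. Qed.

Lemma NnE d n : Nn n = (lo n d :&: hi n (~~ d) + hi n d :&: lo n (~~ d))%VS.
Proof. by case: d => //=; rewrite addvC; congr (_ + _)%VS; exact: capvC. Qed.

Lemma lo_hi n d : (lo n d <= hi n d)%VS. Proof. exact: FlS. Qed.

Lemma NnZ n : (Nn n <= Zn n)%VS.
Proof. by rewrite subv_add; apply/andP; split; apply: capvS; rewrite ?subvv ?lo_hi. Qed.

Lemma Zn_X n : (Zn n <= X n.1)%VS.
Proof. exact: subv_trans (capvSl _ _) (flag_sub (Fl_flag _ _ _)). Qed.

Lemma jump n d W : flag n.1 d W -> (W <= lo n d)%VS \/ (hi n d <= W)%VS.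
Proof. exact: Fl_jump. Qed.

Lemma alive_jump n d : alive n -> ~~ (hi n d <= lo n d)%VS.
Proof.
move=> al; apply: contra al => s; rewrite (ZnE d) (NnE d).
by apply: subv_trans (addvSl _ _); exact: capvS.
Qed.

Lemma mem_lo_Nn n d x : x \in lo n d -> x \in hi n (~~ d) -> x \in Nn n.
Proof.
by move=> h1 h2; rewrite (NnE d); apply: (subvP (addvSl _ _)); rewrite memv_cap h1.
Qed.

(* [a] identifies the graded piece [Zn n / Nn n] with [Zn m / Nn m]. *)
Definition dl a n m := [/\ n.1 = src a, m.1 = tgt a,
  hi m (hs a) = (A a @: hi n (~~ ts a))%VS /\ lo m (hs a) = (A a @: lo n (~~ ts a))%VS,
  hi n (ts a) = pre a (hi m (~~ hs a)) & lo n (ts a) = pre a (lo m (~~ hs a))].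

Lemma dl_Z a n m x : dl a n m -> x \in Zn n -> A a x \in Zn m.
Proof.
case=> _ _ [e1 _] e2 _; rewrite (ZnE (ts a)) (ZnE (hs a) m) !memv_cap => /andP[].
by rewrite e2 mem_pre e1 => /andP[-> _] h; rewrite memv_img.
Qed.

Lemma dl_N a n m x : dl a n m -> x \in Nn n -> A a x \in Nn m.
Proof.
case=> _ _ [e1 e2] e3 e4; rewrite (NnE (ts a)) => /memv_addP[y yN [z zN ->]].
rewrite linearD; move: yN zN; rewrite !memv_cap e3 e4 !mem_pre.
move=> /andP[/andP[y1 _] y2] /andP[/andP[z1 _] z2]; apply: rpredD.
  by apply: (mem_lo_Nn (d := ~~ hs a)) => //; rewrite negbK e1 memv_img.
by apply: (mem_lo_Nn (d := hs a)) => //; rewrite e2 memv_img.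
Qed.

Lemma dl_Z_surj a n m x : dl a n m -> x \in Zn m -> exists2 y, y \in Zn n & x = A a y.
Proof.
case=> e0 _ [e1 _] e2 _; rewrite (ZnE (hs a)) !memv_cap e1 => /andP[/memv_imgP[y yh ->] h].
exists y => //; rewrite (ZnE (ts a)) memv_cap yh e2 mem_pre h andbT -e0.
exact: (subvP (flag_sub (Fl_flag _ _ _))) yh.
Qed.

(** The summand of [A a x] in [lo m (hs a)] lifts to some [g] in [lo n (~~ ts a)]. Then [x - g] is
    mapped into [lo m (~~ hs a)], so it lies in the preimage [lo n (ts a)]. *)
Lemma dl_N_inv a n m x : dl a n m -> x \in Zn n -> A a x \in Nn m -> x \in Nn n.
Proof.
case=> e0 _ [e1 e2] e3 e4 xZ; rewrite (NnE (hs a)) => /memv_addP[y yN [z zN e]].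
have sub w d i : w \in Fl n.1 d i -> w \in X (src a).
  by rewrite -e0; exact: (subvP (flag_sub (Fl_flag _ _ _))).
move: yN; rewrite memv_cap e2 => /andP[/memv_imgP[g gl ey] yh].
have gh : g \in hi n (ts a) by rewrite e3 mem_pre -ey yh (sub _ _ _ gl).
have gN : g \in Nn n by apply: (mem_lo_Nn gl); rewrite negbK.
rewrite -[x](subrK g); apply: rpredD => //; apply: (mem_lo_Nn (d := ts a)).
  move: zN; rewrite memv_cap e4 mem_pre linearB /= e -ey [y + z]addrC addrK => /andP[_ ->] /=.
  apply: rpredB; last exact: sub gl.
  by move: xZ; rewrite memv_cap => /andP[/sub].
apply: rpredB; first by move: xZ; rewrite (ZnE (ts a)) memv_cap => /andP[].
exact: (subvP (lo_hi _ _)).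
Qed.

Lemma dl_alive a n m : dl a n m -> alive n = alive m.
Proof.
move=> l; congr (~~ _); apply/subvP/subvP => s x xZ.
  have [y yZ ->] := dl_Z_surj l xZ; apply: (dl_N l); exact: s.
by apply: (dl_N_inv l) => //; apply: s; exact: (dl_Z l).
Qed.

Definition mknode v d i j : node := (v, if d then (i, j) else (j, i)).

Lemma idx_mk v d i j : idx (mknode v d i j) d = i /\ idx (mknode v d i j) (~~ d) = j.
Proof. by case: d. Qed.

(** The kernel of [b] on its source is a member of the flag that does not contain [hi n (ts b)], so
    it lies in [lo n (ts b)]. Both ends of this jump are therefore preimages under [b], and both
    ends of the other jump are pushed forward; the results are jumps at the target of [b]. *)
Lemma dl_exists b n : alive n -> n.1 = src b -> ~~ (hi n (ts b) <= lker (A b))%VS ->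
  exists m, dl b n m.
Proof.
move=> al en nk; set F := hi n (ts b); set F' := lo n (ts b).
set G := hi n (~~ ts b); set G' := lo n (~~ ts b).
have J1 W : flag (src b) (ts b) W -> (W <= F')%VS \/ (F <= W)%VS.
  by rewrite -en; exact: jump.
have nF : ~~ (F <= F')%VS by exact: alive_jump.
have nG : ~~ (G <= G')%VS by exact: alive_jump.
have fF : flag (src b) (ts b) F by rewrite -en; exact: Fl_flag.
have fF' : flag (src b) (ts b) F' by rewrite -en; exact: Fl_flag.
have GX : (G <= X (src b))%VS by rewrite -en; exact: flag_sub (Fl_flag _ _ _).
have kF' : (pre b 0 <= F')%VS.
  case: (J1 (pre b 0)) => // [|s]; first by apply: flag_pre; exact: flag0.
  case/negP: nk; apply: subv_trans s _; apply/subvP => x.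
  by rewrite mem_pre memv_ker memv0 => /andP[].
have noim W a : src b = tgt a -> ts b = hs a -> flag (src a) (~~ ts a) W ->
    (A a @: W <= F')%VS.
  move=> h1 h2 fW; apply: subv_trans kF'; apply: im_sub_pre => //; exact: flag_sub fW.
have [U0 fU0 eU0] : exists2 U, flag (tgt b) (~~ hs b) U & pre b U = F.
  have [e|e|[a [W [h1 h2 fW e]]]|[a [W [h1 h2 fW e]]]] := flagE fF.
  - by case/negP: nF; rewrite e sub0v.
  - exists (X (tgt b)); first exact: flagX.
    rewrite e; apply: subv_anti; rewrite capvSr /=; apply/subvP => x xX.
    by rewrite mem_pre xX (subvP (XA b)) ?memv_img.
  - by case/negP: nF; rewrite e; apply: (noim W a).
  - by have ea := ts_inj h1 h2; subst a; exists W.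
have [W' fW' eW'] : exists2 U, flag (tgt b) (~~ hs b) U & pre b U = F'.
  have [e|e|[a [W [h1 h2 fW e]]]|[a [W [h1 h2 fW e]]]] := flagE fF'.
  - exists 0%VS; first exact: flag0.
    by apply: subv_anti; rewrite kF' e sub0v.
  - by case/negP: nF; rewrite e; exact: flag_sub fF.
  - exists 0%VS; first exact: flag0.
    by apply: subv_anti; rewrite kF' /= e; apply: im_sub_pre => //; exact: flag_sub fW.
  - by have ea := ts_inj h1 h2; subst a; exists W.
(* Different members may have the same preimage. The least one with preimage [F] is taken, so that
   its predecessor has a strictly smaller preimage, which must be [F']. *)
have [|k /asboolP[U [fU eU dU]] kmin] :=
  ex_minnP (P := fun k => `[< exists U, [/\ flag (tgt b) (~~ hs b) U, pre b U = F & \dim U = k] >]).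
  by exists (\dim U0); apply/asboolP; exists U0.
have k0 : (0 < k)%N.
  rewrite lt0n -dU dimv_eq0; apply: contra nF => /eqP e.
  by rewrite -eU e.
pose U' := Fl (tgt b) (~~ hs b) k.-1.
have [fU' dU' U'max] := FlP (tgt b) (~~ hs b) k.-1.
have nUU' : ~~ (U <= U')%VS.
  by apply/negP => /dimvS; rewrite dU => le; have := leq_trans le dU'; rewrite -ltnS prednK // ltnn.
have JU W : flag (tgt b) (~~ hs b) W -> (W <= U')%VS \/ (U <= W)%VS.
  move=> fW; case: (leqP (\dim W) k.-1) => [le|lt]; first by left; exact: U'max.
  right; case: (flag_chain fW fU) => // s; suff /eqP -> : W == U by exact: subvv.
  by rewrite eqEdim s dU -(prednK k0).
have U'U : (U' <= U)%VS by case: (JU _ fU') => //; case: (flag_chain fU fU') => // h; rewrite h in nUU'.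
have eU' : pre b U' = F'.
  apply: subv_anti; apply/andP; split; last first.
    case: (JU _ fW'); first by move=> s; rewrite -eW' preS.
    by move=> /(preS b); rewrite eU eW' (negPf nF).
  case: (J1 (pre b U')) => // [|s]; first exact: flag_pre.
  have e : pre b U' = F by apply: subv_anti; rewrite s andbT -eU preS.
  have le : (k <= \dim U')%N by apply: kmin; apply/asboolP; exists U'.
  by have := leq_trans le dU'; rewrite -ltnS prednK // ltnn.
have [x xZ xN] : exists2 x, x \in Zn n & x \notin Nn n by exact/subvPn.
have [xF xG] : x \in F /\ x \in G by apply/memv_capP; rewrite -ZnE.
(* Aliveness is used here: if the two images agreed, [x] would be a vector of [G'] plus one of the
   kernel of [b], and would lie in [Nn n]. *)
have nGG : ~~ (A b @: G <= A b @: G')%VS.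
  apply: contra xN => /subvP/(_ (A b x)); rewrite memv_img // => /(_ isT) /memv_imgP[g gG' e].
  have gX : g \in X (src b) by apply: (subvP GX); exact: (subvP (lo_hi _ _)).
  rewrite -[x](subrK g); have kg : x - g \in F'.
    apply: (subvP kF'); rewrite mem_pre linearB /= e subrr mem0v rpredB //.
    exact: (subvP GX).
  apply: rpredD.
    apply: (mem_lo_Nn kg); apply: rpredB => //; exact: (subvP (lo_hi _ _)).
  apply: (mem_lo_Nn gG'); rewrite negbK -/F -[g](subKr x); apply: rpredB => //.
  exact: (subvP (lo_hi _ _)).
have fG : flag (src b) (~~ ts b) G by rewrite -en; exact: Fl_flag.
have fG' : flag (src b) (~~ ts b) G' by rewrite -en; exact: Fl_flag.
have JG W : flag (tgt b) (hs b) W -> (W <= A b @: G')%VS \/ (A b @: G <= W)%VS.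
  case/flagE => [->|->|[a [W1 [h1 h2 fW ->]]]|[a [W1 [h1 h2 fW ->]]]].
  - by left; exact: sub0v.
  - by right; apply: (flag_sub (flag_im fG)).
  - have ea := hs_inj h1 h2; subst a; move: fW; rewrite -en => /jump.
    by case=> /(limgS (A b)); [left|right].
  - by right; apply: im_sub_pre.
have [i ei1 ei2] := Fl_of_jump (flag_im fG) (flag_im fG') (limgS (A b) (lo_hi _ _)) nGG JG.
have [j ej1 ej2] := Fl_of_jump fU fU' U'U nUU' JU.
pose m := mknode (tgt b) (hs b) i j; have [h1 h2] := idx_mk (tgt b) (hs b) i j.
have hm1 : hi m (hs b) = (A b @: G)%VS by rewrite /hi h1; exact: ei2.
have lm1 : lo m (hs b) = (A b @: G')%VS by rewrite /lo h1; exact: ei1.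
have hm2 : hi m (~~ hs b) = U by rewrite /hi h2; exact: ej2.
have lm2 : lo m (~~ hs b) = U' by rewrite /lo h2; exact: ej1.
by exists m; split; rewrite ?hm1 ?lm1 ?hm2 ?lm2 ?eU ?eU'.
Qed.

Lemma node_eq n m d : n.1 = m.1 -> idx n d = idx m d -> idx n (~~ d) = idx m (~~ d) -> n = m.
Proof. by case: n m d => [v [i j]] [w [k l]] [] /= -> -> ->. Qed.

Lemma Fl_inj v d (i j : 'I_(\dim {:V})) : ~~ (Fl v d i.+1 <= Fl v d i)%VS ->
  Fl v d i = Fl v d j -> Fl v d i.+1 = Fl v d j.+1 -> i = j.
Proof.
move=> ni e1 e2; apply: val_inj => /=; case: (ltngtP i j) => // lt; case/negP: ni.
  by rewrite e1 FlS.
by rewrite e2 FlS.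
Qed.

Lemma dl_fun a n m m' : alive n -> dl a n m -> dl a n m' -> m = m'.
Proof.
move=> al l l'; have alm : alive m by rewrite -(dl_alive l).
case: (l) => _ e1 [e2 e3] e4 e5; case: (l') => _ e1' [e2' e3'] e4' e5'.
have e0 : m.1 = m'.1 by rewrite e1.
have nm d : ~~ (hi m d <= lo m d)%VS by exact: alive_jump.
have nn : ~~ (hi n (ts a) <= lo n (ts a))%VS by exact: alive_jump.
apply: (node_eq (d := hs a)) => //.
  apply: (Fl_inj (nm _)).
    by have : lo m (hs a) = lo m' (hs a) by [rewrite e3 e3']; rewrite /lo -e0.
  by have : hi m (hs a) = hi m' (hs a) by [rewrite e2 e2']; rewrite /hi -e0.
apply: val_inj; case: (ltngtP (idx m (~~ hs a)) (idx m' (~~ hs a))) => // lt; case/negP: nn.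
  by rewrite e4 e5'; apply: preS; rewrite /hi /lo e0; exact: FlS.
by rewrite e4' e5; apply: preS; rewrite /hi /lo e0; exact: FlS.
Qed.

Lemma dl_cofun a n n' m : alive m -> dl a n m -> dl a n' m -> n = n'.
Proof.
move=> al l l'; have aln : alive n by rewrite (dl_alive l).
case: (l) => e1 _ [e2 e3] e4 e5; case: (l') => e1' _ [e2' e3'] e4' e5'.
have e0 : n.1 = n'.1 by rewrite e1.
have nn d : ~~ (hi n d <= lo n d)%VS by exact: alive_jump.
have nm : ~~ (hi m (hs a) <= lo m (hs a))%VS by exact: alive_jump.
apply: (node_eq (d := ts a)) => //.
  apply: (Fl_inj (nn _)).
    by have : lo n (ts a) = lo n' (ts a) by [rewrite e5 e5']; rewrite /lo -e0.
  by have : hi n (ts a) = hi n' (ts a) by [rewrite e4 e4']; rewrite /hi -e0.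
apply: val_inj; case: (ltngtP (idx n (~~ ts a)) (idx n' (~~ ts a))) => // lt; case/negP: nm.
  by rewrite e2 e3'; apply: limgS; rewrite /hi /lo e0; exact: FlS.
by rewrite e2' e3; apply: limgS; rewrite /hi /lo e0; exact: FlS.
Qed.

(** As an image under [a], the space [hi n (ts b)] is killed by [b]. It is thus contained in the
    preimage [lo n (ts b)], so there is no jump and [n] is dead. *)
Lemma dl_excl a b n m m' : alive n -> dl b n m -> dl a m' n -> ts b = hs a -> False.
Proof.
move=> al [e1 _ _ _ e2] [e1' e3 [e4 _] _ _] e.
have := alive_jump (ts b) al; rewrite e2 {1}e e4 => /negP; apply.
apply: im_sub_pre => //; first by rewrite -e1.
by rewrite -e1'; exact: flag_sub (Fl_flag _ _ _).
Qed.

(** * Links between graded pieces, and transport of vectors along links *)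

Definition link : rel (node * bool) := fun h h' =>
  `[< alive h.1 /\ exists a, (dl a h.1 h'.1 /\ h.2 = ts a /\ h'.2 = hs a) \/
                             (dl a h'.1 h.1 /\ h'.2 = ts a /\ h.2 = hs a) >].

Lemma linkP h h' : link h h' -> alive h.1 /\
  exists a, (dl a h.1 h'.1 /\ h.2 = ts a /\ h'.2 = hs a) \/
            (dl a h'.1 h.1 /\ h'.2 = ts a /\ h.2 = hs a).
Proof. by move/asboolP. Qed.

Lemma link_sym : symmetric link.
Proof.
suff H h h' : link h h' -> link h' h by move=> h h'; apply/idP/idP; exact: H.
move=> /linkP[al [a [[l e]|[l e]]]]; apply/asboolP; split; [|exists a; right| |exists a; left] => //.
  by rewrite -(dl_alive l).
by rewrite (dl_alive l).
Qed.

Lemma link_irr : irreflexive link.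
Proof.
move=> h; apply/negbTE/negP => /linkP[al [a [|] [l [e1 e2]]]];
by apply: (dl_excl al l l); rewrite -e1 -e2.
Qed.

Lemma half_eq (h h' : node * bool) : h.1 = h'.1 -> h.2 = h'.2 -> h = h'.
Proof. by case: h h' => [? ?] [? ?] /= -> ->. Qed.

Lemma link_fun h h1 h2 : link h h1 -> link h h2 -> h1 = h2.
Proof.
move=> /linkP[al [a [] [l [e1 e2]]]] /linkP[_ [b [] [l' [e1' e2']]]].
- case: (l) (l') => [s1 _ _ _ _] [s2 _ _ _ _].
  have ab : a = b by apply: ts_inj; rewrite -?s1 -?s2 // -e1 e1'.
  by subst b; apply: half_eq; [exact: dl_fun al l l' | rewrite e2].
- by case: (dl_excl al l l'); rewrite -e1.
- by case: (dl_excl al l' l); rewrite -e1'.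
- case: (l) (l') => [_ s1 _ _ _] [_ s2 _ _ _].
  have ab : a = b by apply: hs_inj; rewrite -?s1 -?s2 // -e2 e2'.
  by subst b; apply: half_eq; [exact: dl_cofun al l l' | rewrite e1].
Qed.

Lemma link_alive h h' : link h h' -> alive h'.1.
Proof. by rewrite link_sym => /linkP[]. Qed.

(** Used at the ends of a path of graded pieces: an arrow that did not kill [Zn n] would link [n] to
    a further piece. *)
Lemma unlinked_kill n d : alive n -> (forall h, ~~ link (n, d) h) ->
  forall a, src a = n.1 -> ts a = d -> forall x, x \in Zn n -> A a x = 0.
Proof.
move=> al nl a es ed x xZ; have [/subvP s|nk] := boolP (hi n (ts a) <= lker (A a))%VS.
  by apply/eqP; rewrite -memv_ker s // ed; move: xZ; rewrite (ZnE d) memv_cap => /andP[].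
have [m lm] := dl_exists al (esym es) nk.
by case/negP: (nl (m, hs a)); apply/asboolP; split=> //; exists a; left.
Qed.

Notation nxt := (follow link).
Notation half := (node * bool)%type.
Implicit Types (h : half).

Lemma nxtP h h' : nxt h h' -> alive h.1 /\
  ((exists a, [/\ dl a h.1 h'.1, h.2 = ts a & h'.2 = ~~ hs a]) \/
   (exists a, [/\ dl a h'.1 h.1, h.2 = hs a & h'.2 = ~~ ts a])).
Proof.
move=> /linkP[al [a [] /= [l [e1 e2]]]]; split=> //.
  by left; exists a; rewrite -e2 negbK.
by right; exists a; rewrite -e1 negbK.
Qed.

Lemma nxt_sym h h' : nxt h h' = nxt (flip h') (flip h).
Proof. by rewrite /follow flipK link_sym. Qed.

Lemma nxt_alive h h' : nxt h h' -> alive h.1 /\ alive h'.1.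
Proof. by move=> l; split; [have [] := linkP l|have := link_alive l]. Qed.

(* Transport along a link, whose arrow may point from [h] to [h'] or backwards.  Quantifying
   universally over that arrow, which is unique, makes the relation visibly linear. *)
Definition vl h h' x y := [/\ x \in Zn h.1, y \in Zn h'.1,
  forall a, dl a h.1 h'.1 -> h.2 = ts a -> h'.2 = ~~ hs a -> y = A a x &
  forall a, dl a h'.1 h.1 -> h.2 = hs a -> h'.2 = ~~ ts a -> x = A a y].

Lemma vlP c h h' x x' y y' : vl h h' x x' -> vl h h' y y' -> vl h h' (c *: x + y) (c *: x' + y').
Proof.
move=> [Zx Zx' d i] [Zy Zy' d' i']; split; rewrite ?rpredD ?rpredZ // => a l e1 e2.
  by rewrite linearP /= -d // -d'.
by rewrite linearP /= -i // -i'.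
Qed.

Lemma vl0 h h' : vl h h' 0 0.
Proof. by split; rewrite ?mem0v // => a *; rewrite linear0. Qed.

Lemma vlZ c h h' x x' : vl h h' x x' -> vl h h' (c *: x) (c *: x').
Proof. by move=> /vlP/(_ (vl0 h h')) => /(_ c); rewrite !addr0. Qed.

Lemma vlD h h' x x' y y' : vl h h' x x' -> vl h h' y y' -> vl h h' (x + y) (x' + y').
Proof. by move=> /(@vlP 1) H /H; rewrite !scale1r. Qed.

Lemma vlB h h' x x' y y' : vl h h' x x' -> vl h h' y y' -> vl h h' (x - y) (x' - y').
Proof. by move=> H /(vlZ (-1))/(vlD H); rewrite !scaleN1r. Qed.

Lemma vl_sum (I : Type) (r : seq I) (c : I -> K) h h' (F G : I -> V) :
  (forall i, vl h h' (F i) (G i)) ->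
  vl h h' (\sum_(i <- r) c i *: F i) (\sum_(i <- r) c i *: G i).
Proof.
by move=> H; elim: r => [|i r IH]; rewrite ?big_nil ?big_cons; [exact: vl0|exact: vlP].
Qed.

Lemma vl_flip h h' x y : vl h h' x y -> vl (flip h') (flip h) y x.
Proof.
move=> [Zx Zy d i]; split=> // a l /= e1 /negb_inj e2.
  by apply: i; rewrite // -e1 negbK.
by apply: d; rewrite // -e1 negbK.
Qed.

Lemma vl_direct a h h' x : alive h.1 -> dl a h.1 h'.1 -> h.2 = ts a -> h'.2 = ~~ hs a ->
  x \in Zn h.1 -> vl h h' x (A a x).
Proof.
move=> al l e1 e2 xZ; split=> //; first exact: dl_Z l xZ.
  move=> b l' e1' _; case: (l) (l') => [s1 _ _ _ _] [s2 _ _ _ _].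
  by congr (A _ x); apply: ts_inj; rewrite -?s1 -?s2 // -e1.
by move=> b l' e1' _; case: (dl_excl al l l'); rewrite -e1.
Qed.

Lemma vl_inverse a h h' y : alive h.1 -> dl a h'.1 h.1 -> h.2 = hs a -> h'.2 = ~~ ts a ->
  y \in Zn h'.1 -> vl h h' (A a y) y.
Proof.
move=> al l e1 e2 yZ; split=> //; first exact: dl_Z l yZ.
  by move=> b l' e1' _; case: (dl_excl al l' l); rewrite -e1'.
move=> b l' e1' _; case: (l) (l') => [_ s1 _ _ _] [_ s2 _ _ _].
by congr (A _ y); apply: hs_inj; rewrite -?s1 -?s2 // -e1.
Qed.

Lemma vl_ex h h' x : nxt h h' -> x \in Zn h.1 -> exists y, vl h h' x y.
Proof.
move=> /nxtP[al [[a [l e1 e2]]|[a [l e1 e2]]]] xZ.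
  by exists (A a x); exact: vl_direct.
by have [y yZ ->] := dl_Z_surj l xZ; exists y; exact: vl_inverse.
Qed.

Lemma vl_N h h' x y : nxt h h' -> vl h h' x y -> (x \in Nn h.1) = (y \in Nn h'.1).
Proof.
move=> /nxtP[al [[a [l e1 e2]]|[a [l e1 e2]]]] [Zx Zy d i].
  rewrite (d a) //; apply/idP/idP => [|]; first exact: dl_N l.
  exact: dl_N_inv l Zx.
rewrite (i a) //; apply/idP/idP => [|]; last exact: dl_N l.
exact: dl_N_inv l Zy.
Qed.

Definition side_ok n d x U := forall a, src a = n.1 -> ts a = d -> A a x \in U.

(** If the arrow of the link leaves [h], it is the only arrow on this side and carries [x] to [y].
    If it enters [h], then [x] is in its image, and any arrow leaving on this side kills [x]. *)
Lemma vl_side h h' x y U : nxt h h' -> vl h h' x y -> y \in U -> side_ok h.1 h.2 x U.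
Proof.
move=> /nxtP[al [[a [l e1 e2]]|[a [l e1 e2]]]] [Zx Zy d i] yU b sb tb.
  suff -> : b = a by rewrite -d.
  by case: l => s1 _ _ _ _; apply: ts_inj; rewrite ?tb -?e1 // sb s1.
rewrite (i a) //; case: (l) => s1 s2 _ _ _; rewrite A_side ?mem0v -?s1 -?s2 // ?tb //.
by apply: (subvP (Zn_X _)).
Qed.

Lemma span_rel h h' (T : eqType) (r : seq T) (x y : T -> V) s :
  (forall t, t \in r -> vl h h' (x t) (y t)) -> s \in <<map x r>>%VS ->
  exists2 s', s' \in <<map y r>>%VS & vl h h' s s'.
Proof.
elim: r s => [|t r IH] s H.
  by rewrite span_nil memv0 => /eqP->; exists 0; rewrite ?mem0v //; exact: vl0.
rewrite span_cons => /memv_addP[_ /vlineP[c ->] [u /IH[|u' uU vu]]].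
  by move=> t' tr; apply: H; rewrite inE tr orbT.
move=> ->; exists (c *: y t + u').
  by rewrite span_cons memv_add // rpredZ // memv_line.
by apply: vlP => //; apply: H; rewrite mem_head.
Qed.

Lemma span_transfer h h' (T : eqType) (r : seq T) (x y : T -> V) : nxt h h' ->
  (forall t, t \in r -> vl h h' (x t) (y t)) ->
  (Zn h.1 <= <<map x r>> + Nn h.1)%VS -> (Zn h'.1 <= <<map y r>> + Nn h'.1)%VS.
Proof.
move=> l H /subvP s; apply/subvP => z' Zz'.
have [z vz] : exists z, vl h h' z z'.
  have [|z vz] := @vl_ex (flip h') (flip h) z' _ Zz'; first by rewrite -nxt_sym.
  exists z; have := vl_flip vz; rewrite /flip /= !negbK.
  by case: (h) (h') => [? ?] [? ?].
have Zz : z \in Zn h.1 by case: vz.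
have /memv_addP[u uB [w wN ez]] := s z Zz.
have [u' u'B vu] := span_rel H uB.
rewrite -[z'](subrK u') addrC memv_add // -(vl_N l (vlB vz vu)) ez addrC addKr //.
Qed.

(** * Counting and spanning by graded pieces *)

Definition hdim n := (\dim (Zn n) - \dim (Nn n))%N.

Lemma hdim_diff n : \dim (Zn n :\: Nn n)%VS = hdim n.
Proof. by rewrite /hdim -(dimv_cap_compl (Zn n) (Nn n)) (capv_idPr (NnZ n)) addKn. Qed.

Lemma hdim_le_span n (B : seq V) : (Zn n <= <<B>> + Nn n)%VS -> (hdim n <= size B)%N.
Proof.
move=> /dimvS le; rewrite /hdim leq_subLR addnC; apply: leq_trans le _.
by apply: leq_trans (dimv_add_leqif _ _) _; rewrite leq_add2r dim_span.
Qed.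

Lemma vl_family h h' (r : seq V) : nxt h h' -> {subset r <= Zn h.1} ->
  exists f : V -> V, forall t, t \in r -> vl h h' t (f t).
Proof.
move=> l s; have H t : exists y, t \in r -> vl h h' t y.
  case: (boolP (t \in r)) => [/s/(vl_ex l)[y]|_]; last by exists 0.
  by exists y.
by exists (fun t => sval (cid (H t))) => t; case: cid.
Qed.

Lemma hdim_nxt_le h h' : nxt h h' -> (hdim h'.1 <= hdim h.1)%N.
Proof.
move=> l; set r : seq V := vbasis (Zn h.1 :\: Nn h.1)%VS.
have [|f vf] := @vl_family h h' r l.
  by move=> t /vbasis_mem; exact: (subvP (diffvSl _ _)).
have := span_transfer (x := id) l vf; rewrite map_id (span_basis (vbasisP _)) addv_diff.
by rewrite addvSl => /(_ isT)/hdim_le_span; rewrite size_map size_tuple hdim_diff.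
Qed.

Lemma hdim_nxt h h' : nxt h h' -> hdim h'.1 = hdim h.1.
Proof.
move=> l; apply/eqP; rewrite eqn_leq hdim_nxt_le //=.
by rewrite nxt_sym in l; exact: (hdim_nxt_le l).
Qed.

Lemma dead_hdim n : ~~ alive n -> hdim n = 0%N.
Proof. by rewrite negbK => /dimvS; rewrite /hdim -subn_eq0 => /eqP. Qed.

Hypothesis X_dim : (\sum_v \dim (X v))%N = \dim {:V}.
Hypothesis X_sum : (\sum_v X v = fullv)%VS.

(** The dimension of a graded piece is the mixed second difference of the dimensions [f i j] of the
    intersections of the two flags, so the double sum telescopes. *)
Lemma sum_hdim_vertex v :
  (\sum_(p : 'I_(\dim {:V}) * 'I_(\dim {:V})) hdim (v, p))%N = \dim (X v).
Proof.
set D := \dim {:V}; pose f i j : int := (\dim (Fl v true i :&: Fl v false j)%VS)%:Z.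
have hE (i j : 'I_D) : (hdim (v, (i, j)))%:Z = (f i.+1 j.+1 - f i j.+1) - (f i.+1 j - f i j).
  have e : (\dim (Nn (v, (i, j))))%:Z + f i j = f i j.+1 + f i.+1 j.
    have := dimv_sum_cap (Fl v true i :&: Fl v false j.+1) (Fl v true i.+1 :&: Fl v false j).
    have -> : ((Fl v true i :&: Fl v false j.+1) :&: (Fl v true i.+1 :&: Fl v false j) =
        Fl v true i :&: Fl v false j)%VS.
      rewrite capvA -[((_ :&: Fl v false j.+1) :&: _)%VS]capvA [(Fl v false j.+1 :&: _)%VS]capvC.
      rewrite capvA (capv_idPl (FlS v true (leqnSn i))) -capvA.
      by rewrite (capv_idPr (FlS v false (leqnSn j))).
    by move=> e0; rewrite -!PoszD; congr Posz; exact: e0.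
  rewrite /hdim -subzn; last exact: dimvS (NnZ _).
  by rewrite -[X in X - _ = _]/(f i.+1 j.+1); move: e; clear; set x := Posz _; lia.
apply/eqP; rewrite -eqz_nat; apply/eqP.
pose g i := f i D - f i 0%N.
have -> : (\sum_(p : 'I_D * 'I_D) hdim (v, p))%N%:Z = \sum_(0 <= i < D) (g i.+1 - g i).
  rewrite big_mkord -(pair_bigA _ (fun i j => hdim (v, (i, j)))) /= -!natz natr_sum.
  apply: eq_bigr => i _; rewrite natr_sum.
  have -> : g i.+1 - g i = (f i.+1 D - f i D) - (f i.+1 0%N - f i 0%N) by rewrite /g; lia.
  rewrite -(telescope_sumr (fun j => f i.+1 j - f i j) (leq0n D)) big_mkord.
  by apply: eq_bigr => j _; rewrite natz hE.
rewrite telescope_sumr // /g /f !Fl0 !cap0v !capv0 dimv0 !Fl_dim // capvv !subr0 //.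
Qed.

Lemma sum_hdim : (\sum_(n : node) hdim n)%N = \dim {:V}.
Proof.
rewrite -X_dim -(eq_bigr _ (fun v _ => sum_hdim_vertex v)) pair_bigA /=.
by apply: eq_bigr => -[].
Qed.

(** Induction on [i + j]: both summands of [Nn] are intersections of flag members of smaller total
    index, so [L] already spans them. *)
Lemma spanning (L : seq V) : (forall n, alive n -> (Zn n <= <<L>> + Nn n)%VS) -> (fullv <= <<L>>)%VS.
Proof.
move=> H; rewrite -X_sum; apply/subv_sumP => v _; set D := \dim {:V}.
suff F k : forall i j, (i + j <= k)%N -> (i <= D)%N -> (j <= D)%N ->
    (Fl v true i :&: Fl v false j <= <<L>>)%VS.
  by have := F (D + D)%N D D (leqnn _) (leqnn _) (leqnn _); rewrite !Fl_dim // capvv.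
elim: k => [|k IH] [|i] [|j]; rewrite ?Fl0 ?cap0v ?capv0 ?sub0v // => le li lj.
pose n : node := (v, (Ordinal li, Ordinal lj)).
have NL : (Nn n <= <<L>>)%VS.
  by rewrite subv_add; apply/andP; split; apply: IH => //=; rewrite ?(ltnW li) ?(ltnW lj) //; lia.
have ZN : (Zn n <= <<L>> + Nn n)%VS.
  have [/H //|] := boolP (alive n); rewrite negbK => s.
  exact: subv_trans s (addvSr _ _).
by rewrite (addv_idPl NL) in ZN.
Qed.

(** * Transport sequences along walks and around cycles *)

Lemma propagate (hh : nat -> half) (m : nat) x : (forall i, (i < m)%N -> nxt (hh i) (hh i.+1)) ->
  x \in Zn (hh 0%N).1 ->
  exists2 xs : nat -> V, xs 0%N = x & (forall i, (i < m)%N -> vl (hh i) (hh i.+1) (xs i) (xs i.+1)).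
Proof.
move=> H xZ; elim: m H => [|m IH] H; first by exists (fun=> x).
have [|xs x0 vx] := IH; first by move=> i lt; apply: H; exact: ltnW.
have Zm : xs m \in Zn (hh m).1.
  case: m {IH H} vx => [|m] vx; first by rewrite x0.
  by have [] := vx m (leqnn _).
have [y vy] := vl_ex (H m (leqnn _)) Zm.
exists (fun i => if i == m.+1 then y else xs i) => [|i]; first by rewrite /= x0.
rewrite ltnS leq_eqVlt => /orP[/eqP->|lt]; first by rewrite eqxx ltn_eqF.
by rewrite !ltn_eqF ?ltnS ?(ltnW lt) //; exact: vx.
Qed.

Lemma vl_cons (hh : nat -> half) x g (g' := fun i => if i is j.+1 then g j else x) :
  vl (hh 0%N) (hh 1%N) x (g 0%N) ->
  (forall i, vl (hh i.+1) (hh i.+2) (g i) (g i.+1)) ->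
  forall i, vl (hh i) (hh i.+1) (g' i) (g' i.+1).
Proof. by move=> v0 vg [|i]; [exact: v0|exact: vg]. Qed.

(* The words describing [W] and the endless walk [hh] diverge at some letter, where the transported
   vector becomes 0. *)
Lemma reach0 v d W : flag v d W -> forall (hh : nat -> half), (forall i, nxt (hh i) (hh i.+1)) ->
  (hh 0%N).1.1 = v -> (hh 0%N).2 = d -> (W <= lo (hh 0%N).1 (hh 0%N).2)%VS ->
  forall x, x \in W -> x \in hi (hh 0%N).1 (~~ (hh 0%N).2) ->
  exists (g : nat -> V) (m : nat), [/\ g 0%N = x, (forall i, vl (hh i) (hh i.+1) (g i) (g i.+1)),
    (forall i, (m <= i)%N -> g i = 0) & (forall i, g i \in Nn (hh i).1)].
Proof.
elim=> {v d W} [v d|v d|a W fW IH|a W fW IH] hh nh e1 e2 sW x xW xhi.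
- exists (fun=> 0), 0%N; move: xW; rewrite memv0 => /eqP->; split=> // i; last exact: mem0v.
  exact: vl0.
- have [al _] := nxt_alive (nh 0%N); case/negP: (alive_jump (hh 0%N).2 al).
  by apply: subv_trans sW; rewrite -e1; exact: flag_sub (Fl_flag _ _ _).
- have xN : x \in Nn (hh 0%N).1 by apply: mem_lo_Nn xhi; exact: (subvP sW).
  have xZ := subvP (NnZ _) _ xN.
  have [al [[b [l e3 e4]]|[b [l e3 e4]]]] := nxtP (nh 0%N).
    (* The walk follows an arrow out of the side on which [x] is an image: here word and walk
       diverge, and the sequence is [x] followed by zeros. *)
    have bx : A b x = 0.
      case: (l) => s1 _ _ _ _; apply: (@im_ker a b); rewrite -?s1 -?e3 ?e1 //.
      by apply: (subvP (limgS _ _)) xW; exact: flag_sub fW.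
    exists (fun i => if i is j.+1 then 0 else x), 1%N; split=> // [|[|i] //|[|i] //]; last exact: mem0v.
    by apply: vl_cons => [|i]; [rewrite -bx; exact: vl_direct|exact: vl0].
  case: (l) => s1 s2 [s3 s4] s5 s6.
  have eb : b = a by apply: hs_inj; [rewrite -s2|rewrite -e3].
  subst b; move/memv_imgP: xW => [y yW ey].
  have yh : y \in hi (hh 1%N).1 (ts a).
    rewrite s5 mem_pre -ey -e3 xhi /=; exact: (subvP (flag_sub fW)).
  have sW1 : (W <= lo (hh 1%N).1 (hh 1%N).2)%VS.
    rewrite e4; case: (@jump (hh 1%N).1 (~~ ts a) W) => //; first by rewrite s1.
    move/(limgS (A a)); rewrite -s3 -e3 => s; case/negP: (alive_jump (hh 0%N).2 al).
    exact: subv_trans s sW.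
  have [||||g [m [g0 vg zg Ng]]] := IH (fun i => hh i.+1) _ _ _ sW1 y yW.
  - by move=> i; exact: nh.
  - by rewrite s1.
  - by [].
  - by rewrite e4 negbK.
  exists (fun i => if i is j.+1 then g j else x), m.+1; split=> // [|[|i] //|[|i] //]; last exact: zg.
  apply: vl_cons => [|i]; last exact: vg.
  rewrite g0 ey; apply: vl_inverse => //; rewrite (ZnE (ts a)) memv_cap yh /=.
  by rewrite -e4; apply: (subvP (subv_trans sW1 (lo_hi _ _))).
- have xN : x \in Nn (hh 0%N).1 by apply: mem_lo_Nn xhi; exact: (subvP sW).
  have xZ := subvP (NnZ _) _ xN.
  have [al [[b [l e3 e4]]|[b [l e3 e4]]]] := nxtP (nh 0%N); case: (l) => s1 s2 [s3 s4] s5 s6; last first.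
    (* If the walk went backwards along an arrow, [hi] would be an image and [W] a preimage on the
       same side, giving [hi <= W <= lo]. *)
    case/negP: (alive_jump (hh 0%N).2 al); apply: subv_trans sW.
    rewrite e3 s3; apply: im_sub_pre; rewrite -?s2 ?e1 -?e3 //.
    by rewrite -s1; exact: flag_sub (Fl_flag _ _ _).
  have eb : b = a by apply: ts_inj; [rewrite -s1|rewrite -e3].
  subst b; move: xW; rewrite mem_pre => /andP[yW xX].
  have sW1 : (W <= lo (hh 1%N).1 (hh 1%N).2)%VS.
    rewrite e4; case: (@jump (hh 1%N).1 (~~ hs a) W) => //; first by rewrite s2.
    move/(preS a); rewrite -s5 -e3 => s; case/negP: (alive_jump (hh 0%N).2 al).
    exact: subv_trans s sW.
  have [||||g [m [g0 vg zg Ng]]] := IH (fun i => hh i.+1) _ _ _ sW1 (A a x) yW.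
  - by move=> i; exact: nh.
  - by rewrite s2.
  - by [].
  - by rewrite e4 negbK s3 memv_img // -e3.
  exists (fun i => if i is j.+1 then g j else x), m.+1; split=> // [|[|i] //|[|i] //]; last exact: zg.
  by apply: vl_cons => [|i]; [rewrite g0; exact: vl_direct|exact: vg].
Qed.

Section Cycle.
Variables (hh : nat -> half) (l : nat).
Hypothesis l_gt0 : (0 < l)%N.
Hypothesis hh_per : forall i, hh (i + l)%N = hh i.
Hypothesis hh_nxt : forall i, nxt (hh i) (hh i.+1).

Lemma hh_perM i k : hh (i + k * l)%N = hh i.
Proof. by elim: k => [|k IH]; rewrite ?addn0 // mulSnr addnA hh_per. Qed.

Lemma hh_mod i j : i = j %[mod l] -> hh i = hh j.
Proof.
move=> e; rewrite (divn_eq i l) (divn_eq j l) e.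
by rewrite ![(_ * l + _)%N]addnC !hh_perM.
Qed.

(* Inverts [\sum_j c j T^j], with [T] the transport around the cycle, on transport sequences that
   end in 0, where [T] is nilpotent. *)
Lemma series_solve (g : nat -> V) (m n : nat) (c : nat -> K) : c 0%N != 0 ->
  (forall i, vl (hh i) (hh i.+1) (g i) (g i.+1)) ->
  (forall i, (m <= i)%N -> g i = 0) -> (forall i, g i \in Nn (hh i).1) ->
  exists s : nat -> V, forall i, [/\ vl (hh i) (hh i.+1) (s i) (s i.+1), s i \in Nn (hh i).1 &
    \sum_(j < n.+1) c j *: s (i + j * l)%N = g i].
Proof.
move=> c0 vg zg Ng.
(* Downward induction on the starting index. From [m] on, 0 is a solution; each earlier value is
   solved for in its own equation, whose first coefficient [c 0] is invertible. *)
suff S t : exists s : nat -> V, forall i, (m <= i + t)%N ->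
   [/\ vl (hh i) (hh i.+1) (s i) (s i.+1), s i \in Nn (hh i).1 &
    \sum_(j < n.+1) c j *: s (i + j * l)%N = g i].
  by have [s H] := S m; exists s => i; apply: H; rewrite leq_addl.
elim: t => [|t [s H]].
  exists (fun=> 0) => i; rewrite addn0 => /zg ->; split; rewrite ?mem0v //; first exact: vl0.
  by rewrite big1 // => j _; rewrite scaler0.
have [lt|le] := ltnP t m; last first.
  by exists s => i _; apply: H; rewrite (leq_trans le) // leq_addl.
pose k := (m - t.+1)%N.
have ek i : (m <= i + t.+1)%N -> i = k \/ (k < i)%N /\ (m <= i + t)%N by rewrite /k; lia.
pose sk := (c 0%N)^-1 *: (g k - \sum_(j < n) c j.+1 *: s (k + j.+1 * l)%N).
have big_s (u : nat -> V) i : c 0%N *: u i + \sum_(j < n) c j.+1 *: u (i + j.+1 * l)%N =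
   \sum_(j < n.+1) c j *: u (i + j * l)%N.
  by rewrite big_ord_recl addn0.
have Hgt i : (k < i)%N -> (m <= i + t)%N by rewrite /k; lia.
exists (fun i => if i == k then sk else s i) => i /ek[->|[ki /H[v1 N1 q1]]]; last first.
  rewrite !gtn_eqF ?(leqW ki) //; split=> //; rewrite -[RHS]q1; apply: eq_bigr => j _.
  by rewrite gtn_eqF // (leq_trans ki) // leq_addr.
rewrite eqxx gtn_eqF //; split.
- have [_ _ q] := H k.+1 (Hgt _ (leqnn _)).
  (* The next value is written by the same formula as [sk] with all indices shifted by one, so the
     transport relation passes to it by linearity. *)
  have -> : s k.+1 = (c 0%N)^-1 *: (g k.+1 - \sum_(j < n) c j.+1 *: s (k.+1 + j.+1 * l)%N).
    by rewrite -q -big_s addrK scalerA mulVf // scale1r.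
  apply/vlZ/vlB => //; apply: vl_sum => j.
  have [|v1 _ _] := H (k + j.+1 * l)%N; first by apply: Hgt; rewrite -addn1 leq_add2l muln_gt0.
  by move: v1; rewrite -addSn !hh_perM.
- apply/rpredZ/rpredB => //; apply: rpred_sum => j _; apply: rpredZ.
  have [|_ N1 _] := H (k + j.+1 * l)%N; first by apply: Hgt; rewrite -addn1 leq_add2l muln_gt0.
  by rewrite hh_perM in N1.
- rewrite big_ord_recl addn0 eqxx scalerA mulfV // scale1r.
  rewrite [X in _ + X = _](eq_bigr (fun j : 'I_n => c j.+1 *: s (k + j.+1 * l)%N)) ?subrK // => j _.
  by rewrite lift0 gtn_eqF // -addn1 leq_add2l muln_gt0.
Qed.

End Cycle.

Lemma modn_mul_pred (k p i : nat) : (0 < p)%N -> (i <= k * p)%N -> (k * p - i) * p.-1 = i %[mod p].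
Proof.
case: p => // p _ le; rewrite -[RHS](modnMDl (k * p.+1 - i)); set q := (k * p.+1 - i)%N.
by rewrite mulnS addnAC [(q + i)%N]subnK // modnMDl.
Qed.

Section CycleClosing.
Variables (hh : nat -> half) (l : nat).
Hypothesis l_gt0 : (0 < l)%N.
Hypothesis hh_per : forall i, hh (i + l)%N = hh i.
Hypothesis hh_nxt : forall i, nxt (hh i) (hh i.+1).

(** The cycle walked backwards. Modulo [l], the index [i * l.-1] is [- i], which keeps indices
    natural. *)
Let rv i := flip (hh (i * l.-1)%N).

Lemma rv_per i : rv (i + l)%N = rv i.
Proof.
rewrite /rv; congr flip; apply: (hh_mod hh_per).
by rewrite mulnDl [(l * _)%N]mulnC addnC modnMDl.
Qed.

Lemma rv_nxt i : nxt (rv i) (rv i.+1).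
Proof.
rewrite -nxt_sym mulSn; have -> : hh (i * l.-1)%N = hh (l.-1 + i * l.-1).+1.
  by rewrite -addSn prednK // addnC hh_per.
exact: hh_nxt.
Qed.

(* [xs] is corrected on both sides of [Nn = lo :&: hi + hi :&: lo]: forward transport is nilpotent on
   one summand, backward transport on the other. *)
Lemma cycle_close (n : nat) (c : nat -> K) (xs : nat -> V) : c 0%N != 0 -> c n != 0 ->
  (forall i, (i < n * l)%N -> vl (hh i) (hh i.+1) (xs i) (xs i.+1)) ->
  \sum_(j < n.+1) c j *: xs (j * l)%N \in Nn (hh 0%N).1 ->
  exists ys : nat -> V, [/\ (forall i, (i < n * l)%N -> vl (hh i) (hh i.+1) (ys i) (ys i.+1)),
    ys 0%N - xs 0%N \in Nn (hh 0%N).1 & \sum_(j < n.+1) c j *: ys (j * l)%N = 0].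
Proof.
move=> c0 cn vx; set d := (hh 0%N).2; rewrite (NnE d) => /memv_addP[g gN [f fN ez]].
move: gN fN; rewrite !memv_cap => /andP[gl gh] /andP[fh fl].
have [G [m [G0 vG zG NG]]] := reach0 (Fl_flag _ _ _) hh_nxt erefl erefl (subvv _) gl gh.
have [s Hs] := series_solve l_gt0 hh_per n c0 vG zG NG.
have fh' : f \in hi (rv 0%N).1 (~~ (rv 0%N).2) by rewrite /= negbK.
have [F [p [F0 vF zF NF]]] := reach0 (Fl_flag _ _ _) rv_nxt erefl erefl (subvv _) fl fh'.
(* On the reversed walk the coefficients occur in the opposite order, so it is [c n] that has to be
   invertible; the correction [r] enters [ys] with reversed index. *)
have cn' : c (n - 0)%N != 0 by rewrite subn0.
have [r Hr] := series_solve l_gt0 rv_per (c := fun j => c (n - j)%N) n cn' vF zF NF.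
exists (fun i => xs i - s i - r (n * l - i)%N); split.
- move=> i lt; apply: vlB; first by apply: vlB; [exact: vx | case: (Hs i)].
  have ei : (n * l - i = (n * l - i.+1).+1)%N by rewrite subnS prednK // subn_gt0.
  rewrite ei; have [/vl_flip v _ _] := Hr (n * l - i.+1)%N.
  move: v; rewrite /rv !flipK -ei.
  rewrite (hh_mod hh_per (modn_mul_pred l_gt0 lt)).
  by rewrite (hh_mod hh_per (modn_mul_pred l_gt0 (ltnW lt))).
- have -> : xs 0%N - s 0%N - r (n * l - 0)%N - xs 0%N = - (s 0%N + r (n * l)%N).
    by rewrite subn0 opprD [X in X = _]addrAC [xs 0%N - _ - _]addrAC subrr add0r.
  have [_ Ns _] := Hs 0%N; have [_ Nr _] := Hr (n * l)%N; rewrite -NnE rpredN rpredD //.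
  have e : rv (n * l)%N = rv 0%N by rewrite -[(n * l)%N]add0n (hh_perM rv_per).
  by move: Nr; rewrite e /rv mul0n.
rewrite (eq_bigr (fun j : 'I_n.+1 => c j *: xs (j * l)%N - c j *: s (j * l)%N
  - c j *: r (n * l - j * l)%N)); last by move=> j _; rewrite !scalerBr.
rewrite !sumrB ez; have [_ _ es] := Hs 0%N; have [_ _ er] := Hr 0%N.
have -> : \sum_(j < n.+1) c j *: s (j * l)%N = g by rewrite -[RHS]G0 -es.
have -> : \sum_(j < n.+1) c j *: r (n * l - j * l)%N = f.
  rewrite -[RHS]F0 -er (reindex_inj rev_ord_inj); apply: eq_bigr => j _ /=.
  rewrite subSS -mulnBl subKn ?add0n // -ltnS; exact: ltn_ord.
by rewrite [g + f]addrC addrK subrr.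
Qed.

End CycleClosing.

Hypothesis A_kill : forall a v x, x \in X v -> v != src a -> A a x = 0.

(** * Cutting chains into blocks *)

Definition bad (bk : seq V) x := [exists a, A a x \notin <<bk>>%VS].
Definition nbad (bk : seq V) := count (bad bk) bk.

Lemma good_of_sides n d x bk : x \in Zn n -> side_ok n d x <<bk>>%VS ->
  side_ok n (~~ d) x <<bk>>%VS -> ~~ bad bk x.
Proof.
move=> xZ ok1 ok2; rewrite negb_exists; apply/forallP => a; rewrite negbK.
have [e|ne] := eqVneq n.1 (src a); last first.
  by rewrite (A_kill (subvP (Zn_X n) _ xZ)) ?mem0v.
by have [e'|e'] := eqVneq (ts a) d; [apply: ok1 | apply: ok2 => //; move: e'; case: (ts a); case: (d)].
Qed.

Lemma vl_side_back h h' x y U : nxt h h' -> vl h h' x y -> x \in U -> side_ok h'.1 (~~ h'.2) y U.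
Proof. by rewrite nxt_sym => l /vl_flip v; exact: (vl_side l v). Qed.

Section Segments.
Variables (hh : nat -> half) (xs : nat -> V).

(** A link arrow at an inner vector leads to a neighbour in the segment, and any other arrow kills
    the vector. Only the outer sides of the two end vectors need an assumption. *)
Lemma segment_good s L i (bk := [seq xs j | j <- iota s L]) :
    (forall i, (s <= i)%N -> (i.+1 < s + L)%N ->
       nxt (hh i) (hh i.+1) /\ vl (hh i) (hh i.+1) (xs i) (xs i.+1)) ->
    (forall i, (s <= i < s + L)%N -> xs i \in Zn (hh i).1) ->
  (s <= i < s + L)%N ->
  (i = s -> side_ok (hh i).1 (~~ (hh i).2) (xs i) <<bk>>%VS) ->
  (i.+1 = s + L -> side_ok (hh i).1 (hh i).2 (xs i) <<bk>>%VS)%N ->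
  ~~ bad bk (xs i).
Proof.
move=> H HZ ri es eL; have mb j : (s <= j < s + L)%N -> xs j \in <<bk>>%VS.
  by move=> rj; apply: memv_span; rewrite map_f // mem_iota.
apply: (good_of_sides (d := (hh i).2) (HZ i ri)).
  have [/eL//|ne] := eqVneq i.+1 (s + L)%N.
  have [lt sl] : (i.+1 < s + L)%N /\ (s <= i)%N by move/andP: ri => [? ?]; rewrite ltn_neqAle ne.
  have [n1 v1] := H i sl lt; apply: (vl_side n1 v1); apply: mb.
  by rewrite lt (leq_trans sl).
have [/es//|ne] := eqVneq i s.
case: i ne ri es eL => [|i] ne ri es eL; first by move: ri ne; rewrite leqn0 eq_sym => /andP[->].
have [sl lt] : (s <= i)%N /\ (i.+1 < s + L)%N.
  by move/andP: ri => [h1 ->]; split=> //; rewrite -ltnS ltn_neqAle eq_sym ne.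
have [n1 v1] := H i sl lt; apply: (vl_side_back n1 v1); apply: mb.
by rewrite sl ltnW.
Qed.

Lemma segment_nbad s L :
    (forall i, (s <= i)%N -> (i.+1 < s + L)%N ->
       nxt (hh i) (hh i.+1) /\ vl (hh i) (hh i.+1) (xs i) (xs i.+1)) ->
    (forall i, (s <= i < s + L)%N -> xs i \in Zn (hh i).1) ->
  (nbad [seq xs j | j <- iota s L] <= 2)%N.
Proof.
move=> H HZ; rewrite /nbad count_map; set p := preim _ _.
apply: (@leq_trans (count (predU (pred1 s) (pred1 (s + L).-1)) (iota s L))).
  rewrite (@eq_in_count _ p (predI p [pred i | s <= i < s + L]%N)); last first.
    by move=> i; rewrite mem_iota => ri; rewrite /= ri andbT.
  apply: sub_count => i /= /andP[bi ri]; apply: contraLR bi.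
  rewrite negb_or => /andP[n1 n2]; apply: segment_good => // e; [by rewrite e eqxx in n1|].
  by rewrite -e /= eqxx in n2.
rewrite -[X in (X <= _)%N]addn0.
apply: leq_trans (_ : count (pred1 s) (iota s L) + count (pred1 (s + L).-1) (iota s L) <= 2)%N.
  by rewrite -count_predUI leq_add2l.
by rewrite !count_uniq_mem ?iota_uniq // (leq_add (leq_b1 _) (leq_b1 _)).
Qed.

(** All blocks have length [k] except possibly a shorter last one, which accounts for the summand
    [+ k]; a block has two ends, which accounts for the factor 2. *)
Lemma cut k s L : (0 < k)%N ->
    (forall i, (s <= i)%N -> (i.+1 < s + L)%N ->
       nxt (hh i) (hh i.+1) /\ vl (hh i) (hh i.+1) (xs i) (xs i.+1)) ->
    (forall i, (s <= i < s + L)%N -> xs i \in Zn (hh i).1) ->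
  exists bs : seq (seq V), [/\ flatten bs = [seq xs i | i <- iota s L],
    all (fun bk => size bk <= k)%N bs, (\sum_(bk <- bs) nbad bk <= 2 * size bs)%N &
    (k * size bs <= L + k)%N].
Proof.
move=> k0; have [m] := ubnP L; elim: m s L => // m IH s L /ltnSE leL H HZ.
have [le|lt] := leqP L k.
  exists [:: [seq xs i | i <- iota s L]]; split; rewrite /= ?cats0 ?size_map ?size_iota ?le //.
    by rewrite big_seq1 muln1 segment_nbad.
  by rewrite muln1 leq_addl.
have eL : (s + k + (L - k) = s + L)%N by rewrite -addnA subnKC // ltnW.
have [||| bs [e1 e2 e3 e4]] := IH (s + k)%N (L - k)%N.
- by lia.
- by rewrite eL => i h1 h2; apply: H => //; apply: leq_trans h1; exact: leq_addr.
- by rewrite eL => i /andP[h1 h2]; apply: HZ; rewrite h2 (leq_trans _ h1) // leq_addr.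
exists ([seq xs i | i <- iota s k] :: bs); split.
- by rewrite /= e1 -map_cat -iotaD subnKC // ltnW.
- by rewrite /= size_map size_iota leqnn.
- rewrite big_cons mulnS leq_add // segment_nbad // => [i h1 h2|i /andP[h1 h2]].
    by apply: H => //; apply: leq_trans h2 _; rewrite leq_add2l ltnW.
  by apply: HZ; rewrite h1 (leq_trans h2) // leq_add2l ltnW.
- by rewrite /= mulnS; move: e4 lt; clear; lia.
Qed.

(** The factor 4 comes from [2 (L + k) <= 4 L] for [L > k]. A segment with [L <= k] stays in one
    block, for which the bound is met by having no bad vector. *)
Lemma blocks_of_segment k L : (0 < k)%N -> (0 < L)%N ->
    (forall i, (i.+1 < L)%N ->
       nxt (hh i) (hh i.+1) /\ vl (hh i) (hh i.+1) (xs i) (xs i.+1)) ->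
    (forall i, (i < L)%N -> xs i \in Zn (hh i).1) ->
    ((L <= k)%N -> nbad [seq xs i | i <- iota 0 L] = 0%N) ->
  exists bs : seq (seq V), [/\ flatten bs = [seq xs i | i <- iota 0 L],
    all (fun bk => size bk <= k)%N bs & (k * \sum_(bk <- bs) nbad bk <= 4 * L)%N].
Proof.
move=> k0 L0 H HZ small; have [le|lt] := leqP L k.
  exists [:: [seq xs i | i <- iota 0 L]]; split; rewrite /= ?cats0 ?size_map ?size_iota ?le //.
  by rewrite big_seq1 small // muln0.
have [||bs [e1 e2 e3 e4]] := @cut k 0%N L k0.
- by move=> i _; exact: H.
- by move=> i /andP[_]; exact: HZ.
exists bs; split=> //; move: e3 e4 lt; set S := bigop _ _ _ => e3 e4 lt.
have le1 : (k * S <= k * (2 * size bs))%N by rewrite leq_mul2l e3 orbT.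
apply: leq_trans le1 _; rewrite mulnCA; move: e4 lt; clear; lia.
Qed.

End Segments.

(** Independence is absent: the size is recorded instead, and a comparison with the dimension of [V]
    over all components yields a basis. *)
Definition blocks_ok k (c : seq half) (bs : seq (seq V)) :=
  [/\ all (fun bk => size bk <= k)%N bs, (forall x, x \in flatten bs -> exists v, x \in X v),
    size (flatten bs) = (\sum_(h <- c) hdim h.1)%N,
    (forall h, h \in c -> (Zn h.1 <= <<flatten bs>> + Nn h.1)%VS) &
    (k * \sum_(bk <- bs) nbad bk <= 4 * size (flatten bs))%N].

Lemma size_flatten2 (I : Type) (rs : seq I) (F : I -> seq (seq V)) :
  size (flatten (flatten [seq F t | t <- rs])) = (\sum_(t <- rs) size (flatten (F t)))%N.
Proof.
elim: rs => [|t rs IH]; first by rewrite big_nil.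
by rewrite big_cons /= flatten_cat size_cat IH.
Qed.

Lemma mem_flatten2 (I : eqType) (rs : seq I) (F : I -> seq (seq V)) x :
  reflect (exists2 t, t \in rs & x \in flatten (F t)) (x \in flatten (flatten [seq F t | t <- rs])).
Proof.
apply: (iffP flattenP) => [[bk /flatten_mapP[t tr bF] xb]|[t tr /flattenP[bk bF xb]]].
  by exists t => //; apply/flattenP; exists bk.
by exists bk => //; apply/flatten_mapP; exists t.
Qed.

(** * Blocks for one path or cycle of graded pieces *)

Section Component.
Variables (k : nat) (h0 : half) (c : seq half).
Let l := size (h0 :: c).
Variable hh : nat -> half.
Hypothesis hh_nth : forall i, (i < l)%N -> hh i = nth h0 (h0 :: c) i.
Hypothesis hh_per : forall i, hh (i + l)%N = hh i.
Hypothesis k_gt0 : (0 < k)%N.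
Hypothesis c_path : path nxt h0 c.

Let hh0 : hh 0%N = h0. Proof. by rewrite hh_nth. Qed.

Let hh_nxt i : (i.+1 < l)%N -> nxt (hh i) (hh i.+1).
Proof. by move=> lt; rewrite !hh_nth ?(ltnW lt) //; apply: (pathP h0 c_path). Qed.

Lemma component_hdim i : (i < l)%N -> hdim (hh i).1 = hdim h0.1.
Proof.
elim: i => [|i IH] lt; first by rewrite hh0.
by rewrite -IH ?(ltnW lt) //; apply: hdim_nxt; exact: hh_nxt.
Qed.

(** Common end of the path case and the cycle case. Each [t] indexes a thread, a transport sequence
    that runs [nn t] times through the chain; [xs t (i + j * l)] is its vector at the node [i]
    during the turn [j]. The threads need to span only at [h0], as links carry spanning families
    onwards. *)
Lemma assemble (I : eqType) (rs : seq I) (xs : I -> nat -> V) (nn : I -> nat)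
    (bs : I -> seq (seq V)) :
  (forall t j i, t \in rs -> (j < nn t)%N -> (i.+1 < l)%N ->
     vl (hh i) (hh i.+1) (xs t (i + j * l)%N) (xs t (i.+1 + j * l)%N)) ->
  (forall t i, t \in rs -> (i < nn t * l)%N -> xs t i \in Zn (hh i).1) ->
  (forall t, t \in rs -> [/\ flatten (bs t) = [seq xs t i | i <- iota 0 (nn t * l)],
     all (fun bk => size bk <= k)%N (bs t) & (k * \sum_(bk <- bs t) nbad bk <= 4 * (nn t * l))%N]) ->
  (Zn h0.1 <= <<[seq xs t (j * l)%N | t <- rs, j <- iota 0 (nn t)]>> + Nn h0.1)%VS ->
  (\sum_(t <- rs) nn t)%N = hdim h0.1 ->
  blocks_ok k (h0 :: c) (flatten [seq bs t | t <- rs]).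
Proof.
move=> Hv HZ Hb Hs Hn.
have sz t : t \in rs -> size (flatten (bs t)) = (nn t * l)%N.
  by case/Hb => -> _ _; rewrite size_map size_iota.
have szt : size (flatten (flatten [seq bs t | t <- rs])) = (hdim h0.1 * l)%N.
  by rewrite size_flatten2 (eq_big_seq _ sz) -big_distrl /= Hn.
split.
- by apply/allP => bk /flatten_mapP[t /Hb[_ /allP H _] bt]; exact: (H _ bt).
- move=> x /mem_flatten2[t tr]; have [-> _ _] := Hb t tr => /mapP[i].
  rewrite mem_iota => /andP[_ lt] ->; exists (hh i).1.1.
  exact: (subvP (Zn_X _) _ (HZ t i tr lt)).
- rewrite szt (eq_big_seq (fun=> hdim h0.1)); first by rewrite big_const_seq count_predT iter_addn_0.
  by move=> h /(nthP h0)[i lt <-]; rewrite -hh_nth // component_hdim.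
- pose P := [seq (t, j) | t <- rs, j <- iota 0 (nn t)].
  have PP p : p \in P -> p.1 \in rs /\ (p.2 < nn p.1)%N.
    by case/allpairsPdep => t [j [tr]]; rewrite mem_iota => /andP[_ lt] ->.
  have Si i : (i < l)%N -> (Zn (hh i).1 <= <<[seq xs p.1 (i + p.2 * l)%N | p <- P]>> + Nn (hh i).1)%VS.
    elim: i => [|i IH] lt.
      by rewrite hh0; apply: subv_trans Hs _; rewrite /P map_allpairs.
    apply: (span_transfer (hh_nxt lt) _ (IH (ltnW lt))) => p /PP[p1 p2].
    exact: Hv.
  move=> h /(nthP h0)[i lt <-]; rewrite -hh_nth //; apply: subv_trans (Si i lt) _.
  apply: addvS => //; apply: sub_span => x /mapP[p /PP[p1 p2] ->].
  apply/mem_flatten2; exists p.1 => //; have [-> _ _] := Hb _ p1.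
  rewrite map_f // mem_iota add0n /=; have : (p.2.+1 * l <= nn p.1 * l)%N by rewrite leq_mul2r p2 orbT.
  by apply: leq_trans; rewrite mulSn ltn_add2r.
- rewrite szt -Hn big_distrl /= big_distrr /= big_flatten big_map big_distrr /=.
  rewrite big_seq [X in (_ <= X)%N]big_seq; apply: leq_sum => t /Hb[_ _ H].
  by rewrite -big_distrr.
Qed.

(** One thread for each basis vector of a complement of [Nn] in [Zn] at the first node. The unlinked
    ends are killed by the arrows on their outer sides, so an uncut thread has no bad vector. *)
Lemma path_blocks : (forall h, ~~ link (last h0 c) h) -> (forall h, ~~ link (flip h0) h) ->
  alive h0.1 -> exists bs, blocks_ok k (h0 :: c) bs.
Proof.
move=> nlast nfirst al; set rs : seq V := vbasis (Zn h0.1 :\: Nn h0.1)%VS.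
have al_hh i : (i < l)%N -> alive (hh i).1.
  case: i => [|i] lt; first by rewrite hh0.
  by have [] := nxt_alive (hh_nxt lt).
have H y : exists p : (nat -> V) * seq (seq V), y \in rs ->
  [/\ p.1 0%N = y, forall i, (i.+1 < l)%N -> vl (hh i) (hh i.+1) (p.1 i) (p.1 i.+1),
    forall i, (i < l)%N -> p.1 i \in Zn (hh i).1 &
    [/\ flatten p.2 = [seq p.1 i | i <- iota 0 l], all (fun bk => size bk <= k)%N p.2 &
      (k * \sum_(bk <- p.2) nbad bk <= 4 * l)%N]].
  case: (boolP (y \in rs)) => [yr|_]; last by exists (fun=> 0, [::]).
  have yZ : y \in Zn (hh 0%N).1 by rewrite hh0; apply: (subvP (diffvSl _ _)); exact: vbasis_mem yr.
  have [xs x0 vx] := @propagate hh l.-1 y (fun i lt => hh_nxt (i := i) lt) yZ.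
  have xZ i : (i < l)%N -> xs i \in Zn (hh i).1.
    case: i => [|i] lt; first by rewrite x0.
    by have [] := vx i lt.
  have [|//||bs [b1 b2 b3]] := @blocks_of_segment hh xs k l k_gt0 (ltn0Sn _).
  - by move=> i lt; split; [exact: hh_nxt|exact: vx].
  - move=> _; apply/eqP; rewrite -leqn0 leqNgt -has_count; apply/hasPn => x /mapP[i].
    rewrite mem_iota => /andP[_ lt] ->; apply: (@segment_good hh xs 0%N l i) => //.
    + by move=> j _ ltj; split; [exact: hh_nxt|exact: vx].
    + move=> i0 a; rewrite i0 => sa ta.
      have nl h : ~~ link ((hh 0%N).1, ~~ (hh 0%N).2) h by rewrite hh0; exact: nfirst.
      by rewrite (unlinked_kill (al_hh 0%N (ltn0Sn _)) nl sa ta (xZ 0%N (ltn0Sn _))) mem0v.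
    + move=> il a sa ta; have nl h : ~~ link ((hh i).1, (hh i).2) h.
        have -> : ((hh i).1, (hh i).2) = last h0 c.
          by rewrite -surjective_pairing hh_nth // (last_nth h0); move: il; rewrite add0n => -[->].
        exact: nlast.
      by rewrite (unlinked_kill (al_hh i lt) nl sa ta (xZ i lt)) mem0v.
  by exists (xs, bs).
have [f Hf] := choice H.
exists (flatten [seq (f t).2 | t <- rs]).
apply: (@assemble _ rs (fun t => (f t).1) (fun=> 1%N) (fun t => (f t).2)).
- by move=> t j i /Hf[_ v _ _]; rewrite ltnS leqn0 => /eqP-> lt; rewrite mul0n !addn0; exact: v.
- by move=> t i /Hf[_ _ z _]; rewrite mul1n; exact: z.
- by move=> t /Hf[_ _ _ b]; rewrite mul1n.
- have -> : [seq (f t).1 (j * l)%N | t <- rs, j <- iota 0 1] = rs.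
    rewrite -[RHS]map_id /= ; have : {subset rs <= rs} by [].
    elim: {1 3 4}rs => //= y r IH s; rewrite mul0n; have [-> _ _ _] := Hf y (s _ (mem_head _ _)).
    by rewrite IH // => z zr; apply: s; rewrite inE zr orbT.
  by rewrite (span_basis (vbasisP _)) addv_diff addvSl.
- by rewrite big_const_seq count_predT iter_addn_0 mul1n /rs size_tuple hdim_diff.
Qed.

Section CyclicComponent.
Hypothesis c_cycle : nxt (last h0 c) h0.

Let cyc_nxt i : nxt (hh i) (hh i.+1).
Proof.
have [r [lt -> ->]] : exists r, [/\ (r < l)%N, hh i = hh r & hh i.+1 = hh r.+1].
  exists (i %% l)%N; split; first exact: ltn_pmod.
    by apply: (hh_mod hh_per); rewrite modn_mod.
  by apply: (hh_mod hh_per); rewrite -[i.+1]addn1 -[(i %% l).+1]addn1 modnDml.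
have [lt'|ge] := ltnP r.+1 l; first exact: hh_nxt.
have er : r.+1 = l by apply/eqP; rewrite eqn_leq lt ge.
have -> : hh r = last h0 c by rewrite hh_nth // (last_nth h0); case: er => ->.
by rewrite er -[l]add0n hh_per hh0.
Qed.

Lemma window_Nn (m : nat) (zs : nat -> V) :
  (forall i, (i < m)%N -> vl (hh i) (hh i.+1) (zs i) (zs i.+1)) ->
  (zs m \in Nn (hh m).1) = (zs 0%N \in Nn h0.1).
Proof.
elim: m => [|m IH] H; first by rewrite hh0.
by rewrite -(vl_N (cyc_nxt m) (H m (ltnSn _))) IH // => i lt; apply: H; exact: ltnW.
Qed.

(** The relation has both extreme coefficients invertible. It expresses the vector after the last
    one by vectors of the segment; and after an arrow on the outer side of the first vector is
    applied, it expresses the image of that vector by images of [xs (j * l)], [j > 0], which lie in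
    the segment. *)
Lemma closed_segment_good (m : nat) (q : nat -> K) (xs : nat -> V) : (0 < m)%N ->
  q 0%N != 0 -> q m != 0 ->
  (forall i, (i < m * l)%N -> vl (hh i) (hh i.+1) (xs i) (xs i.+1)) ->
  \sum_(j < m.+1) q j *: xs (j * l)%N = 0 -> nbad [seq xs i | i <- iota 0 (m * l)] = 0%N.
Proof.
move=> m0 q0 qm vx; set bk := map _ _ => e0.
have mb j : (j < m * l)%N -> xs j \in <<bk>>%VS.
  by move=> lt; apply: memv_span; rewrite map_f // mem_iota.
apply/eqP; rewrite -leqn0 leqNgt -has_count; apply/hasPn => x /mapP[i].
rewrite mem_iota => /andP[_ lt] ->; apply: (@segment_good hh xs 0%N (m * l) i) => //.
- by move=> j _ ltj; split; [exact: cyc_nxt|apply: vx; exact: ltnW].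
- by move=> j /andP[_ ltj]; have [] := vx j ltj.
- move=> i0 a sa ta; move: sa ta; rewrite i0 => sa ta; rewrite -/bk.
  move/(congr1 (A a)): e0; rewrite big_ord_recl mul0n linearD linearZ linear0 /= => /eqP.
  rewrite addr_eq0 => /eqP eA; rewrite -[A a _](scalerK q0) eA; apply: rpredZ.
  rewrite rpredN linear_sum; apply: rpred_sum => j _; rewrite linearZ; apply: rpredZ => /=.
  have lj : (0 < (lift ord0 j) * l)%N by rewrite lift0 muln_gt0.
  have lej : ((lift ord0 j) * l <= m * l)%N by rewrite leq_mul2r ltn_ord orbT.
  have := vl_side_back (cyc_nxt _) (vx (lift ord0 j * l).-1 _); rewrite prednK // => /(_ <<bk>>%VS lej).
  have -> : hh (lift ord0 j * l) = hh 0%N by rewrite -[(_ * l)%N]add0n (hh_perM hh_per).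
  by apply=> //; apply: mb; rewrite prednK.
- move=> il; rewrite add0n in il; have vi := vx i lt; apply: (vl_side (cyc_nxt i) vi); rewrite il -/bk.
  move: e0; rewrite big_ord_recr /= => /eqP; rewrite addrC addr_eq0 => /eqP e.
  rewrite -[xs _](scalerK qm) e; apply: rpredZ; rewrite rpredN; apply: rpred_sum => j _.
  by apply: rpredZ; apply: mb; rewrite ltn_mul2r ltn_ord.
Qed.

Let U := (Zn h0.1 :\: Nn h0.1)%VS.

(** The complement [U] stands for the quotient [Zn / Nn]. Transport once around the cycle is only a
    relation on [Zn], but it preserves and reflects [Nn]; choices on a basis of [U] extend linearly
    to an injective map, correct modulo [Nn] for every transport sequence. *)
Lemma monodromy : exists tau : 'End(V), [/\ (tau @: U <= U)%VS,
  (forall u, u \in U -> tau u = 0 -> u = 0) &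
  forall u ys, u \in U -> (forall i, (i < l)%N -> vl (hh i) (hh i.+1) (ys i) (ys i.+1)) ->
    ys 0%N - u \in Nn h0.1 -> ys l - tau u \in Nn h0.1].
Proof.
have UZ : (U <= Zn h0.1)%VS by exact: diffvSl.
have hl : hh l = h0 by rewrite -[l]add0n hh_per hh0.
have H x : exists p : V * (nat -> V), x \in Zn h0.1 -> [/\ p.1 \in U, p.2 0%N = x,
    forall i, (i < l)%N -> vl (hh i) (hh i.+1) (p.2 i) (p.2 i.+1) & p.2 l - p.1 \in Nn h0.1].
  case: (boolP (x \in Zn h0.1)) => [xZ|_]; last by exists (0, fun=> 0).
  have xZ0 : x \in Zn (hh 0%N).1 by rewrite hh0.
  have [xs x0 vx] := @propagate hh l x (fun i _ => cyc_nxt i) xZ0.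
  have : xs l \in Zn h0.1 by have [] := vx l.-1 (ltnSn _); rewrite hl.
  rewrite -(addv_idPl (NnZ h0.1)) -addv_diff => /memv_addP[u uU [w wN e]].
  by exists (u, xs) => _; split=> //=; rewrite e addrC addKr.
have {H}[f Hf] := choice H.
set r : seq V := vbasis U.
have [tau0 Htau] := linear_of_free r [seq (f e).1 | e <- r].
have {}Htau e : e \in r -> tau0 e = (f e).1.
  have /eq_in_map := Htau (basis_free (vbasisP U)) (size_map _ _); exact.
have key u : u \in U -> tau0 u \in U /\ exists xs, [/\ xs 0%N = u,
    forall i, (i < l)%N -> vl (hh i) (hh i.+1) (xs i) (xs i.+1) & xs l - tau0 u \in Nn h0.1].
  move=> uU; have eu := coord_basis (vbasisP U) uU.
  have rn (i : 'I_(\dim U)) : (vbasis U)`_i \in r by rewrite mem_nth // size_tuple.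
  have rZ (i : 'I_(\dim U)) : (vbasis U)`_i \in Zn h0.1.
    by apply: (subvP UZ); apply: vbasis_mem; exact: rn.
  have et : tau0 u = \sum_(i < \dim U) coord (vbasis U) i u *: (f (vbasis U)`_i).1.
    by rewrite {1}eu linear_sum; apply: eq_bigr => i _; rewrite linearZ /= Htau.
  split; first by rewrite et; apply: rpred_sum => i _; apply: rpredZ; have [] := Hf _ (rZ i).
  exists (fun j => \sum_(i < \dim U) coord (vbasis U) i u *: (f (vbasis U)`_i).2 j); split.
  - by rewrite [RHS]eu; apply: eq_bigr => i _; have [_ -> _ _] := Hf _ (rZ i).
  - by move=> j lt; apply: vl_sum => i; have [_ _ v _] := Hf _ (rZ i); exact: v.
  - rewrite et -sumrB; apply: rpred_sum => i _; rewrite -scalerBr; apply: rpredZ.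
    by have [_ _ _] := Hf _ (rZ i).
exists (linfun tau0); split.
- by apply/subvP => _ /memv_imgP[u uU ->]; rewrite lfunE /=; have [] := key u uU.
- move=> u uU; rewrite lfunE /= => t0; have [_ [xs [x0 vx]]] := key u uU.
  rewrite t0 subr0 -{1}hl (window_Nn vx) x0 => uN.
  by apply/eqP; rewrite -memv0 -(capv_diff (Zn h0.1) (Nn h0.1)) memv_cap uU.
- move=> u ys uU vy yu; rewrite lfunE /=; have [_ [xs [x0 vx xt]]] := key u uU.
  rewrite -[ys l](subrK (xs l)) -addrA rpredD // -hl.
  by rewrite (window_Nn (zs := fun i => ys i - xs i)) ?x0 // => i lt; apply: vlB; [exact: vy|exact: vx].
Qed.

(** A cyclic summand with generator [u] and polynomial [p] becomes a thread of as many turns as the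
    degree of [p]. After [j] turns it agrees with [tau^j u] modulo [Nn], so it satisfies the
    relation given by [p] modulo [Nn], and [cycle_close] makes this exact. The constant coefficient
    of [p] is nonzero because [tau] is injective. *)
Lemma cycle_blocks : exists bs, blocks_ok k (h0 :: c) bs.
Proof.
have [tau [tU tinj tN]] := monodromy.
have [s [Hs bs]] := cyclic_decomposition tU.
have UZ : (U <= Zn h0.1)%VS by exact: diffvSl.
pose nn (t : V * {poly K}) := (size t.2).-1.
have iterN t xs : t.1 \in U -> xs 0%N - t.1 \in Nn h0.1 ->
    (forall i, (i < nn t * l)%N -> vl (hh i) (hh i.+1) (xs i) (xs i.+1)) ->
    forall j, (j <= nn t)%N -> xs (j * l)%N - iter j tau t.1 \in Nn h0.1.
  move=> tUU x0 vx; elim=> [|j IH] lt //.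
  have := tN (iter j tau t.1) (fun i => xs (j * l + i)%N) (iter_stable tU j tUU).
  rewrite addn0 mulSn [(l + _)%N]addnC; apply; last by apply: IH; exact: ltnW.
  have eh p : hh (j * l + p)%N = hh p by rewrite addnC (hh_perM hh_per).
  move=> i li; have := vx (j * l + i)%N; rewrite -addnS !eh; apply.
  by apply: leq_trans (_ : j.+1 * l <= _)%N; rewrite ?leq_mul2r ?lt ?orbT // mulSn addnC ltn_add2r.
have H t : exists p : (nat -> V) * seq (seq V), t \in s ->
  [/\ p.1 0%N - t.1 \in Nn h0.1,
    forall i, (i < nn t * l)%N -> vl (hh i) (hh i.+1) (p.1 i) (p.1 i.+1) &
    [/\ flatten p.2 = [seq p.1 i | i <- iota 0 (nn t * l)], all (fun bk => size bk <= k)%N p.2 &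
      (k * \sum_(bk <- p.2) nbad bk <= 4 * (nn t * l))%N]].
  case: (boolP (t \in s)) => [ts'|_]; last by exists (fun=> 0, [::]).
  have [tUU mp sp pt fr] := Hs t ts'.
  have n0 : (0 < nn t)%N by rewrite /nn -subn1 subn_gt0.
  have tZ : t.1 \in Zn (hh 0%N).1 by rewrite hh0; exact: (subvP UZ).
  have [xs x0 vx] := @propagate hh (nn t * l) t.1 (fun i _ => cyc_nxt i) tZ.
  have q0 : t.2`_0 != 0 := coef0_neq0 tU tinj tUU sp pt fr.
  have qn : t.2`_(nn t) != 0 by rewrite -lead_coefE lead_coef_eq0 monic_neq0.
  have xN j : (j <= nn t)%N -> xs (j * l)%N - iter j tau t.1 \in Nn h0.1.
    by apply: iterN => //; rewrite x0 subrr mem0v.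
  have [ys [y0 vy yk]] : exists ys : nat -> V, [/\ ys 0%N - t.1 \in Nn h0.1,
      forall i, (i < nn t * l)%N -> vl (hh i) (hh i.+1) (ys i) (ys i.+1) &
      ((nn t * l <= k)%N -> nbad [seq ys i | i <- iota 0 (nn t * l)] = 0%N)].
    have [ys [vy y0 ye]] : exists ys : nat -> V,
      [/\ (forall i, (i < nn t * l)%N -> vl (hh i) (hh i.+1) (ys i) (ys i.+1)),
        ys 0%N - xs 0%N \in Nn (hh 0%N).1 & \sum_(j < (nn t).+1) t.2`_j *: ys (j * l)%N = 0].
      apply: (cycle_close (ltn0Sn _) hh_per cyc_nxt q0 qn vx).
      rewrite hh0; have -> : \sum_(j < (nn t).+1) t.2`_j *: xs (j * l)%N =
          \sum_(j < (nn t).+1) t.2`_j *: (xs (j * l)%N - iter j tau t.1) + pact tau t.2 t.1.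
        rewrite (@pactE _ _ tau (nn t).+1) ?leqSpred // -big_split; apply: eq_bigr => j _.
        by rewrite /= -scalerDr subrK.
      rewrite pt addr0; apply: rpred_sum => j _; apply: rpredZ; apply: xN.
      by rewrite -ltnS.
    exists ys; split=> // [|_]; first by rewrite -x0 -hh0.
    exact: closed_segment_good n0 q0 qn vy ye.
  have nl0 : (0 < nn t * l)%N by rewrite muln_gt0 n0.
  have [||//|bb [b1 b2 b3]] := @blocks_of_segment hh ys k (nn t * l) k_gt0 nl0.
  - by move=> i lt; split; [exact: cyc_nxt|apply: vy; exact: ltnW].
  - by move=> i lt; have [] := vy i lt.
  by exists (ys, bb).
have {H}[f Hf] := choice H.
exists (flatten [seq (f t).2 | t <- s]).
apply: (@assemble _ s (fun t => (f t).1) nn (fun t => (f t).2)).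
- move=> t j i /Hf[_ v _] lj li; have := v (i + j * l)%N; rewrite -addSn !(hh_perM hh_per); apply.
  by apply: leq_trans (_ : j.+1 * l <= _)%N; rewrite ?leq_mul2r ?lj ?orbT // mulSn ltn_add2r ltnW.
- by move=> t i /Hf[_ v _] /v[].
- by move=> t /Hf[_ _].
- set L := flatten _; rewrite -(addv_idPl (NnZ h0.1)) -addv_diff subv_add addvSr andbT.
  rewrite -/U -(span_basis (X := in_tuple _) bs); apply/span_subvP => x /flatten_mapP[t ts'].
  case/trajectP => j lt ->; have [f0 vf _] := Hf t ts'; have [tUU _ _ _ _] := Hs t ts'.
  rewrite -[iter _ _ _](subKr ((f t).1 (j * l)%N)); apply: memv_add.
    apply: memv_span; apply/allpairsPdep; exists t, j; split=> //.
    by rewrite mem_iota.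
  by rewrite rpredN; apply: (iterN t (f t).1) => //; exact: ltnW.
- rewrite -hdim_diff -/U (size_basis (X := in_tuple _) bs) size_flatten /shape -map_comp sumnE big_map.
  by apply: eq_bigr => t _; rewrite /= size_traject.
Qed.

End CyclicComponent.

End Component.

Lemma component_blocks k h0 c : (0 < k)%N -> component link (h0 :: c) -> alive h0.1 ->
  exists bs, blocks_ok k (h0 :: c) bs.
Proof.
move=> k0; pose hh (i : nat) := nth h0 (h0 :: c) (i %% size (h0 :: c)).
have hn i : (i < size (h0 :: c))%N -> hh i = nth h0 (h0 :: c) i by move=> lt; rewrite /hh modn_small.
have hp i : hh (i + size (h0 :: c))%N = hh i by rewrite /hh modnDr.
case/andP=> p /orP[cy _|/andP[/forallP nl /forallP nf] al].
  exact: cycle_blocks hn hp k0 p cy.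
exact: path_blocks hn k0 p nl nf al.
Qed.

(** The blocks span every alive graded piece, hence [V], and their vectors are as many as the
    dimensions of the graded pieces add up to, that is, the dimension of [V]. *)
Theorem block_basis k : (0 < k)%N -> exists bs : seq (seq V), [/\ basis_of fullv (flatten bs),
  all (fun bk => size bk <= k)%N bs, (forall x, x \in flatten bs -> exists v, x \in X v) &
  (k * \sum_(bk <- bs) nbad bk <= 4 * \dim {:V})%N].
Proof.
move=> k0; pose U := [set n : node | alive n].
have clU (y h : half) : y.1 \in U -> link y h -> h.1 \in U.
  by move=> _ /link_alive; rewrite inE.
have [cs [comp un mem]] := components_exist link_sym link_irr link_fun clU.
have H c : exists bs, c \in cs -> blocks_ok k c bs.
  case: (boolP (c \in cs)) => [cc|_]; last by exists [::].
  have := allP comp _ cc; case: c cc => // h c cc cmp.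
  have al : alive h.1.
    have : h.1 \in U by rewrite -mem map_f //; apply/flattenP; exists (h :: c); rewrite ?mem_head.
    by rewrite inE.
  by have [bs H] := component_blocks k0 cmp al; exists bs.
have {H}[f Hf] := choice H.
pose bs := flatten [seq f c | c <- cs].
have sz : size (flatten bs) = \dim {:V}.
  rewrite /bs size_flatten2 (eq_big_seq (fun c => \sum_(h <- c) hdim h.1)%N); last first.
    by move=> c /Hf[].
  rewrite -big_flatten -sum_hdim (bigID alive) /= [X in (_ + X)%N]big1 ?addn0; last first.
    by move=> n; exact: dead_hdim.
  rewrite -(big_map (fun h : half => h.1) predT hdim) (perm_big (enum U)) /=.
    by rewrite big_enum; apply: eq_bigl => n; rewrite inE.
  by apply: uniq_perm; rewrite ?enum_uniq // => n; rewrite mem_enum mem.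
exists bs; split.
- rewrite basisEdim sz leqnn andbT; apply: spanning => n al.
  have : n \in U by rewrite inE.
  rewrite -mem => /mapP[h /flattenP[c cc hc] ->].
  have [_ _ _ H _] := Hf c cc; apply: subv_trans (H h hc) _.
  by apply: addvS => //; apply: sub_span => x xc; apply/mem_flatten2; exists c.
- by apply/allP => bk /flatten_mapP[c /Hf[/allP H _ _ _ _] b]; exact: (H _ b).
- by move=> x /mem_flatten2[c /Hf[_ H _ _ _]]; exact: H.
- rewrite -sz /bs size_flatten2 big_flatten big_map !big_distrr /=.
  rewrite big_seq [X in (_ <= X)%N]big_seq; apply: leq_sum => c /Hf[_ _ _ _ H].
  exact: H.
Qed.

End StringRepresentation.

(** * Modules over a string algebra *)

Section Sides.
Variables (Q0 Q1 : finType) (src tgt : Q1 -> Q0) (nz : Q1 -> Q1 -> bool).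
Hypothesis out2 : forall v, (#|[set a | src a == v]| <= 2)%N.
Hypothesis in2 : forall v, (#|[set a | tgt a == v]| <= 2)%N.
Hypothesis one_out : forall a, (#|[set b | (src b == tgt a) && nz a b]| <= 1)%N.
Hypothesis one_in : forall a, (#|[set b | (tgt b == src a) && nz b a]| <= 1)%N.

Lemma card_le2 (S : {set Q1}) a b c : (#|S| <= 2)%N -> a \in S -> b \in S -> c \in S ->
  a != c -> b != c -> a = b.
Proof.
move=> le aS bS cS ac bc; apply/eqP; apply: contraLR le => ab; rewrite -ltnNge.
have <- : #|[set a; b; c]| = 3%N.
  by rewrite setUC !cardsU1 cards1 !inE negb_or [c == a]eq_sym [c == b]eq_sym ac bc ab.
apply: subset_leq_card; apply/subsetP => x; rewrite !inE => /orP[/orP[]|] /eqP-> //.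
Qed.

(** The sides of heads are chosen first. If a nonzero composite of [a0] and [b0] passes through a
    vertex, [b0] is put on the side opposite to [a0] and the other outgoing arrow on the side of
    [a0]. A further nonzero composite through one side would give [b0] two predecessors or [a0] two
    successors. *)
Lemma sides_exist : exists ts hs : Q1 -> bool, [/\
  forall a b, src a = src b -> ts a = ts b -> a = b,
  forall a b, tgt a = tgt b -> hs a = hs b -> a = b &
  forall a b, src b = tgt a -> ts b = hs a -> ~~ nz a b].
Proof.
have first (f : Q1 -> Q0) : (forall v, (#|[set a | f a == v]| <= 2)%N) ->
    forall a b, f a = f b -> (Some a == [pick x | f x == f a]) = (Some b == [pick x | f x == f b]) ->
    a = b.
  move=> f2 a b e; rewrite -e; case: pickP => [x /eqP ex|/(_ a)]; last by rewrite eqxx.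
  rewrite !(inj_eq Some_inj); have [-> /esym/eqP-> //|ax /esym/negbT bx] := eqVneq a x.
  by apply: (card_le2 (f2 (f a)) _ _ _ ax bx); rewrite inE ?e ?ex ?e.
pose hs a := Some a == [pick x | tgt x == tgt a].
have hI a b : tgt a = tgt b -> hs a = hs b -> a = b by exact: first in2 a b.
pose pk v := [pick p : Q1 * Q1 | [&& tgt p.1 == v, src p.2 == v & nz p.1 p.2]].
pose ts b := if pk (src b) is Some p then (if b == p.2 then ~~ hs p.1 else hs p.1)
             else Some b == [pick x | src x == src b].
exists ts, hs; split=> // [a b e|a b e].
  rewrite /ts -e /pk; case: pickP => [[a0 b0] /= /and3P[_ /eqP eb _]|_]; last first.
    by rewrite [in X in _ = X]e; exact: first out2 a b e.
  case: (eqVneq a b0) => [->|na]; case: (eqVneq b b0) => [->|nb] //.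
  - by case: (hs a0).
  - by case: (hs a0).
  - by move=> _; apply: (card_le2 (out2 (src a)) _ _ _ na nb); rewrite inE ?eb ?e.
rewrite /ts /pk; case: pickP => [[a0 b0] /= /and3P[/eqP ea /eqP eb n0]|/(_ (a, b))/=]; last first.
  by rewrite e !eqxx /= => ->.
have [->|nb] := eqVneq b b0 => eh; apply/negP => nab.
  have ea0 : a = a0.
    apply/eqP; move: (one_in b0); apply: contraLR => ne; rewrite -ltnNge.
    apply: (@leq_trans #|[set a; a0]|); first by rewrite cards2 ne.
    by apply: subset_leq_card; apply/subsetP => x; rewrite !inE => /orP[] /eqP->;
      rewrite ?nab ?n0 ?ea ?eb ?e ?eqxx.
  by move: eh; rewrite ea0; case: (hs a0).
have ea0 : a0 = a by apply: hI; rewrite ?ea ?e.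
case/eqP: nb; apply/eqP; move: (one_out a); apply: contraLR => ne; rewrite -ltnNge.
apply: (@leq_trans #|[set b; b0]|); first by rewrite cards2 ne.
by apply: subset_leq_card; apply/subsetP => x; rewrite !inE => /orP[] /eqP->;
  rewrite ?nab -?ea0 ?n0 ?ea ?eb ?e ?eqxx.
Qed.

End Sides.

(** * Idempotents, arrows and short paths in the quotient algebra *)

Section PathAlgebraQuotient.
Variables (K : fieldType) (Q : quiver) (I : ideal2 (path_algebra K Q)).
Notation R := (quotient_ring I).
Notation kappa := (quotient_scalar I).
Notation proj := (quotient_proj I).
Implicit Types (p : qpath Q) (a b : arrow Q) (v w : vertex Q).

(* Sealed: unfolding these classes to finitely supported functions makes unification diverge. *)
Lemma qpathR_subproof : {f : qpath Q -> R | f =1 fun p => proj (pbasis K p)}.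
Proof. by exists (fun p => proj (pbasis K p)). Qed.
Definition qpathR : qpath Q -> R := sval qpathR_subproof.
Definition idemR v : R := qpathR (trivial_path v).
Definition arrR a : R := qpathR (arrow_path a).

Lemma qpathRE p : qpathR p = proj (pbasis K p).
Proof. exact: (svalP qpathR_subproof p). Qed.

Lemma arrRE a : arrR a = proj (arr K a).
Proof. exact: qpathRE. Qed.

Lemma kappa_mul k f : kappa k * proj f = proj (k *: f).
Proof. by rewrite /= -rmorphM pa_scalar_mull. Qed.

Lemma kappa_comm k (r : R) : kappa k * r = r * kappa k.
Proof.
rewrite -[r]quotient_reprK kappa_mul.
by rewrite -[LHS]/(proj (k *: _)) -pa_scalar_mulr rmorphM.
Qed.

Lemma proj_eq0 f : f \in I -> proj f = 0.
Proof. by move=> fI; rewrite -[RHS](raddf0 proj); apply/quotient_projP; rewrite subr0. Qed.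

Lemma proj_ind (P : R -> Prop) : P 0 -> (forall x y, P x -> P y -> P (x + y)) ->
  (forall k x, P x -> P (kappa k * x)) -> (forall p, P (qpathR p)) -> forall r, P r.
Proof.
move=> P0 PD PZ Pp r; rewrite -[r]quotient_reprK; move: (repr r) => f.
rewrite [f]pa_basisE; elim: (finmap.enum_fset _) => [|p s IH].
  by rewrite big_nil raddf0; exact: P0.
rewrite big_cons raddfD; apply: PD; last exact: IH.
by have := PZ f@_p _ (Pp p); rewrite qpathRE kappa_mul.
Qed.

Lemma mul_pbasis p q : pbasis K p * pbasis K q = opbasis K (path_comp p q).
Proof. exact: pa_mulU. Qed.

Lemma path_cons v a l (w : walk v (a :: l)) (w' : walk (target a) l) :
  pbasis K (@QPath Q (v, a :: l) w) = pbasis K (@QPath Q (target a, l) w') * arr K a.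
Proof.
have e : path_end (arrow_path a) = path_start (@QPath Q (target a, l) w') by [].
rewrite mul_pbasis; have [r -> er] := path_compE e; congr (pbasis K _).
apply: val_inj; rewrite /= er /path_start /path_arrows /=.
by move: (w) => /= /andP[/eqP -> _].
Qed.

Lemma qpathR_cons v a l (w : walk v (a :: l)) (w' : walk (target a) l) :
  qpathR (@QPath Q (v, a :: l) w) = qpathR (@QPath Q (target a, l) w') * arrR a.
Proof. by rewrite arrRE !qpathRE (path_cons w w') rmorphM. Qed.

Lemma qpathR_nil v (w : walk v [::]) : qpathR (@QPath Q (v, [::]) w) = idemR v.
Proof. by congr qpathR; exact: val_inj. Qed.

Lemma qpathR_ind (P : R -> Prop) : (forall v, P (idemR v)) ->
  (forall a r, P r -> P (r * arrR a)) -> forall p, P (qpathR p).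
Proof.
move=> Pv Pa [[v l] w]; elim: l v w => [|a l IH] v w.
  by rewrite qpathR_nil; exact: Pv.
have w' : walk (target a) l by move: (w) => /= /andP[].
by rewrite (qpathR_cons w w'); apply: Pa; exact: IH.
Qed.

Lemma idem_mul v w : idemR v * idemR w = if v == w then idemR v else 0.
Proof.
rewrite /idemR !qpathRE -rmorphM mul_pbasis path_comp_trivl /path_end /= eq_sym.
case: eqP => [->|_] //; exact: raddf0.
Qed.

Lemma sum_idem : \sum_v idemR v = 1.
Proof.
rewrite -(rmorph1 proj) /= -[1]/(pa_one K Q) raddf_sum.
by apply: eq_bigr => v _; exact: qpathRE.
Qed.

Lemma arr_idem a v : arrR a * idemR v = if v == source a then arrR a else 0.
Proof.
rewrite /arrR /idemR !qpathRE -rmorphM mul_pbasis path_comp_trivr -[path_start _]/(source a).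
by case: eqP => // _; exact: raddf0.
Qed.

Lemma idem_arr a v : idemR v * arrR a = if v == target a then arrR a else 0.
Proof.
rewrite /arrR /idemR !qpathRE -rmorphM mul_pbasis path_comp_trivl -[path_end _]/(target a) eq_sym.
by case: eqP => // _; exact: raddf0.
Qed.

Lemma arr_mul0 a b : (arr K b * arr K a \notin I) = false -> arrR b * arrR a = 0.
Proof. by move=> /negbT; rewrite negbK => /proj_eq0; rewrite !arrRE rmorphM. Qed.

Variable q : nat.
Hypothesis q_nil : forall p, (q <= path_length p)%N -> pbasis K p \in I.

(** As longer paths are 0 in the quotient, the images of these finitely many paths span it over
    [K]. *)
Definition short_paths : seq (qpath Q) :=
  [seq p <- pmap insub [seq (v, l) | v <- enum (vertex Q),
      l <- flatten [seq [seq tval t | t : n.-tuple (arrow Q)] | n <- iota 0 q]]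
  | (path_length p < q)%N].

Lemma mem_short_paths p : (p \in short_paths) = (path_length p < q)%N.
Proof.
rewrite mem_filter; case: ltnP => //= lt; rewrite mem_pmap; apply/mapP.
exists (path_data p); last by rewrite valK.
case: p lt => -[v l] w /= lt; apply/allpairsP; exists (v, l); split=> //; first by rewrite mem_enum.
apply/flatten_mapP; exists (size l); first by rewrite mem_iota.
by apply/mapP; exists (in_tuple l); rewrite ?mem_enum.
Qed.

Lemma short_path_ind (P : R -> Prop) : P 0 -> (forall x y, P x -> P y -> P (x + y)) ->
  (forall k x, P x -> P (kappa k * x)) -> (forall p, p \in short_paths -> P (qpathR p)) ->
  forall r, P r.
Proof.
move=> P0 PD PZ Pp; apply: proj_ind => // p.
have [|le] := ltnP (path_length p) q; first by rewrite -mem_short_paths; exact: Pp.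
by rewrite qpathRE proj_eq0 //; exact: q_nil.
Qed.

End PathAlgebraQuotient.


(** * Coordinates from a finite spanning family *)

Section FiniteDimension.
Variables (K : fieldType) (W : lmodType K).

Definition spanned (L : seq W) x := exists c : nat -> K, x = \sum_(i < size L) c i *: L`_i.

Lemma spanned0 L : spanned L 0.
Proof. by exists (fun=> 0); rewrite big1 // => i _; rewrite scale0r. Qed.

Lemma spannedD L x y : spanned L x -> spanned L y -> spanned L (x + y).
Proof.
move=> [c ->] [d ->]; exists (fun i => c i + d i); rewrite -big_split.
by apply: eq_bigr => i _; rewrite scalerDl.
Qed.

Lemma spannedZ L k x : spanned L x -> spanned L (k *: x).
Proof.
by move=> [c ->]; exists (fun i => k * c i); rewrite scaler_sumr; apply: eq_bigr => i _; rewrite scalerA.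
Qed.

Lemma spanned_mem L x : x \in L -> spanned L x.
Proof.
move=> xL; have lt : (index x L < size L)%N by rewrite index_mem.
exists (fun i => (i == index x L)%:R); rewrite (bigD1 (Ordinal lt)) //= eqxx scale1r nth_index //.
rewrite big1 ?addr0 // => i; rewrite -val_eqE /= => /negPf->.
by rewrite scale0r.
Qed.

Let S n (g : 'I_n -> W) := forall x, exists u : 'rV[K]_n, x = \sum_i u 0 i *: g i.

Lemma drop_generator n (g : 'I_n.+1 -> W) (u : 'rV[K]_n.+1) i :
  S g -> \sum_j u 0 j *: g j = 0 -> u 0 i != 0 -> S (fun j => g (lift i j)).
Proof.
move=> Sg eu ui x; have [v ->] := Sg x.
have gi : g i = - (u 0 i)^-1 *: \sum_j u 0 (lift i j) *: g (lift i j).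
  move: eu; rewrite (bigD1_ord i) //= => /eqP; rewrite addr_eq0 => /eqP e.
  by rewrite -[g i]scale1r -(mulVf ui) -scalerA e scalerN scaleNr.
exists (\row_j (v 0 (lift i j) - v 0 i * (u 0 i)^-1 * u 0 (lift i j))).
rewrite (bigD1_ord i) //= gi scalerA scaler_sumr -big_split; apply: eq_bigr => j _ /=.
by rewrite mxE scalerBl mulrN scaleNr scalerA addrC -mulrA.
Qed.

(** A spanning family of least length is independent, since a linear relation would allow one member
    to be dropped. *)
Lemma spanned_axiom L : (forall x, spanned L x) -> exists n, inhabited (Vector.axiom n W).
Proof.
move=> HL.
have [|n /asboolP[g Sg] nmin] := ex_minnP (P := fun n => `[< exists g : 'I_n -> W, S g >]).
  exists (size L); apply/asboolP; exists (fun i => L`_i) => x; have [c ->] := HL x.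
  by exists (\row_i c i); apply: eq_bigr => i _; rewrite mxE.
pose f (u : 'rV[K]_n) := \sum_i u 0 i *: g i.
have fl : linear f.
  move=> a u v; rewrite /f scaler_sumr -big_split; apply: eq_bigr => i _.
  by rewrite !mxE scalerDl scalerA.
pose F : {linear 'rV[K]_n -> W} := HB.pack f (GRing.isLinear.Build K 'rV[K]_n W _ f fl).
have finj : injective F.
  apply: raddf_inj => u fu; apply/rowP => i; rewrite mxE; apply/eqP/negPn/negP => ui.
  have eu : \sum_j u 0 j *: g j = 0 by exact: fu.
  clear fu F fl f; case: n g Sg nmin u i ui eu => [|n] g Sg nmin u i ui eu; first by case: i ui.
  suff : (n.+1 <= n)%N by rewrite ltnn.
  by apply: nmin; apply/asboolP; exists (fun j => g (lift i j)); exact: drop_generator Sg eu ui.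
have Sg' x : exists u, F u = x by have [u ->] := Sg x; exists u.
have [h hK] := choice Sg'.
have hK' : cancel F h by move=> u; apply: finj; rewrite hK.
exists n; split; exists h; last by exists F.
by move=> a x y; apply: finj; rewrite linearP !hK.
Qed.

End FiniteDimension.

(** * Vectors of a subspace that given maps keep inside it *)

Section Core.
Variables (K : fieldType) (V : vectType K).
Implicit Types (S T Y : {vspace V}) (f : 'End(V)) (fs : seq 'End(V)).

Definition core fs S : {vspace V} := foldr (fun f T => T :&: (f @^-1: S))%VS S fs.

Lemma mem_core fs S x : reflect (x \in S /\ forall f, f \in fs -> f x \in S) (x \in core fs S).
Proof.
elim: fs => [|f fs IH] /=; first by apply: (iffP idP) => [//|[]].
rewrite memv_cap -memv_preim; apply: (iffP andP) => [[/IH[xS H] fx]|[xS H]].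
  by split=> // g; rewrite inE => /orP[/eqP->|/H].
by split; [apply/IH; split=> // g gf; apply: H; rewrite inE gf orbT|apply: H; rewrite mem_head].
Qed.

Lemma core_sub fs S : (core fs S <= S)%VS.
Proof. by apply/subvP => x /mem_core[]. Qed.

(** Modulo the vectors that [f] sends into [S], the space [T] embeds through [f] into
    [(S + Y) / S]. *)
Lemma dim_preim f S T Y c : (T <= S)%VS -> (f @: S <= S + Y)%VS -> (\dim Y <= c)%N ->
  (\dim T <= \dim (T :&: (f @^-1: S)) + c)%N.
Proof.
move=> TS fS dY; set T' := (T :&: _)%VS.
have kT : (T :&: lker f)%VS = (T' :&: lker f)%VS.
  apply: subv_anti; rewrite -capvA; apply/andP; split; last exact: capvS (subvv _) (capvSr _ _).
  apply/subvP => x; rewrite !memv_cap => /andP[-> k]; rewrite k andbT -memv_preim.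
  by move: k; rewrite memv_ker => /eqP->; exact: mem0v.
have iT : (f @: T :&: S <= f @: T')%VS.
  apply/subvP => _ /memv_capP[/memv_imgP[x xT ->] fxS]; apply: memv_img.
  by rewrite memv_cap xT -memv_preim.
rewrite -(limg_ker_dim f T) -(limg_ker_dim f T') kT -addnA leq_add2l.
have s : (f @: T + S <= S + Y)%VS.
  by rewrite subv_add addvSl andbT; apply: subv_trans (limgS f TS) fS.
have := dimv_sum_cap (f @: T) S; have := dimvS s; have := dimvS iT.
have := dimv_add_leqif S Y => /leqifP; case: ifP => _; first move=> /eqP.
all: move: dY; clear; lia.
Qed.

Lemma dim_core fs S c : (forall f, f \in fs -> exists2 Y, (f @: S <= S + Y)%VS & (\dim Y <= c)%N) ->
  (\dim S <= \dim (core fs S) + size fs * c)%N.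
Proof.
elim: fs => [|f fs IH] H; first by rewrite addn0.
have [Y fY dY] := H f (mem_head _ _).
have {}IH := IH (fun g gf => H g (@mem_behead _ (f :: fs) _ gf)).
apply: leq_trans IH _; rewrite /= mulSn addnA leq_add2r.
exact: dim_preim (core_sub _ _) fY dY.
Qed.

End Core.

(** * Modules as representations, and submodules inside the spans of blocks *)

Section ModuleBlocks.
Variables (K : fieldType) (Q : quiver) (I : ideal2 (path_algebra K Q)).
Notation R := (quotient_ring I).
Notation kappa := (quotient_scalar I).
Variables (M : lmodType R) (n : nat) (ax : Vector.axiom n (restr_lmod kappa M)).

Definition vmod : vectType K := HB.pack (restr_lmod kappa M)
  (Lmodule_hasFinDim.Build K (restr_lmod kappa M) ax).

Definition act (r : R) (x : vmod) : vmod := r *: (x : M).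

Lemma vmod_scaleE (k : K) (x : vmod) : k *: x = kappa k *: (x : M).
Proof. by []. Qed.

Lemma act_is_linear r : linear (act r).
Proof.
move=> k x y; rewrite /act [LHS]scalerDr; congr (_ + _).
by rewrite !vmod_scaleE !scalerA kappa_comm.
Qed.
HB.instance Definition _ r := GRing.isLinear.Build K vmod vmod _ (act r) (act_is_linear r).

Lemma actM r s x : act (r * s) x = act r (act s x).
Proof. by rewrite /act scalerA. Qed.

Lemma actD r s x : act (r + s) x = act r x + act s x.
Proof. exact: (@scalerDl R M x r s). Qed.

Lemma act0 x : act 0 x = 0. Proof. exact: (@scale0r R M x). Qed.

Lemma act1 x : act 1 x = x. Proof. exact: (@scale1r R M x). Qed.

Lemma act_kappa k r x : act (kappa k * r) x = k *: act r x.
Proof. by rewrite actM. Qed.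

Lemma act_sum (J : finType) (F : J -> R) x : act (\sum_j F j) x = \sum_j act (F j) x.
Proof. exact: (@scaler_suml R M x). Qed.

Definition lact r : 'End(vmod) := linfun (act r).

Lemma lactE r x : lact r x = act r x. Proof. exact: lfunE. Qed.

Let X v : {vspace vmod} := limg (lact (idemR I v)).

Lemma mem_X v x : (x \in X v) = (act (idemR I v) x == x).
Proof.
apply/idP/eqP => [/memv_imgP[y _ ->]|<-]; last by rewrite -lactE memv_img ?memvf.
by rewrite lactE -actM idem_mul eqxx.
Qed.

Lemma X_sum : (\sum_v X v = fullv)%VS.
Proof.
apply: subv_anti; rewrite subvf; apply/subvP => x _.
rewrite -[x]act1 -(sum_idem I) act_sum; apply: memv_sumr => v _.
by rewrite mem_X -actM idem_mul eqxx.
Qed.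

Lemma X_dim : (\sum_v \dim (X v))%N = \dim {:vmod}.
Proof.
rewrite -X_sum; apply/esym/eqP; have : directv (\sum_v X v); last by rewrite directvE.
apply/directv_sum_independent => us uX us0 v _.
have := congr1 (act (idemR I v)) us0; rewrite linear_sum linear0 (bigD1 v) //= big1 => [|w nw].
  by move: (uX v isT); rewrite mem_X addr0 => /eqP ->.
by move: (uX w isT); rewrite mem_X => /eqP <-; rewrite -actM idem_mul eq_sym (negPf nw) act0.
Qed.

Hypothesis str : string_ideal I.

Lemma module_blocks k : (0 < k)%N -> exists bs : seq (seq vmod),
  [/\ basis_of fullv (flatten bs), all (fun bk => size bk <= k)%N bs,
    (forall x, x \in flatten bs -> exists v, act (idemR I v) x = x) &
    (k * \sum_(bk <- bs) nbad (fun a => lact (arrR I a)) bk <= 4 * \dim {:vmod})%N].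
Proof.
move=> k0; have [_ deg2 one_o one_i _] := str.
have [ts [hs [tsI hsI sd]]] := @sides_exist _ _ (@source Q) (@target Q)
  (fun a b => arr K b * arr K a \notin I) (fun v => (deg2 v).1) (fun v => (deg2 v).2) one_o one_i.
have [||| bs [b1 b2 b3 b4]] := @block_basis K vmod _ _ (@source Q) (@target Q) X
  (fun a => lact (arrR I a)) ts hs _ tsI hsI _ X_dim X_sum _ k k0.
- move=> a; apply/subvP => _ /memv_imgP[x xX ->].
  by rewrite mem_X !lactE -actM idem_arr eqxx.
- by move=> a b e1 e2 x _; rewrite !lactE -actM arr_mul0 ?act0 //; exact: negbTE (sd a b e1 e2).
- move=> a v x; rewrite mem_X => /eqP <- nv.
  by rewrite lactE -actM arr_idem (negPf nv) act0.
exists bs; split=> // x /b3[v]; rewrite mem_X => /eqP; by exists v.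
Qed.

Variable q : nat.
Hypothesis q_nil : forall p : qpath Q, (q <= path_length p)%N -> pbasis K p \in I.
Notation paths := (short_paths Q q).

(** The largest submodule contained in [S]; testing the short paths suffices because they span the
    algebra. *)
Definition pcore (S : {vspace vmod}) : {vspace vmod} := core [seq lact (qpathR I p) | p <- paths] S.

Lemma mem_pcore (S : {vspace vmod}) x : x \in pcore S -> x \in S /\ forall r, act r x \in S.
Proof.
case/mem_core => xS H; split=> //; apply: (short_path_ind q_nil).
- by rewrite act0 mem0v.
- by move=> r s rS sS; rewrite actD rpredD.
- by move=> c r rS; rewrite act_kappa rpredZ.
- by move=> p ps; rewrite -lactE; apply: H; exact: map_f.
Qed.

Lemma pcore_mem (S : {vspace vmod}) x : (forall r, act r x \in S) -> x \in pcore S.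
Proof.
move=> H; apply/mem_core; split; first by rewrite -[x]act1.
by move=> _ /mapP[p _ ->]; rewrite lactE.
Qed.

Lemma pcore_act (S : {vspace vmod}) r x : x \in pcore S -> act r x \in pcore S.
Proof. by case/mem_pcore => _ H; apply: pcore_mem => s; rewrite -actM. Qed.

(** Each arrow of the path adds at most the images of the bad vectors of the block. Trivial paths
    add nothing, as each vector of the block belongs to one vertex and is fixed or killed by an
    idempotent. *)
Lemma path_defect (bk : seq vmod) p : (forall x, x \in bk -> exists v, act (idemR I v) x = x) ->
  exists2 Y, (lact (qpathR I p) @: <<bk>> <= <<bk>> + Y)%VS &
    (\dim Y <= path_length p * nbad (fun a => lact (arrR I a)) bk)%N.
Proof.
move=> hom; set S := <<bk>>%VS; set m := nbad _ _.
case: p => -[v l] w; elim: l v w => [|a l IH] v w.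
  exists 0%VS; last by rewrite dimv0.
  rewrite addv0 limg_span; apply/span_subvP => _ /mapP[x xb ->]; rewrite lactE.
  have [u eu] := hom x xb; rewrite qpathR_nil -eu -actM idem_mul.
  case: eqP => [->|_]; last by rewrite act0 mem0v.
  by rewrite eu memv_span.
have w' : walk (target a) l by move: (w) => /= /andP[].
have [Y sY dY] := IH (target a) w'; set f := lact (qpathR I (@QPath Q (target a, l) w')) in sY.
pose B := <<[seq lact (arrR I a) x | x <- bk & bad (fun a => lact (arrR I a)) bk x]>>%VS.
exists (Y + f @: B)%VS; last first.
  rewrite mulSn addnC (leq_trans (dimv_add_leqif _ _)) // leq_add //.
  apply: (@leq_trans (\dim B)); first by rewrite -(limg_ker_dim f B) leq_addl.
  apply: leq_trans (dim_span _) _.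
  by rewrite size_map size_filter.
have -> : lact (qpathR I (@QPath Q (v, a :: l) w)) = (f \o lact (arrR I a))%VF.
  by apply/lfunP => x; rewrite comp_lfunE !lactE -actM (qpathR_cons I w w').
rewrite limg_comp; have aS : (lact (arrR I a) @: S <= S + B)%VS.
  rewrite limg_span; apply/span_subvP => _ /mapP[x xb ->].
  have [bx|/existsPn/(_ a)] := boolP (bad (fun a => lact (arrR I a)) bk x).
    apply: (subvP (addvSr _ _)); apply: memv_span; apply: map_f.
    by rewrite mem_filter bx.
  by rewrite negbK => h; apply: (subvP (addvSl _ _)).
apply: subv_trans (limgS f aS) _; rewrite limgD addvA; exact: addvS.
Qed.

Lemma dim_pcore (bk : seq vmod) : (forall x, x \in bk -> exists v, act (idemR I v) x = x) ->
  (\dim <<bk>> <= \dim (pcore <<bk>>) +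
    size paths * (q * nbad (fun a => lact (arrR I a)) bk))%N.
Proof.
move=> hom; rewrite -(size_map (fun p => lact (qpathR I p))); apply: dim_core => _ /mapP[p ps ->].
have [Y sY dY] := path_defect p hom; exists Y => //; apply: leq_trans dY _.
by rewrite leq_mul2r; rewrite mem_short_paths in ps; rewrite (ltnW ps) orbT.
Qed.

End ModuleBlocks.

(** * Finitely many modules of bounded dimension over a finite field *)

Section Codes.
Variables (K : finFieldType) (Q : quiver) (I : ideal2 (path_algebra K Q)).
Notation R := (quotient_ring I).
Notation kappa := (quotient_scalar I).

Definition gen (g : vertex Q + arrow Q) : R :=
  match g with inl v => idemR I v | inr a => arrR I a end.

(* The underlying set and the action of the generators of a module embedded in ['rV[K]_k]. *)
Definition code k : finType :=
  ({set 'rV[K]_k} * {ffun (vertex Q + arrow Q) * 'rV[K]_k -> 'rV[K]_k})%type.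

Definition realizes k (c : code k) (N : lmodType R) := exists phi : N -> 'rV[K]_k,
  [/\ forall a x y, phi (kappa a *: x + y) = a *: phi x + phi y, injective phi,
    forall u, u \in c.1 <-> exists x, phi x = u &
    forall g x, phi (gen g *: x) = c.2 (g, phi x)].

Lemma partial_inverse (T : Type) (N : lmodType R) (phi : N -> T) : injective phi ->
  forall u, exists z, forall x, phi x = u -> z = x.
Proof.
move=> phii u; have [[x e]|ne] := pselect (exists x, phi x = u).
  by exists x => y ey; apply: phii; rewrite e ey.
by exists 0 => y ey; case: ne; exists y.
Qed.

Lemma code_exists k d (N : lmodType R) : Vector.axiom d (restr_lmod kappa N) -> (d <= k)%N ->
  exists c : code k, realizes c N.
Proof.
(* Coordinate vectors of length [d] are padded with zeros to length [k]. *)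
move=> [f fl [f' fK f'K]] le; pose phi (x : N) : 'rV[K]_k := \row_i oapp (f x 0) 0 (insub (val i)).
have phil a x y : phi (kappa a *: x + y) = a *: phi x + phi y.
  apply/rowP => i; rewrite !mxE; case: insubP => [j _ _|_] /=; last by rewrite mulr0 addr0.
  by have := fl a x y => /rowP/(_ j); rewrite !mxE => <-.
have phii : injective phi.
  move=> x y e; apply: (can_inj fK); apply/rowP => j; have lt := leq_trans (ltn_ord j) le.
  have := congr1 (fun u : 'rV_k => u 0 (Ordinal lt)) e; rewrite !mxE /=.
  by case: insubP => [j' _ ej|]; rewrite ?ltn_ord //=; have -> : j' = j by exact: val_inj.
have [g Hg] := choice (partial_inverse phii).
exists ([set u | `[< exists x, phi x = u >]], [ffun p => phi (gen p.1 *: g p.2)]), phi.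
split=> // [u|h x]; first by rewrite inE; split=> /asboolP.
by rewrite ffunE /= (Hg _ x).
Qed.

(** The two embeddings have the same image, so one followed by the inverse of the other is a
    bijection. It commutes with scalars, idempotents and arrows, hence with the whole algebra. *)
Lemma realizes_iso k (c : code k) (N N' : lmodType R) : realizes c N -> realizes c N' ->
  exists f : {linear N -> N'}, bijective f.
Proof.
move=> [f [fl fi fs fg]] [f' [fl' fi' fs' fg']].
have H x : exists y, f' y = f x by apply/fs'/fs; exists x.
have H' y : exists x, f x = f' y by apply/fs/fs'; exists y.
have [h hK] := choice H; have [h' hK'] := choice H'.
have hD x y : h (x + y) = h x + h y.
  by apply: fi'; have := fl' 1 (h x) (h y); have := fl 1 x y;
     rewrite rmorph1 !scale1r !hK => -> ->.
have h0 : h 0 = 0 by apply: (addrI (h 0)); rewrite -hD !addr0.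
have hkappa a x : h (kappa a *: x) = kappa a *: h x.
  apply: fi'; have := fl' a (h x) 0; have := fl a x 0; rewrite !addr0 !hK => ->.
  have f0 : f 0 = 0.
    by apply: (addrI (f 0)); have := fl 1 0 0; rewrite rmorph1 !scale1r !addr0 => <-.
  have f'0 : f' 0 = 0 by rewrite -h0 hK f0.
  by rewrite f0 f'0 !addr0 => ->.
have hg g x : h (gen g *: x) = gen g *: h x by apply: fi'; rewrite fg' !hK fg.
have hZ r : forall x, h (r *: x) = r *: h x.
  elim/proj_ind: r => [x|r s IHr IHs x|a r IH x|p].
  - by rewrite !scale0r.
  - by rewrite !scalerDl hD IHr IHs.
  - by rewrite -!scalerA hkappa IH.
  move: p; apply: (qpathR_ind (P := fun r => forall x, h (r *: x) = r *: h x)) => [v x|a r IH x].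
    exact: (hg (inl v)).
  by rewrite -!scalerA IH (hg (inr a)).
have hl : linear h by move=> r x y; rewrite hD hZ.
pose hlin : {linear N -> N'} := HB.pack h (GRing.isLinear.Build R N N' _ h hl).
exists hlin; exists h' => x.
  by apply: fi; rewrite hK'; exact: hK.
by apply: fi'; rewrite [LHS]hK hK'.
Qed.

Lemma realizes_fin_gen k (c : code k) (N : lmodType R) : realizes c N -> fin_gen N.
Proof.
case=> phi [phil phii _ _].
have [g Hg] := choice (partial_inverse phii).
exists #|{: 'rV[K]_k}|, (fun i => g (enum_val i)) => m.
exists (fun i => if i == enum_rank (phi m) then 1 else 0).
rewrite (bigD1 (enum_rank (phi m))) //= eqxx scale1r enum_rankK (Hg _ m) // big1 ?addr0 //.
by move=> i /negPf->; rewrite scale0r.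
Qed.

Lemma regular_fin_gen : fin_gen (R^o : lmodType R).
Proof.
by exists 1%N, (fun=> 1) => m; exists (fun=> m); rewrite big_ord1 [RHS]mulr1.
Qed.

(** One module is selected for each code; codes realized by no module receive the regular module as
    a placeholder. *)
Lemma models_exist k : exists N : code k -> lmodType R, (forall c, fin_gen (N c)) /\
  forall c N', realizes c N' -> realizes c (N c).
Proof.
have H (c : code k) : exists N : lmodType R, fin_gen N /\ forall N', realizes c N' -> realizes c N.
  have [[N rN]|nN] := pselect (exists N, realizes c N).
    by exists N; split=> //; exact: realizes_fin_gen rN.
  exists (R^o : lmodType R); split; first exact: regular_fin_gen.
  by move=> N' rN'; case: nN; exists N'.
have [N HN] := choice H.
by exists N; split=> c; have [] := HN c.
Qed.

End Codes.

Section Submodules.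
Variables (K : fieldType) (Q : quiver) (I : ideal2 (path_algebra K Q)).
Notation R := (quotient_ring I).
Notation kappa := (quotient_scalar I).
Variables (M : lmodType R) (n : nat) (ax : Vector.axiom n (restr_lmod kappa M)).
Variables (W : {vspace vmod ax}).
Hypothesis W_act : forall r x, x \in W -> act r x \in W.

Definition in_vspace (x : M) : bool := (x : vmod ax) \in W.

Lemma in_vspace_closed : GRing.subsemimod_closed in_vspace.
Proof.
split; first by split; [exact: mem0v | move=> x y xW yW; exact: (memvD xW yW)].
by move=> r x xW; exact: (W_act r xW).
Qed.

Definition vsubmod : submodClosed M :=
  HB.pack in_vspace (GRing.isSubmodClosed.Build R M in_vspace in_vspace_closed).

Lemma vsubmod_axiom : Vector.axiom (\dim W) (restr_lmod kappa (submodule vsubmod)).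
Proof.
pose f (x : restr_lmod kappa (submodule vsubmod)) : 'rV[K]_(\dim W) :=
  \row_i coord (vbasis W) i (submodule_val (x : submodule vsubmod) : vmod ax).
exists f; first by move=> a x y; apply/rowP => i; rewrite !mxE -linearP.
have mem (u : 'rV[K]_(\dim W)) : (\sum_i u 0 i *: (vbasis W)`_i : vmod ax) \in W.
  by apply: rpred_sum => i _; apply: rpredZ; apply: vbasis_mem; rewrite mem_nth // size_tuple.
exists (fun u => @Submodule R M vsubmod _ (mem u)) => [x|u].
  apply: val_inj => /=; rewrite [RHS](coord_basis (vbasisP W) (submodule_mem x)).
  by apply: eq_bigr => i _; rewrite mxE.
apply/rowP => i; rewrite mxE /= linear_sum (bigD1 i) //= big1 => [|j nj].
  by rewrite linearZ /= coord_free ?eqxx ?mulr1 ?addr0 // (basis_free (vbasisP W)).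
rewrite linearZ /= coord_free ?(basis_free (vbasisP W)) //.
by move: nj; rewrite -val_eqE /= => /negPf ->; rewrite mulr0.
Qed.

End Submodules.

(** * Internal direct sums with prescribed isomorphism types *)

Section DirectSumDecomposition.
Variables (R : pzRingType) (M : lmodType R) (P : submodClosed M).
Variables (J : finType) (t : nat) (N : 'I_t -> lmodType R) (c : J -> 'I_t).
(** The type index [i] is kept apart from [c j] to avoid transport along equalities between types;
    [theta i j] is meaningful when [c j = i]. *)
Variable theta : forall i, J -> {linear N i -> M}.
Hypothesis theta_inj : forall i j, c j = i -> injective (theta i j).
Hypothesis theta_indep : forall x : J -> M, (forall j, exists y, x j = theta (c j) j y) ->
  \sum_j x j = 0 -> forall j, x j = 0.
Hypothesis theta_sum : forall x : M, x \in P <->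
  exists2 y : J -> M, (forall j, exists z, y j = theta (c j) j z) & x = \sum_j y j.

Let A i := [set j | c j == i].
Let T := dsum (fun i => ({ffun 'I_#|A i| -> N i} : lmodType R)).

Let Phi (f : T) : M := \sum_i \sum_(l < #|A i|) theta i (enum_val l) (f i l).

Let Phi_linear : linear Phi.
Proof.
move=> a f g; rewrite /Phi scaler_sumr -big_split; apply: eq_bigr => i _ /=.
rewrite scaler_sumr -big_split; apply: eq_bigr => l _ /=.
by rewrite -linearP; congr (theta _ _ _); rewrite !ffunE.
Qed.

Let c_enum i (l : 'I_#|A i|) : c (enum_val l) = i.
Proof. by apply/eqP; have := enum_valP l; rewrite inE. Qed.

Let enum_c j : exists l : 'I_#|A (c j)|, enum_val l = j.
Proof.
have jA : j \in A (c j) by rewrite inE.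
by exists (enum_rank_in jA j); rewrite enum_rankK_in.
Qed.

Let Phi_parts f : exists w : J -> M, [/\ forall j, exists y, w j = theta (c j) j y,
  Phi f = \sum_j w j & forall i (l : 'I_#|A i|), w (enum_val l) = theta i (enum_val l) (f i l)].
Proof.
pose w j := \sum_i \sum_(l < #|A i|)
  (if j == enum_val l then theta i (enum_val l) (f i l) else 0).
have wE i (l : 'I_#|A i|) : w (enum_val l) = theta i (enum_val l) (f i l).
  rewrite /w (bigD1 i) //= [X in _ + X]big1 => [|i' ni]; last first.
    apply: big1 => l' _; case: eqP => // e; case/eqP: ni.
    by rewrite -(c_enum l') -e c_enum.
  rewrite addr0 (bigD1 l) //= eqxx big1 ?addr0 // => l' nl.
  by rewrite (inj_eq enum_val_inj) eq_sym (negPf nl).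
exists w; split=> // [j|].
  by have [l el] := enum_c j; exists (f (c j) l); have := wE _ l; rewrite el.
rewrite /w exchange_big /=; apply: eq_bigr => i _; rewrite exchange_big /=.
by apply: eq_bigr => l _; rewrite -big_mkcond big_pred1_eq.
Qed.

Let Phi_inj f : Phi f = 0 -> f = 0.
Proof.
have [w [w1 -> wE]] := Phi_parts f => /(theta_indep w1) w0.
apply/ffunP => i; apply/ffunP => l; rewrite !ffunE.
by apply: (theta_inj (c_enum l)); rewrite -wE w0 linear0.
Qed.

Let Phi_surj x : x \in P -> exists f, Phi f = x.
Proof.
move/theta_sum => [y Hy ->].
have H i j : exists z, c j = i -> theta i j z = y j.
  have [e|ne] := eqVneq (c j) i; last by exists 0 => e; rewrite e eqxx in ne.
  by subst i; have [z ->] := Hy j; exists z.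
exists ([ffun i => [ffun l : 'I_#|A i| => sval (cid (H i (enum_val l)))]] : T).
rewrite /Phi (partition_big c xpredT) //=; apply: eq_bigr => i _.
transitivity (\sum_(j in A i) y j); last by apply: eq_bigl => j; rewrite inE.
rewrite [RHS]big_enum_val; apply: eq_bigr => l _; rewrite !ffunE.
by case: cid => z /= ->.
Qed.

Lemma direct_sum_iso : iso_mod (submodule P) T.
Proof.
have H (x : submodule P) : exists f, Phi f = submodule_val x.
  by apply: Phi_surj; exact: submodule_mem.
have [g Hg] := choice H.
have Phi_can f f' : Phi f = Phi f' -> f = f'.
  move=> e; apply/eqP; rewrite -subr_eq0; apply/eqP/Phi_inj.
  have := Phi_linear (-1) f' f; rewrite !scaleN1r [- f' + f]addrC => ->.
  by rewrite e addNr.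
have gl : linear g.
  by move=> a x y; apply: Phi_can; rewrite Phi_linear !Hg.
pose G : {linear submodule P -> T} := HB.pack g (GRing.isLinear.Build R (submodule P) T _ g gl).
have PP f : Phi f \in P.
  by have [w [w1 -> _]] := Phi_parts f; apply/theta_sum; exists w.
exists G; exists (fun f => Submodule (PP f)) => [x|f].
  by apply: val_inj; rewrite /= Hg.
by apply: Phi_can; rewrite [LHS]Hg.
Qed.

End DirectSumDecomposition.

(** * The submodule of a finitely generated module, and the final estimate *)

Section SubmoduleOfBlocks.
Variables (K : finFieldType) (Q : quiver) (I : ideal2 (path_algebra K Q)).
Notation R := (quotient_ring I).
Notation kappa := (quotient_scalar I).
Hypothesis str : string_ideal I.
Variable q : nat.
Hypothesis q_nil : forall p : qpath Q, (q <= path_length p)%N -> pbasis K p \in I.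
Notation paths := (short_paths Q q).

(** The products of short paths with module generators span over [K]. *)
Lemma fin_gen_axiom (M : lmodType R) : fin_gen M ->
  exists n, inhabited (Vector.axiom n (restr_lmod kappa M)).
Proof.
move=> [m [g Hg]].
pose L : seq (restr_lmod kappa M) := [seq qpathR I p *: g i | p <- paths, i <- enum 'I_m].
apply: (@spanned_axiom K (restr_lmod kappa M) L) => x; have [c ->] := Hg x.
have L0 : spanned L (0 : M) := spanned0 L.
have LD (y z : M) : spanned L y -> spanned L z -> spanned L (y + z : M).
  by move=> Ly Lz; exact: (spannedD Ly Lz).
apply: (big_ind (fun y : M => spanned L y)) => // i _.
move: (c i); apply: (short_path_ind q_nil) => [|r s rL sL|a r rL|p pp].
- by rewrite scale0r.
- by rewrite scalerDl; exact: LD.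
- by rewrite -scalerA; exact: (spannedZ a rL).
- by apply: spanned_mem; apply/allpairsP; exists (p, i); rewrite pp mem_enum.
Qed.

Variables (k : nat) (N : code K Q k -> lmodType R).
Hypothesis k_gt0 : (0 < k)%N.
Hypothesis N_model : forall c (N' : lmodType R), realizes c N' -> realizes c (N c).
Variables (M : lmodType R) (n : nat) (ax : Vector.axiom n (restr_lmod kappa M)).

(** [P] is the sum of the cores of the blocks. The sum is direct because the spans of the blocks are
    independent, so the codimensions add up; [alpha i] counts the blocks whose core has the code
    numbered [i]. *)
Lemma block_submodule : exists (P : submodClosed M) (alpha : 'I_#|code K Q k| -> nat) (d s : nat),
  [/\ has_dimK kappa (submodule P) d, (n <= d + size paths * q * s)%N, (k * s <= 4 * n)%N &
    iso_mod (submodule P) (dsum (fun i => ({ffun 'I_(alpha i) -> N (enum_val i)} : lmodType R)))].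
Proof.
have [bs [bas szk hom nb]] := module_blocks ax str k_gt0.
pose J := 'I_(size bs); pose S (j : J) : {vspace vmod ax} := <<nth [::] bs j>>%VS.
pose W (j : J) := pcore q (S j).
have dimV : \dim {:vmod ax} = n by rewrite dimvf.
have sizeS : (\sum_(j < size bs) size (nth [::] bs j))%N = \dim {:vmod ax}.
  rewrite (size_basis (X := in_tuple _) bas).
  by rewrite size_flatten sumnE /shape big_map (big_nth [::]) big_mkord.
have sumS : (\sum_j S j = fullv)%VS.
  rewrite -(span_basis (X := in_tuple _) bas) /=; apply: subv_anti; apply/andP; split.
    apply/subv_sumP => j _; apply: sub_span => x xj; apply/flattenP; exists (nth [::] bs j) => //.
    exact: mem_nth.
  apply/span_subvP => x /flattenP[bk /(nthP [::])[j lt <-] xj].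
  by apply: (subvP (sumv_sup (Ordinal lt) _ (subvv _))) => //; exact: memv_span.
have dS : directv (\sum_j S j).
  rewrite directvE /= eqn_leq dimv_leq_sum /= sumS -sizeS.
  by apply: leq_sum => j _; exact: dim_span.
have indep (x : J -> vmod ax) : (forall j, x j \in W j) -> \sum_j x j = 0 -> forall j, x j = 0.
  move=> xW x0 j; have /directv_sum_independent H := dS.
  apply: (H x) => // i _; exact: (subvP (core_sub _ _)) (xW i).
have dW : directv (\sum_j W j).
  by apply/directv_sum_independent => us uW u0 j _; apply: (indep us) => // i; exact: uW.
have stabW j r x : x \in W j -> act r x \in W j by exact: pcore_act.
pose T : {vspace vmod ax} := (\sum_j W j)%VS.
have stabT r x : x \in T -> act r x \in T.
  case/memv_sumP => us uW ->; rewrite linear_sum; apply: memv_sumr => j _; apply: stabW.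
  exact: uW.
have [c Hc] : exists c : J -> code K Q k, forall j, realizes (c j) (submodule (vsubmod (stabW j))).
  have H j : exists cj : code K Q k, realizes cj (submodule (vsubmod (stabW j))).
    apply: code_exists (vsubmod_axiom (stabW j)) _.
    apply: leq_trans (dimvS (core_sub _ _)) _; apply: leq_trans (dim_span _) _.
    by apply: (allP szk); exact: mem_nth.
  by have [c Hc] := choice H; exists c.
pose cr j := enum_rank (c j).
(* For a pair whose code does not match, the zero map is a default value. *)
have Hth (ij : 'I_#|code K Q k| * J) : exists th : {linear N (enum_val ij.1) -> M}, cr ij.2 = ij.1 ->
    injective th /\ forall x : M, in_vspace (W ij.2) x <-> exists y, x = th y.
  case: ij => i j /=; have [e|ne] := eqVneq (cr j) i; last first.
    by exists \0 => e; rewrite e eqxx in ne.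
  have rs : realizes (enum_val i) (submodule (vsubmod (stabW j))) by rewrite -e enum_rankK.
  have [f [f' fK f'K]] := realizes_iso (N_model rs) rs.
  pose v : {linear submodule (vsubmod (stabW j)) -> M} := val.
  exists (v \o f) => _; split; first by apply: inj_comp; [exact: val_inj|exact: can_inj fK].
  move=> x; split=> [xW|[y ->]]; last exact: submodule_mem (f y).
  by exists (f' (Submodule (P := vsubmod (stabW j)) xW)); rewrite /= f'K.
have [th thP] : {th : forall ij : 'I_#|code K Q k| * J, {linear N (enum_val ij.1) -> M} &
    forall ij, cr ij.2 = ij.1 -> injective (th ij) /\
      forall x : M, in_vspace (W ij.2) x <-> exists y, x = th ij y}.
  by exists (fun ij => sval (cid (Hth ij))) => ij; case: cid.
pose theta (i : 'I_#|code K Q k|) (j : J) : {linear N (enum_val i) -> M} := th (i, j).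
have th_mem j (x : M) : in_vspace (W j) x <-> exists y, x = theta (cr j) j y.
  by have [_ H] := thP (cr j, j) erefl; exact: H.
exists (vsubmod stabT), (fun i => #|[set j | cr j == i]|), (\dim T).
exists (\sum_(bk <- bs) nbad (fun a => lact ax (arrR I a)) bk)%N; split.
- by split; exact: vsubmod_axiom.
- move/directvP: dW => /= dT; rewrite -/T in dT.
  apply: leq_trans (eq_leq (esym dimV)) _.
  rewrite dT (big_nth [::]) big_mkord big_distrr /= -big_split /= -sumS.
  apply: (@leq_trans (\sum_j \dim (S j))%N); first exact: dimv_leq_sum.
  apply: leq_sum => j _.
  rewrite -mulnA; apply: dim_pcore => x xj; apply: hom.
  by apply/flattenP; exists (nth [::] bs j) => //; exact: mem_nth.
- by move: nb; rewrite dimV.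
apply: (@direct_sum_iso R M (vsubmod stabT) J _ (fun i => N (enum_val i)) cr theta).
- by move=> i j e; have [] := thP (i, j) e.
- by move=> x xW x0; apply: (indep x) => // j; apply/th_mem; exact: xW.
- move=> x; split.
    case/memv_sumP => us uW ->; exists us => // j; apply/th_mem; exact: uW.
  case=> y yW ->; have : \sum_j (y j : vmod ax) \in T.
    by apply: memv_sumr => j _; apply/th_mem; exact: yW.
  exact.
Qed.

End SubmoduleOfBlocks.

Theorem proposition10p1 (Re : realType) (K : finFieldType) (Q : quiver)
    (I : ideal2 (path_algebra K Q)) (hI : string_ideal I) :
  hyperfinite_type Re (quotient_scalar I).
Proof.
move=> eps eps0; have [_ _ _ _ [q _ q_nil]] := hI.
set C := (size (short_paths Q q) * q)%N.
(* With [s] bad vectors in all, the codimension is at most [C * s], where [k * s <= 4 * n]; so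
   [k >= 4 C / eps] bounds it by [eps * n]. The successor keeps [k] positive. *)
pose k := (Num.bound (4%:R * C%:R / eps)).+1.
have k_big : 4%:R * C%:R <= eps * k%:R :> Re.
  rewrite [eps * _]mulrC -ler_pdivrMr //; apply/ltW.
  have /archi_boundP h : 0 <= 4%:R * C%:R / eps by rewrite divr_ge0 ?mulr_ge0 ?ler0n // ltW.
  by apply: lt_le_trans h _; rewrite ler_nat.
have [N [Nfg Nmod]] := models_exist I k.
exists #|code K Q k|, (fun i => N (enum_val i)); split=> [i|M fgM]; first exact: Nfg.
have [n [ax]] := fin_gen_axiom q_nil fgM.
have [P [alpha [d [s [dP le1 le2 iso]]]]] := block_submodule hI q_nil (ltn0Sn _ : (0 < k)%N) Nmod ax.
exists P, alpha; split=> //; exists d, n; split; [exact: dP|exact: inhabits|].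
move: le1 le2; rewrite -/C -(ler_nat Re) -[(k * s <= _)%N](ler_nat Re) natrD.
rewrite (natrM _ C s) (natrM _ k s) (natrM _ 4 n) => le1 le2.
have k0 : 0 < k%:R :> Re by rewrite ltr0n.
have le3 : C%:R * s%:R <= eps * n%:R :> Re.
  rewrite -(ler_pM2l k0) mulrCA; apply: le_trans (ler_wpM2l (ler0n _ _) le2) _.
  by rewrite mulrCA mulrA [X in _ <= X]mulrA [k%:R * eps]mulrC ler_wpM2r ?ler0n.
by rewrite mulrBl mul1r lerBlDr (le_trans le1) // lerD2l.
Qed.
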